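(* Let $(Q,\le)$ be a non-empty well-quasi-order. Then $o(i^F_{\omega^\omega}(Q)) = o(\mathsf{T_f}(Q)) = g(o(Q))$, where $g(1)=\omega$ and $g(\alpha)=\bar\varepsilon(-2+\alpha)$ for $\alpha\ge2$.
   Context: A quasi-order is a set with a reflexive, transitive relation. It is a well-quasi-order (wqo) if every infinite sequence $(x_i)_{i<\omega}$ has $i<j$ with $x_i\le x_j$. For a wqo $Q$, $o(Q)$ (the maximal order type) is the supremum of the order types of all linearizations of $Q$, i.e. linear quasi-orders on the same set extending $\le$. Sequences: a transfinite sequence over $Q$ of length $\alpha$ (with $\alpha$ a non-zero ordinal) is a function $\sigma:\alpha\to Q$, and $|\sigma|=\alpha$. Define $\sigma\preceq\tau$ if there is a strictly increasing $f:|\sigma|\to|\tau|$ with $\sigma(i)\le_Q\tau(f(i))$ for all $i$. The sequence $\sigma$ has finite range if it takes finitely many values. A proper tail of $\sigma$ is a sequence $i\mapsto\sigma(\delta+i)$ for $0\le i<-\delta+|\sigma|$, where $0<\delta<|\sigma|$ and $-\delta+|\sigma|$ is the unique $\beta$ with $\delta+\beta=|\sigma|$. The sequence $\sigma$ is indecomposable if $\sigma\preceq\tau$ for every proper tail $\tau$ of $\sigma$. $i^F_\alpha(Q)$ is the set of indecomposable sequences over $Q$ with finite range and length $<\alpha$, ordered by $\preceq$. Trees: $\mathsf{T_f}(Q)$ is the smallest class containing the leaf $\cdot q$ for each $q\in Q$, and containing $\cdot(\tau_0,\dots,\tau_{k-1})$ (an unlabelled root with children $\tau_i$) for every finite set $\{\tau_0,\dots,\tau_{k-1}\}\subseteq\mathsf{T_f}(Q)$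 with $k\ge1$. It is ordered by $\le_T$, defined recursively: - $\cdot x\le_T\cdot y$ iff $x\le_Q y$; - $\cdot x\le_T\cdot(\tau_j)_{j<l}$ iff $\cdot x\le_T\tau_j$ for some $j$; - $\cdot(\sigma_i)_{i<k}\le_T\cdot(\tau_j)_{j<l}$ iff every $\sigma_i$ is $\le_T$ some $\tau_j$; - a non-leaf tree is never $\le_T$ a leaf. Epsilon numbers: $(\varepsilon_\alpha)$ enumerates the fixed points of $\beta\mapsto\omega^\beta$ increasingly. Define $\bar\varepsilon(\alpha)=\varepsilon_{\alpha+1}$ if $\alpha=\gamma+n$ with $n<\omega$ and $\varepsilon_\gamma=\gamma$; otherwise $\bar\varepsilon(\alpha)=\varepsilon_\alpha$. Here $-2+\alpha$ is the unique $\beta$ with $2+\beta=\alpha$. *)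

(* Defs.v *)
From Stdlib Require Import List.
From mathcomp Require Import all_boot.
Set Implicit Arguments. Unset Strict Implicit. Unset Printing Implicit Defensive.

(* Ordinals as well-founded trees (Dockins-style):                     *)
(*   mkOrd A f  denotes  sup_{a : A} (f a + 1).                         *)
(* Ordinal equality is ord_eq (extensional), not Leibniz equality.    *)
Inductive Ord : Type := mkOrd (A : Type) (f : A -> Ord).
Arguments mkOrd : clear implicits.

Definition children (x : Ord) : Type := match x with mkOrd A _ => A end.
Definition child (x : Ord) : children x -> Ord :=
  match x as x0 return children x0 -> Ord with mkOrd A f => f end.

Fixpoint ord_le (x y : Ord) : Prop :=
  match x, y with
  | mkOrd A f, mkOrd B g => forall a : A, exists b : B, ord_le (f a) (g b)
  end.
Definition ord_eq (x y : Ord) : Prop := ord_le x y /\ ord_le y x.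

Definition ozero : Ord := mkOrd Empty_set (fun e => match e with end).
Definition osucc (x : Ord) : Ord := mkOrd unit (fun _ => x).
Definition osup (I : Type) (h : I -> Ord) : Ord :=
  mkOrd {i : I & children (h i)} (fun p => child (projT2 p)).
Fixpoint onat (n : nat) : Ord := match n with 0 => ozero | S m => osucc (onat m) end.
Definition oomega : Ord := mkOrd nat onat.

Fixpoint oadd (x y : Ord) {struct y} : Ord :=
  match y with
  | mkOrd B g => mkOrd (children x + B)%type
                   (fun s => match s with inl a => child a | inr b => oadd x (g b) end)
  end.
Fixpoint omul_nat (x : Ord) (n : nat) : Ord :=
  match n with 0 => ozero | S m => oadd (omul_nat x m) x end.
Fixpoint oexp_omega (x : Ord) : Ord :=
  match x with
  | mkOrd A f => osup (fun o : option ({a : A & nat}) =>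
                   match o with
                   | None => osucc ozero
                   | Some p => omul_nat (oexp_omega (f (projT1 p))) (projT2 p)
                   end)
  end.
(* epsilon numbers: eps x is the least fixed point of omega^_ strictly
   above every eps (f a) *)
Fixpoint oeps (x : Ord) : Ord :=
  match x with
  | mkOrd A f => let s := mkOrd A (fun a => oeps (f a)) in
                 osup (fun n : nat => iter n oexp_omega s)
  end.

Definition ebar_spec (beta delta : Ord) : Prop :=
  ((exists (gamma : Ord) (n : nat),
       ord_eq beta (oadd gamma (onat n)) /\ ord_eq (oeps gamma) gamma) ->
     ord_eq delta (oeps (osucc beta))) /\
  (~ (exists (gamma : Ord) (n : nat),
       ord_eq beta (oadd gamma (onat n)) /\ ord_eq (oeps gamma) gamma) ->
     ord_eq delta (oeps beta)).

Definition g_spec (alpha delta : Ord) : Prop :=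
  (ord_eq alpha (onat 1) -> ord_eq delta oomega) /\
  (forall beta : Ord, ord_eq (oadd (onat 2) beta) alpha -> ebar_spec beta delta).

Definition quasi_order (X : Type) (R : X -> X -> Prop) : Prop :=
  (forall x, R x x) /\ (forall x y z, R x y -> R y z -> R x z).
Definition wqo (X : Type) (R : X -> X -> Prop) : Prop :=
  quasi_order R /\
  forall s : nat -> X, exists i j : nat, (i < j)%N /\ R (s i) (s j).

Definition linearization (X : Type) (R L : X -> X -> Prop) : Prop :=
  quasi_order L /\ (forall x y, L x y \/ L y x) /\ (forall x y, R x y -> L x y).
Definition strict (X : Type) (L : X -> X -> Prop) (x y : X) : Prop := L x y /\ ~ L y x.

Fixpoint acc_rank (A : Type) (R : A -> A -> Prop) (a : A) (H : Acc R a) {struct H} : Ord :=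
  match H with
  | Acc_intro h => mkOrd {b : A | R b a}
                        (fun b => acc_rank (h (proj1_sig b) (proj2_sig b)))
  end.
Definition wf_type (A : Type) (R : A -> A -> Prop) (w : well_founded R) : Ord :=
  mkOrd A (fun a => acc_rank (w a)).

Definition max_otype (X : Type) (R : X -> X -> Prop) : Ord :=
  osup (fun p : {L : X -> X -> Prop | linearization R L /\ well_founded (strict L)} =>
          wf_type (proj2 (proj2_sig p))).

(* Ordinals < omega^omega in Cantor normal form: a non-increasing list *)
(* [e1; ...; ek] of exponents stands for omega^e1 + ... + omega^ek.    *)
Definition cnf_ok (s : seq nat) : bool := sorted geq s.
Fixpoint cnf_lt (s t : seq nat) : bool :=
  match s, t with
  | [::], [::] => false
  | [::], _ :: _ => true
  | _ :: _, [::] => false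
  | a :: s', b :: t' => (a < b) || ((a == b) && cnf_lt s' t')
  end.
Definition cnf_add (s t : seq nat) : seq nat :=
  match t with
  | [::] => s
  | e :: _ => [seq a <- s | e <= a] ++ t
  end.
Definition pos (alpha i : seq nat) : bool := cnf_ok i && cnf_lt i alpha.

(* transfinite sequences of length < omega^omega; values outside the
   domain are irrelevant *)
Record tseq (Q : Type) := TSeq { tlen : seq nat; tval : seq nat -> Q }.

Definition tseq_valid (Q : Type) (s : tseq Q) : Prop :=
  cnf_ok (tlen s) /\ tlen s <> [::].

Definition seq_emb (Q : Type) (le : Q -> Q -> Prop) (s t : tseq Q) : Prop :=
  exists f : seq nat -> seq nat,
    (forall i, pos (tlen s) i -> pos (tlen t) (f i) /\ le (tval s i) (tval t (f i))) /\
    (forall i j, pos (tlen s) i -> pos (tlen s) j -> cnf_lt i j -> cnf_lt (f i) (f j)).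

Definition finite_range (Q : Type) (s : tseq Q) : Prop :=
  exists r : seq Q, forall i, pos (tlen s) i -> List.In (tval s i) r.

(* tail i |-> s(delta + i), of length beta = -delta + |s| *)
Definition tail_seq (Q : Type) (s : tseq Q) (delta beta : seq nat) : tseq Q :=
  TSeq beta (fun i => tval s (cnf_add delta i)).

Definition indecomposable (Q : Type) (le : Q -> Q -> Prop) (s : tseq Q) : Prop :=
  forall delta beta : seq nat,
    cnf_ok delta -> cnf_ok beta -> delta <> [::] -> cnf_lt delta (tlen s) ->
    cnf_add delta beta = tlen s ->
    seq_emb le s (tail_seq s delta beta).

Definition iF (Q : Type) (le : Q -> Q -> Prop) : Type :=
  {s : tseq Q | tseq_valid s /\ finite_range s /\ indecomposable le s}.
Definition iF_le (Q : Type) (le : Q -> Q -> Prop) (x y : iF le) : Prop :=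
  seq_emb le (proj1_sig x) (proj1_sig y).

(* Finite trees T_f(Q); the finite set of children is given as a list *)
(* (order / repetitions are irrelevant for <=_T).                      *)
Inductive tree (Q : Type) : Type := Leaf (q : Q) | Node (ts : list (tree Q)).
Arguments Leaf {Q} q. Arguments Node {Q} ts.

Inductive tree_wf (Q : Type) : tree Q -> Prop :=
| twf_leaf q : tree_wf (Leaf q)
| twf_node ts : ts <> nil -> (forall t, List.In t ts -> tree_wf t) -> tree_wf (Node ts).

Inductive tree_le (Q : Type) (le : Q -> Q -> Prop) : tree Q -> tree Q -> Prop :=
| tle_leaf x y : le x y -> tree_le le (Leaf x) (Leaf y)
| tle_leaf_node x ts t : List.In t ts -> tree_le le (Leaf x) t -> tree_le le (Leaf x) (Node ts)
| tle_node ss ts :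
    (forall s, List.In s ss -> exists t, List.In t ts /\ tree_le le s t) ->
    tree_le le (Node ss) (Node ts).

Definition Tf (Q : Type) : Type := {t : tree Q | tree_wf t}.
Definition Tf_le (Q : Type) (le : Q -> Q -> Prop) (x y : Tf Q) : Prop :=
  tree_le le (proj1_sig x) (proj1_sig y).
Arguments iF_le {Q} le x y.
Arguments Tf_le {Q} le x y.
Arguments max_otype {X} R.

(* Main.v *)
(* The rank of the tree of bad sequences of a well-quasi-order decreases along residuals
   {y | x is not <= y}, and by the theorem of de Jongh and Parikh it is the order type of some
   linearization; so maximal order types may be computed as ranks.

   Iterating "repeat the concatenation of the children omega times" turns a tree into an
   indecomposable sequence, and every indecomposable sequence of finite range and length below
   omega^omega is equivalent to one obtained in this way, because a finite alphabet allows only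
   finitely many trees of bounded depth. Hence both orders have the same rank.

   Upper bound: a tree not above [Leaf q] has its leaves in the residual of q, and a tree not
   above [Node ts] is a leaf or a finite set of trees not above some child of [Node ts]; since
   finite sets over an order of rank d have rank at most omega^d, the rank stays below any
   epsilon number exceeding o(Q) and the ranks attached to its residuals.

   Lower bound: choose a linearization of Q of maximal type. Its elements from the third one on
   name epsilon numbers (or, below a fixed point of the epsilon function, all ordinals), and a
   Cantor normal form with exponents a_1 >= ... >= a_k becomes the set of the pairs {a_i, h_i},
   where h_i is a chain of braces over the least element, taller than the tree of a_i and than
   h_(i-1). A larger ordinal is then never below a smaller one. *)
From Stdlib Require Import Classical ClassicalEpsilon FunctionalExtensionality PropExtensionality Wellfounded.
Require Import Defs.
From mathcomp Require Import all_boot.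
Set Implicit Arguments. Unset Strict Implicit. Unset Printing Implicit Defensive.

(** The 2 in -2 + alpha has a source on each side. From above, a residual of rank at most 1 carries
    trees of rank at most omega, which lies below every epsilon number; only residuals of rank 2 + b
    raise the epsilon index. From below, the least element is spent on the braces and the next one
    on a mark for the base ordinal, so labels start at the third. The jump to the next epsilon
    number at a fixed point has a similar source: all leaves survive in the residual of a node, so
    o(Q) itself must lie below the bound, and epsilon_gamma = gamma fails to exceed gamma. The
    theorem of de Jongh and Parikh is proved by induction on the rank, written k + omega^c with
    omega^c the last term of its normal form. If k > 0, a part of rank k is placed below a part of
    rank omega^c. If k = 0 no such cut exists, and the set is cut into layers of cofinal ranks
    instead; building these layers is the hard part. *)

(** * Order on ordinals *)

Definition olt (x y : Ord) : Prop := exists b : children y, ord_le x (child b).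

Lemma ord_leP x y : ord_le x y <-> forall a : children x, olt (child a) y.
Proof. by case: x => A f; case: y => B g. Qed.

Lemma ord_le_refl x : ord_le x x.
Proof. by elim: x => A f IH /= a; exists a. Qed.

Lemma ord_le_trans x y z : ord_le x y -> ord_le y z -> ord_le x z.
Proof.
elim: x y z => A f IH [B g] [C h] /= xy yz a.
have [b ab] := xy a; have [c bc] := yz b; exists c; exact: IH ab bc.
Qed.

Lemma child_lt x (a : children x) : olt (child a) x.
Proof. by exists a; exact: ord_le_refl. Qed.

Lemma olt_le_trans x y z : olt x y -> ord_le y z -> olt x z.
Proof.
move=> [b xb] /ord_leP yz; have [c bc] := yz b.
by exists c; exact: ord_le_trans xb bc.
Qed.

Lemma ole_lt_trans x y z : ord_le x y -> olt y z -> olt x z.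
Proof. by move=> xy [c yc]; exists c; exact: ord_le_trans xy yc. Qed.

Lemma child_le x (a : children x) : ord_le (child a) x.
Proof.
elim: x a => A f IH a /=; apply/ord_leP => b.
by exists a; exact: IH.
Qed.

Lemma olt_le x y : olt x y -> ord_le x y.
Proof. by move=> [b xb]; exact: ord_le_trans xb (child_le b). Qed.

Lemma olt_trans x y z : olt x y -> olt y z -> olt x z.
Proof. by move=> xy /olt_le; exact: olt_le_trans. Qed.

Lemma olt_irrefl x : ~ olt x x.
Proof.
elim: x => A f IH [a /ord_leP xa].
by apply: (IH a); have := xa a.
Qed.

Lemma olt_wf : well_founded olt.
Proof.
suff H : forall x y, ord_le y x -> Acc olt y by move=> x; apply: (H x); exact: ord_le_refl.
elim=> A f IH y yx; constructor => z [b zb].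
have /ord_leP/(_ b)[a ba] := yx.
by apply: (IH a); exact: ord_le_trans zb ba.
Qed.

Lemma ole_or_lt x y : ord_le x y \/ olt y x.
Proof.
elim: x y => A f IH [B g].
case: (classic (ord_le (mkOrd A f) (mkOrd B g))) => [|nle]; [by left|right].
have [a na] := not_all_ex_not _ _ nle.
exists a; apply/ord_leP => b /=.
by case: (IH a (g b)) => // lab; case: na; exists b.
Qed.

Lemma nle_lt x y : ~ ord_le x y -> olt y x.
Proof. by case: (ole_or_lt x y). Qed.

Lemma nlt_le x y : ~ olt x y -> ord_le y x.
Proof. by case: (ole_or_lt y x). Qed.

Lemma ole_nlt x y : ord_le x y -> ~ olt y x.
Proof. by move=> xy yx; exact: (olt_irrefl (ole_lt_trans xy yx)). Qed.

Lemma ord_eq_refl x : ord_eq x x.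
Proof. by split; exact: ord_le_refl. Qed.

Lemma ord_eq_sym x y : ord_eq x y -> ord_eq y x.
Proof. by case. Qed.

Lemma ord_eq_trans x y z : ord_eq x y -> ord_eq y z -> ord_eq x z.
Proof. by move=> [a b] [c d]; split; apply: ord_le_trans; eassumption. Qed.

Lemma ole_eq_or_lt x y : ord_le x y -> ord_eq x y \/ olt x y.
Proof. by move=> xy; case: (ole_or_lt y x); [left|right]. Qed.

Lemma ord_min (P : Ord -> Prop) x :
  P x -> exists2 y, P y & forall z, P z -> ord_le y z.
Proof.
elim/(well_founded_induction olt_wf): x => x IH Px.
case: (classic (exists2 z, P z & olt z x)) => [[z Pz zx]|nz]; first exact: IH zx Pz.
exists x => // z Pz; apply: nlt_le => zx; apply: nz; by exists z.
Qed.

Lemma ole0 x : ord_le ozero x.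
Proof. by case: x => B g []. Qed.

Lemma olt_succ x : olt x (osucc x).
Proof. by exists tt; exact: ord_le_refl. Qed.

Lemma olt_succ_le x y : olt x (osucc y) -> ord_le x y.
Proof. by case. Qed.

Lemma olt_le_succ x y : olt x y -> ord_le (osucc x) y.
Proof. by move=> xy; apply/ord_leP. Qed.

Lemma osucc_mono x y : ord_le x y -> ord_le (osucc x) (osucc y).
Proof. by move=> xy; apply: olt_le_succ; exists tt. Qed.

Lemma olt_sup I (h : I -> Ord) x : olt x (osup h) <-> exists i, olt x (h i).
Proof.
split; first by move=> [[i b] /= xb]; exists i, b.
by move=> [i [b xb]]; exists (existT _ i b).
Qed.

Lemma osup_le I (h : I -> Ord) y : (forall i, ord_le (h i) y) -> ord_le (osup h) y.
Proof. by move=> H; apply/ord_leP => -[i b]; apply: olt_le_trans (H i); exact: child_lt. Qed.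

Lemma le_osup I (h : I -> Ord) i : ord_le (h i) (osup h).
Proof. by apply/ord_leP => b; apply/olt_sup; exists i; exact: child_lt. Qed.

Lemma omax x y : exists2 z, ord_le x z /\ ord_le y z & z = x \/ z = y.
Proof.
case: (ole_or_lt x y) => [xy|/olt_le yx]; [exists y|exists x]; auto using ord_le_refl.
Qed.

Lemma olt_max x y z : olt x z -> olt y z -> exists2 w, olt w z & ord_le x w /\ ord_le y w.
Proof. by move=> xz yz; have [w ww [E|E]] := omax x y; subst w; [exists x | exists y]. Qed.

(** * Addition *)

Lemma oadd_mono_r x y z : ord_le y z -> ord_le (oadd x y) (oadd x z).
Proof.
elim: y z => B g IH [C h] /= H; case=> [a|b] /=.
  by exists (inl a); exact: ord_le_refl.
by have [c bc] := H b; exists (inr c); exact: IH.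
Qed.

Lemma olt_add z x y : olt z (oadd x y) <-> olt z x \/ exists2 y', olt y' y & ord_le z (oadd x y').
Proof.
case: y => B g; split.
  move=> [[a|b] /= H]; first by left; exists a.
  by right; exists (g b) => //; exact: (@child_lt (mkOrd B g)).
move=> [[a za]|[y' [b yb] zy]]; first by exists (inl a).
by exists (inr b) => /=; apply: ord_le_trans zy _; exact: oadd_mono_r.
Qed.

Lemma oadd_lt_r x y z : olt y z -> olt (oadd x y) (oadd x z).
Proof. by move=> yz; apply/olt_add; right; exists y => //; exact: ord_le_refl. Qed.

Lemma oadd_mono_l x y z : ord_le x y -> ord_le (oadd x z) (oadd y z).
Proof.
move=> xy; elim/(well_founded_induction olt_wf): z => z IH.
apply/ord_leP => c; have /olt_add[H|[z' zz H]] := child_lt c; apply/olt_add.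
  by left; exact: olt_le_trans H xy.
by right; exists z' => //; exact: ord_le_trans H (IH _ zz).
Qed.

Lemma oadd_mono x y z w : ord_le x y -> ord_le z w -> ord_le (oadd x z) (oadd y w).
Proof. by move=> xy zw; apply: ord_le_trans (oadd_mono_l z xy) (oadd_mono_r y zw). Qed.

Lemma oadd_le_l x y : ord_le x (oadd x y).
Proof. by apply/ord_leP => a; apply/olt_add; left; exact: child_lt. Qed.

Lemma oadd_le_r x y : ord_le y (oadd x y).
Proof.
elim/(well_founded_induction olt_wf): y => y IH.
apply/ord_leP => b; apply/olt_add; right; exists (child b); [exact: child_lt|].
by apply: IH; exact: child_lt.
Qed.

Lemma oadd0 x : ord_eq (oadd x ozero) x.
Proof.
split; last exact: oadd_le_l.
by apply/ord_leP => c; have /olt_add[//|[? [[]]]] := child_lt c.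
Qed.

Lemma add0o x : ord_eq (oadd ozero x) x.
Proof.
split; last exact: oadd_le_r.
elim/(well_founded_induction olt_wf): x => x IH.
apply/ord_leP => c; have /olt_add[[[]]|[y yx H]] := child_lt c.
by apply: ole_lt_trans H (ole_lt_trans (IH _ yx) yx).
Qed.

Lemma oaddA x y z : ord_eq (oadd x (oadd y z)) (oadd (oadd x y) z).
Proof.
elim/(well_founded_induction olt_wf): z => z IH; split; apply/ord_leP => c.
  have /olt_add[H|[w /olt_add[wy|[z' zz wz]] H]] := child_lt c; apply/olt_add.
  - by left; apply/olt_add; left.
  - by left; apply/olt_add; right; exists w.
  - right; exists z' => //; apply: ord_le_trans H _.
    by apply: ord_le_trans (oadd_mono_r _ wz) _; case: (IH _ zz).
have /olt_add[/olt_add[H|[y' yy H]]|[z' zz H]] := child_lt c; apply/olt_add.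
- by left.
- by right; exists y' => //; apply/olt_add; left.
- right; exists (oadd y z'); first exact: oadd_lt_r.
  by apply: ord_le_trans H _; case: (IH _ zz).
Qed.

(** The least [y] with [z <= x + y] gives equality: if [z < x + y], a smaller [y] would do. *)
Lemma osub x z : ord_le x z -> exists y, ord_eq z (oadd x y).
Proof.
move=> xz; have [y zy min] := @ord_min (fun y => ord_le z (oadd x y)) z (oadd_le_r x z).
exists y; split=> //; apply: nlt_le => /olt_add[zx|[y' yy zy']].
  exact: ole_nlt xz zx.
exact: ole_nlt (min _ zy') yy.
Qed.

Lemma olt_add_cancel x y z : olt (oadd x y) (oadd x z) -> olt y z.
Proof.
move=> H; apply: nle_lt => zy; exact: ole_nlt (oadd_mono_r x zy) H.
Qed.

Lemma ole_add_cancel x y z : ord_le (oadd x y) (oadd x z) -> ord_le y z.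
Proof. move=> H; apply: nlt_le => zy; exact: ole_nlt H (oadd_lt_r x zy). Qed.

Lemma oadd_succ x y : ord_eq (oadd x (osucc y)) (osucc (oadd x y)).
Proof.
split; last by apply: olt_le_succ; apply: oadd_lt_r; exact: olt_succ.
apply/ord_leP => c; have /olt_add[H|[y' /olt_succ_le yy H]] := child_lt c; exists tt.
  by apply: olt_le; apply: olt_le_trans H (oadd_le_l _ _).
by apply: ord_le_trans H _; exact: oadd_mono_r.
Qed.

(** * Powers of omega *)

Lemma omul_natS x n : omul_nat x n.+1 = oadd (omul_nat x n) x.
Proof. by []. Qed.

Lemma omul_nat_add x m n : ord_eq (omul_nat x (m + n)) (oadd (omul_nat x m) (omul_nat x n)).
Proof.
elim: n => [|n IH]; first by rewrite addn0; apply: ord_eq_sym; exact: oadd0.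
rewrite addnS !omul_natS.
apply: ord_eq_trans (ord_eq_sym (oaddA _ _ _)); apply: ord_eq_sym.
by case: IH => a b; split; exact: oadd_mono_l.
Qed.

Lemma omul_nat_mono x y n : ord_le x y -> ord_le (omul_nat x n) (omul_nat y n).
Proof. by move=> xy; elim: n => [|n IH]; [exact: ord_le_refl | exact: oadd_mono]. Qed.

Definition oexp_term (A : Type) (f : A -> Ord) (o : option {a : A & nat}) : Ord :=
  match o with
  | None => osucc ozero
  | Some p => omul_nat (oexp_omega (f (projT1 p))) (projT2 p)
  end.

Lemma oexpE (A : Type) (f : A -> Ord) : oexp_omega (mkOrd A f) = osup (oexp_term f).
Proof. by []. Qed.

Lemma olt_exp_elim z x : olt z (oexp_omega x) ->
  ord_le z ozero \/ exists2 x', olt x' x & exists n, olt z (omul_nat (oexp_omega x') n).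
Proof.
case: x => A f; rewrite oexpE => /olt_sup[[[a n]|] H]; last by left; exact: olt_succ_le H.
right; exists (f a); last by exists n.
exact: (@child_lt (mkOrd A f)).
Qed.

Lemma oexp_mono x y : ord_le x y -> ord_le (oexp_omega x) (oexp_omega y).
Proof.
elim: x y => A f IH [B g] H; rewrite !oexpE; apply: osup_le => -[[a n]|].
  have [b ab] := H a.
  apply: ord_le_trans (omul_nat_mono n (IH _ _ ab)) _.
  exact: (le_osup (oexp_term g) (Some (existT _ b n))).
exact: (le_osup (oexp_term g) None).
Qed.

Lemma omul_exp_le x y n : olt x y -> ord_le (omul_nat (oexp_omega x) n) (oexp_omega y).
Proof.
case: y => B g [b /oexp_mono H]; rewrite oexpE.
apply: ord_le_trans (omul_nat_mono n H) _.
exact: (le_osup (oexp_term g) (Some (existT _ b n))).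
Qed.

Lemma oexp_pos x : olt ozero (oexp_omega x).
Proof. by case: x => A f; rewrite oexpE; apply/olt_sup; exists None; exact: olt_succ. Qed.

Lemma olt_add_pos x y : olt ozero y -> olt x (oadd x y).
Proof.
by move=> y0; apply/olt_add; right; exists ozero => //; case: (oadd0 x).
Qed.

Lemma omul_exp_lt x y n : olt x y -> olt (omul_nat (oexp_omega x) n) (oexp_omega y).
Proof.
move=> xy; apply: olt_le_trans (omul_exp_le n.+1 xy).
by apply: olt_add_pos; exact: oexp_pos.
Qed.

Lemma omul1 x : ord_eq (omul_nat x 1) x.
Proof. exact: add0o. Qed.

Lemma oexp_lt x y : olt x y -> olt (oexp_omega x) (oexp_omega y).
Proof. by move=> xy; apply: ole_lt_trans (omul_exp_lt 1 xy); case: (omul1 (oexp_omega x)). Qed.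

Lemma oexp_ge x : ord_le x (oexp_omega x).
Proof.
elim/(well_founded_induction olt_wf): x => x IH.
by apply/ord_leP => a; apply: ole_lt_trans (oexp_lt (child_lt a)); apply: IH; exact: child_lt.
Qed.

Lemma oexp_add_lt x y z : olt y (oexp_omega x) -> olt z (oexp_omega x) ->
  olt (oadd y z) (oexp_omega x).
Proof.
move=> /olt_exp_elim[y0|[a ax [n yn]]] zx.
  by apply: ole_lt_trans zx; apply: ord_le_trans (oadd_mono_l _ y0) _; case: (add0o z).
case/olt_exp_elim: (zx) => [z0|[b bx [m zm]]].
  apply: ole_lt_trans (omul_exp_lt n ax); apply: ord_le_trans (oadd_mono_r _ z0) _.
  by apply: ord_le_trans (olt_le yn); case: (oadd0 y).
have [c cx [ac bc]] := olt_max ax bx.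
apply: ole_lt_trans (omul_exp_lt (n + m) cx).
apply: ord_le_trans (proj2 (omul_nat_add _ _ _)); apply: oadd_mono.
  by apply: ord_le_trans (olt_le yn) _; apply: omul_nat_mono; exact: oexp_mono.
by apply: ord_le_trans (olt_le zm) _; apply: omul_nat_mono; exact: oexp_mono.
Qed.

Lemma oexp_absorb x y : olt y (oexp_omega x) -> ord_le (oadd y (oexp_omega x)) (oexp_omega x).
Proof.
move=> yx; apply/ord_leP => c; have /olt_add[H|[z zx H]] := child_lt c.
  exact: olt_trans H yx.
by apply: ole_lt_trans H (oexp_add_lt yx zx).
Qed.

(** * Natural sum *)

(** The Hessenberg sum. Recursion on both arguments, instead of normal forms, mirrors the first step
    of a bad sequence in a union, which lowers the rank of one of the two sets. *)
Fixpoint nadd (x : Ord) : Ord -> Ord :=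
  match x with
  | mkOrd A f => fix nadd_x (y : Ord) : Ord :=
      match y with
      | mkOrd B g => mkOrd (A + B)%type (fun s => match s with
                       | inl a => nadd (f a) (mkOrd B g)
                       | inr b => nadd_x (g b) end)
      end
  end.

Lemma nadd_child_l x y (a : children x) : olt (nadd (child a) y) (nadd x y).
Proof. by case: x a => A f a; case: y => B g; exists (inl a); exact: ord_le_refl. Qed.

Lemma nadd_child_r x y (b : children y) : olt (nadd x (child b)) (nadd x y).
Proof. by case: x => A f; case: y b => B g b; exists (inr b); exact: ord_le_refl. Qed.

Lemma nadd_le x y z : (forall a : children x, olt (nadd (child a) y) z) ->
  (forall b : children y, olt (nadd x (child b)) z) -> ord_le (nadd x y) z.
Proof.
by case: x => A f; case: y => B g H1 H2; apply/ord_leP => -[a|b]; [exact: H1|exact: H2].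
Qed.

Lemma nadd_mono x y x' y' : ord_le x x' -> ord_le y y' -> ord_le (nadd x y) (nadd x' y').
Proof.
elim: x y x' y' => A f IHx y; elim: y => B g IHy x' y' xx yy.
apply: nadd_le => [a|b].
  have /ord_leP/(_ a)[a' aa] := xx.
  by apply: ole_lt_trans (nadd_child_l _ a'); exact: IHx.
have /ord_leP/(_ b)[b' bb] := yy.
by apply: ole_lt_trans (nadd_child_r _ b'); exact: IHy.
Qed.

Lemma nadd_le_lt x y z : (forall x', olt x' x -> olt (nadd x' y) z) ->
  (forall y', olt y' y -> olt (nadd x y') z) -> ord_le (nadd x y) z.
Proof. by move=> H1 H2; apply: nadd_le => ?; [apply: H1|apply: H2]; exact: child_lt. Qed.

Lemma naddC_le x y : ord_le (nadd x y) (nadd y x).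
Proof.
elim: x y => A f IHx y; elim: y => B g IHy; apply: nadd_le => [a|b].
  by apply: ole_lt_trans (IHx a _) _; exact: (@nadd_child_r _ (mkOrd A f)).
by apply: ole_lt_trans (IHy b) _; exact: (@nadd_child_l (mkOrd B g)).
Qed.

Lemma nadd_lt_r x y y' : olt y y' -> olt (nadd x y) (nadd x y').
Proof. by move=> [b yb]; apply: ole_lt_trans (nadd_child_r _ b); apply: nadd_mono => //; exact: ord_le_refl. Qed.

Lemma nadd_lt_l x x' y : olt x x' -> olt (nadd x y) (nadd x' y).
Proof. by move=> [b yb]; apply: ole_lt_trans (nadd_child_l _ b); apply: nadd_mono => //; exact: ord_le_refl. Qed.

Lemma nadd_le_l x y : ord_le x (nadd x y).
Proof.
elim: x y => A f IH y; apply/ord_leP => a.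
by apply: ole_lt_trans (@nadd_child_l (mkOrd A f) y a); exact: IH.
Qed.

Lemma nadd_le_r x y : ord_le y (nadd x y).
Proof. exact: ord_le_trans (nadd_le_l y x) (naddC_le _ _). Qed.

Section NaddExp.
Variable c : Ord.
Local Notation W := (oexp_omega c).
(** [oexp_nadd_lt] proves this by induction on [c], using the instances at smaller exponents through
    [nadd_mul_exp]. *)
Hypothesis W_closed : forall y z, olt y W -> olt z W -> olt (nadd y z) W.

Lemma nadd_mul_exp n m v u : olt v W -> olt u W ->
  ord_le (nadd (oadd (omul_nat W n) v) (oadd (omul_nat W m) u))
         (oadd (omul_nat W (n + m)) (nadd v u)).
Proof.
move E : (n + m) => k; elim: k n m E v u => [|k IHk] n m E v u.
all: elim/(well_founded_induction olt_wf): v u => v IHv u.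
all: elim/(well_founded_induction olt_wf): u => u IHu vW uW.
  have [n0 m0] : n = 0 /\ m = 0 by case: n m E {IHv IHu} => // -[].
  subst n m; apply: nadd_le_lt => z /olt_add[[[]]|[v' vv zv]].
    apply: ole_lt_trans (nadd_mono zv (ord_le_refl _)) _.
    apply: ole_lt_trans (IHv _ vv _ (olt_trans vv vW) uW) _.
    by apply: oadd_lt_r; exact: nadd_lt_l.
  apply: ole_lt_trans (nadd_mono (ord_le_refl _) zv) _.
  apply: ole_lt_trans (IHu _ vv vW (olt_trans vv uW)) _.
  by apply: oadd_lt_r; exact: nadd_lt_r.
(* One lost copy of [W] outweighs any remainder below [W], so an argument may drop below its
   multiple of [W]. *)
have low w : olt w W -> olt (oadd (omul_nat W k) w) (oadd (omul_nat W k.+1) (nadd v u)).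
  by move=> wW; apply: olt_le_trans (oadd_le_l _ _); exact: oadd_lt_r.
apply: nadd_le_lt => z /olt_add[zn|[v' vv zv]].
- case: n E zn {IHv IHu} => [|n] E zn; first by case: zn => -[].
  case: E => E; suff [v' vW' zv] : exists2 v', olt v' W & ord_le z (oadd (omul_nat W n) v').
    apply: ole_lt_trans (nadd_mono zv (ord_le_refl _)) _.
    apply: ole_lt_trans (IHk _ _ E _ _ vW' uW) _; apply: low; exact: W_closed.
  case/olt_add: zn => [/olt_le zn|//]; exists ozero; first exact: oexp_pos.
  exact: ord_le_trans zn (oadd_le_l _ _).
- apply: ole_lt_trans (nadd_mono zv (ord_le_refl _)) _.
  apply: ole_lt_trans (IHv _ vv _ (olt_trans vv vW) uW) _.
  by apply: oadd_lt_r; exact: nadd_lt_l.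
- case: m E zn {IHv IHu} => [|m] E zn; first by case: zn => -[].
  move: E; rewrite addnS => -[E].
  suff [v' vW' zv] : exists2 v', olt v' W & ord_le z (oadd (omul_nat W m) v').
    apply: ole_lt_trans (nadd_mono (ord_le_refl _) zv) _.
    apply: ole_lt_trans (IHk _ _ E _ _ vW vW') _; apply: low; exact: W_closed.
  case/olt_add: zn => [/olt_le zn|//]; exists ozero; first exact: oexp_pos.
  exact: ord_le_trans zn (oadd_le_l _ _).
- apply: ole_lt_trans (nadd_mono (ord_le_refl _) zv) _.
  apply: ole_lt_trans (IHu _ vv vW (olt_trans vv uW)) _.
  by apply: oadd_lt_r; exact: nadd_lt_r.
Qed.

(** The third clause expresses that [k] is a multiple of [W]. The least [k] with [z < k + W]
    satisfies it because [W] absorbs smaller ordinals on its left. *)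
Lemma multiple_split z : exists k v,
  [/\ ord_eq z (oadd k v), olt v W & forall w, olt w k -> ord_le (oadd w W) k].
Proof.
have [k zk kmin] := @ord_min (fun k => olt z (oadd k W)) z (olt_add_pos z (oexp_pos c)).
have kz : ord_le k z by apply: kmin; apply: olt_add_pos; exact: oexp_pos.
have [v zv] := osub kz; exists k, v; split=> //.
  by apply: (@olt_add_cancel k); apply: ole_lt_trans zk; case: zv.
move=> w wk; apply: nlt_le => /olt_add[kw|[t tW kt]]; first exact: (olt_irrefl (olt_trans kw wk)).
apply: (ole_nlt (kmin w _) wk).
apply: olt_le_trans zk _; apply: ord_le_trans (oadd_mono_l _ kt) _.
apply: ord_le_trans (proj2 (oaddA _ _ _)) _; apply: oadd_mono_r; exact: oexp_absorb.
Qed.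

(** When the left argument drops below [k], it becomes [k' + v'] with [k'] a multiple of [W] and
    [k' + W <= k], which leaves room for every sum of remainders. *)
Lemma nadd_multiple k v u : (forall w, olt w k -> ord_le (oadd w W) k) ->
  olt v W -> olt u W -> ord_le (nadd (oadd k v) u) (oadd k (nadd v u)).
Proof.
elim/(well_founded_induction olt_wf): k v u => k IHk v u kmul.
elim/(well_founded_induction olt_wf): v u => v IHv u.
elim/(well_founded_induction olt_wf): u => u IHu vW uW.
apply: nadd_le_lt => z.
  move=> /olt_add[zk|[v' vv zv]].
    have [k' [v' [zE vW' k'mul]]] := multiple_split z.
    have k'z : ord_le k' z by apply: ord_le_trans (oadd_le_l _ v') _; case: zE.
    apply: olt_le_trans (oadd_le_l _ _); apply: olt_le_trans (kmul _ zk).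
    apply: ole_lt_trans (nadd_mono (proj1 zE) (ord_le_refl _)) _.
    apply: ole_lt_trans (IHk _ (ole_lt_trans k'z zk) _ _ k'mul vW' uW) _.
    apply: olt_le_trans (oadd_lt_r _ (W_closed vW' uW)) _; exact: oadd_mono_l.
  apply: ole_lt_trans (nadd_mono zv (ord_le_refl _)) _.
  apply: ole_lt_trans (IHv _ vv _ (olt_trans vv vW) uW) _.
  by apply: oadd_lt_r; exact: nadd_lt_l.
move=> zu; apply: ole_lt_trans (IHu _ zu vW (olt_trans zu uW)) _.
by apply: oadd_lt_r; exact: nadd_lt_r.
Qed.
End NaddExp.

Lemma oexp_nadd_lt c y z : olt y (oexp_omega c) -> olt z (oexp_omega c) ->
  olt (nadd y z) (oexp_omega c).
Proof.
elim/(well_founded_induction olt_wf): c y z => c IH y z yc zc.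
have key a n m : olt a c -> ord_le y (omul_nat (oexp_omega a) n) ->
    ord_le z (omul_nat (oexp_omega a) m) -> olt (nadd y z) (oexp_omega c).
  move=> ac yn zm; apply: ole_lt_trans (omul_exp_lt (n + m).+1 ac).
  apply: ord_le_trans (nadd_mono (ord_le_trans yn (proj2 (oadd0 _)))
    (ord_le_trans zm (proj2 (oadd0 _)))) _.
  apply: ord_le_trans (nadd_mul_exp (IH a ac) n m (oexp_pos a) (oexp_pos a)) _.
  by apply: oadd_mono_r; apply: nadd_le => -[].
case: (olt_exp_elim yc) => [y0|[a ac [n yn]]]; case: (olt_exp_elim zc) => [z0|[b bc [m zm]]].
- apply: ole_lt_trans (oexp_pos c); apply: ord_le_trans (nadd_mono y0 z0) _.
  by apply: nadd_le => -[].
- by apply: (key b 0 m) => //; exact: olt_le.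
- by apply: (key a n 0) => //; exact: olt_le.
- have [d dc [ad bd]] := olt_max ac bc.
  apply: (key d n m) => //.
    by apply: ord_le_trans (olt_le yn) (omul_nat_mono _ (oexp_mono ad)).
  by apply: ord_le_trans (olt_le zm) (omul_nat_mono _ (oexp_mono bd)).
Qed.

Lemma nadd_exp_lt k u c : (forall w, olt w k -> ord_le (oadd w (oexp_omega c)) k) ->
  olt u (oexp_omega c) -> olt (nadd k u) (oadd k (oexp_omega c)).
Proof.
move=> kmul uc.
apply: ole_lt_trans (nadd_mono (proj2 (oadd0 k)) (ord_le_refl u)) _.
apply: ole_lt_trans (nadd_multiple (@oexp_nadd_lt c) kmul (oexp_pos c) uc) _.
by apply: oadd_lt_r; apply: oexp_nadd_lt => //; exact: oexp_pos.
Qed.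

(** * Cantor normal forms *)

Definition csum (l : seq Ord) : Ord := foldr (fun a s => oadd (oexp_omega a) s) ozero l.

Fixpoint cdesc (l : seq Ord) : Prop :=
  match l with
  | [::] => True
  | a :: l' => (forall b, List.In b l' -> ord_le b a) /\ cdesc l'
  end.

Lemma csum_cat l l' : ord_eq (csum (l ++ l')) (oadd (csum l) (csum l')).
Proof.
elim: l => [|a l IH] /=; first by apply: ord_eq_sym; exact: add0o.
apply: ord_eq_trans (oaddA _ _ _).
by case: IH => h1 h2; split; exact: oadd_mono_r.
Qed.

Lemma csum_nseq n e : ord_eq (csum (nseq n e)) (omul_nat (oexp_omega e) n).
Proof.
elim: n => [|n IH]; first exact: ord_eq_refl.
rewrite -[n.+1]add1n; apply: ord_eq_trans (ord_eq_sym (omul_nat_add _ 1 n)).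
case: IH => h1 h2; have [o1 o2] := omul1 (oexp_omega e).
by split; exact: oadd_mono.
Qed.

Lemma csum_lt b l : (forall a, List.In a l -> olt a b) -> olt (csum l) (oexp_omega b).
Proof.
elim: l => [|a l IH] H /=; first exact: oexp_pos.
apply: oexp_add_lt; first by apply: oexp_lt; apply: H; left.
by apply: IH => c cl; apply: H; right.
Qed.

Lemma cdesc_nseq n e l : cdesc l -> (forall b, List.In b l -> ord_le b e) ->
  cdesc (nseq n e ++ l).
Proof.
move=> dl le; elim: n => [|n IH] //=; split=> // b.
elim: n {IH} => [|n IH] /=; first exact: le.
by move=> [<-|]; [exact: ord_le_refl | exact: IH].
Qed.

Lemma In_nseq T n (e b : T) l : List.In b (nseq n e ++ l) -> b = e \/ List.In b l.
Proof. by elim: n => [|n IH] /=; [right | move=> [<-|//]; left]. Qed.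

Lemma cnf_below e a : olt a (oexp_omega e) ->
  exists l, [/\ cdesc l, forall b, List.In b l -> olt b e & ord_eq a (csum l)].
Proof.
elim/(well_founded_induction olt_wf): e a => e IH a.
case/olt_exp_elim => [a0|[d de [n an]]].
  by exists [::]; split=> //; split=> //; exact: ole0.
(* This induction finds the largest number of copies of [omega^d] that fit into [a]; the remainder
   is then below [omega^d]. *)
elim: n an => [[[]]//|n IHn] /olt_add[//|[y yd ay]].
case: (ole_or_lt (omul_nat (oexp_omega d) n) a) => [na|//].
have [c ac] := osub na.
have cd : olt c (oexp_omega d).
  apply: ole_lt_trans yd; apply: (@ole_add_cancel (omul_nat (oexp_omega d) n)).
  by apply: ord_le_trans ay; case: ac.
have [l [dl ll cl]] := IH d de c cd.
exists (nseq n d ++ l); split.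
- by apply: cdesc_nseq => // b bl; apply: olt_le; exact: ll.
- by move=> b bl; case: (In_nseq bl) => [E|bl']; [rewrite E|exact: olt_trans (ll _ bl') de].
- apply: ord_eq_trans ac _; apply: ord_eq_sym.
  apply: ord_eq_trans (csum_cat _ _) _.
  have [h1 h2] := csum_nseq n d; have [h3 h4] := cl.
  by split; exact: oadd_mono.
Qed.

Lemma cnf_exists a : exists l, [/\ cdesc l, forall b, List.In b l -> ord_le b a & ord_eq a (csum l)].
Proof.
have [|l [dl ll cl]] := @cnf_below (osucc a) a.
  by apply: ole_lt_trans (oexp_ge a) _; apply: oexp_lt; exact: olt_succ.
by exists l; split=> // b bl; apply: olt_succ_le; exact: ll.
Qed.

Lemma csum_ge_In b l : List.In b l -> ord_le (oexp_omega b) (csum l).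
Proof.
elim: l => //= a l IH [->|/IH h]; first exact: oadd_le_l.
exact: ord_le_trans h (oadd_le_r _ _).
Qed.

Lemma csum_multiple c l : (forall b, List.In b l -> ord_le c b) ->
  forall w, olt w (csum l) -> ord_le (oadd w (oexp_omega c)) (csum l).
Proof.
elim: l => [_ w [[]]|a l IH] H w /= /olt_add[wa|[w' ww wle]].
  apply: ord_le_trans (oadd_le_l _ _).
  have ca : ord_le c a by apply: H; left.
  by apply: ord_le_trans (oadd_mono_r _ (oexp_mono ca)) _; exact: oexp_absorb.
apply: ord_le_trans (oadd_mono_l _ wle) _.
apply: ord_le_trans (proj2 (oaddA _ _ _)) _; apply: oadd_mono_r.
by apply: IH => // b bl; apply: H; right.
Qed.

Lemma cdesc_rcons l c : cdesc (rcons l c) -> forall b, List.In b l -> ord_le c b.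
Proof.
elim: l => //= a l IH [H /IH h] b [<-|/h//].
by apply: H; clear; elim: l => [|d l IH] /=; [left|right].
Qed.

(** Splits off the last term of the normal form; all earlier exponents are at least [c], so [k] is a
    multiple of [omega^c]. *)
Lemma last_power r : olt ozero r -> exists k c,
  ord_eq r (oadd k (oexp_omega c)) /\
  forall w, olt w k -> ord_le (oadd w (oexp_omega c)) k.
Proof.
have [l [dl _ rl]] := cnf_exists r; move=> r0.
case/lastP: l dl rl => [_ [r_le _]|l c dl rl]; first by case: (ole_nlt r_le r0).
exists (csum l), c; split; last by apply: csum_multiple; exact: cdesc_rcons dl.
apply: ord_eq_trans rl _; rewrite -cats1; apply: ord_eq_trans (csum_cat _ _) _.
by have [h1 h2] := oadd0 (oexp_omega c); split; apply: oadd_mono_r.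
Qed.

(** * Epsilon numbers *)

Definition eps_base (A : Type) (f : A -> Ord) : Ord := mkOrd A (fun a => oeps (f a)).

Lemma oepsE (A : Type) (f : A -> Ord) :
  oeps (mkOrd A f) = osup (fun n => iter n oexp_omega (eps_base f)).
Proof. by []. Qed.

Lemma iter_exp_mono n x y : ord_le x y -> ord_le (iter n oexp_omega x) (iter n oexp_omega y).
Proof. by move=> xy; elim: n => //= n IH; exact: oexp_mono. Qed.

Lemma oeps_mono x y : ord_le x y -> ord_le (oeps x) (oeps y).
Proof.
elim: x y => A f IH [B g] xy; rewrite !oepsE; apply: osup_le => n.
apply: ord_le_trans (le_osup (fun n => iter n oexp_omega (eps_base g)) n).
apply: iter_exp_mono => a; have [b ab] := xy a; exists b; exact: IH.
Qed.

Lemma oeps_lt x y : olt x y -> olt (oeps x) (oeps y).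
Proof.
case: y => B g [b /oeps_mono xb]; rewrite oepsE; apply/olt_sup; exists 0.
by exists b.
Qed.

Lemma oeps_ge x : ord_le x (oeps x).
Proof.
elim/(well_founded_induction olt_wf): x => x IH.
by apply/ord_leP => a; apply: ole_lt_trans (oeps_lt (child_lt a)); apply: IH; exact: child_lt.
Qed.

Lemma oeps_fix x : ord_le (oexp_omega (oeps x)) (oeps x).
Proof.
case: x => A f; rewrite oepsE; apply/ord_leP => c.
have /olt_exp_elim[c0|[z /olt_sup[m zm] [n cn]]] := child_lt c; apply/olt_sup.
  by exists 1; apply: ole_lt_trans c0 (oexp_pos _).
by exists m.+1; apply: olt_trans cn _; exact: omul_exp_lt.
Qed.

Lemma oeps_exp_lt x y : olt y (oeps x) -> olt (oexp_omega y) (oeps x).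
Proof. by move=> /oexp_lt h; exact: olt_le_trans h (oeps_fix x). Qed.

Lemma oeps_nadd_lt x y z : olt y (oeps x) -> olt z (oeps x) -> olt (nadd y z) (oeps x).
Proof.
move=> yx zx; apply: olt_le_trans (oeps_fix x).
by apply: oexp_nadd_lt; apply: olt_le_trans (oexp_ge _).
Qed.

Lemma oeps_pos x : olt ozero (oeps x).
Proof. by apply: olt_le_trans (oeps_fix x); exact: oexp_pos. Qed.

Lemma onat_lt_exp n x : olt ozero x -> olt (onat n) (oexp_omega x).
Proof.
move=> x0; elim: n => [|n IH] /=; first exact: oexp_pos.
apply: ole_lt_trans (oexp_add_lt IH (oexp_lt x0)).
apply: olt_le_succ; apply: olt_add_pos; exact: oexp_pos.
Qed.

Lemma oomega_lt_eps x : olt oomega (oeps x).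
Proof.
have e0 := oeps_pos x; have e1 := oeps_exp_lt e0.
apply: ole_lt_trans (oeps_exp_lt e1).
by apply/ord_leP => n; apply: onat_lt_exp; exact: oexp_pos.
Qed.

Lemma eps_enum a y : ord_le (oexp_omega a) a -> olt a (oeps y) ->
  exists2 x, olt x y & ord_eq a (oeps x).
Proof.
move=> fixa; elim: y => B g IH; rewrite oepsE.
case: (ole_or_lt (eps_base g) a) => [sa|[b /= ab]] H.
  (* If [a] bounds the starting point of the iteration, the iterates of [omega^_] never pass the
     fixed point [a]. *)
  suff : ord_le (oeps (mkOrd B g)) a by move=> /ole_nlt; case.
  rewrite oepsE; apply: osup_le; elim=> [|n IHn] //=.
  by apply: ord_le_trans fixa; exact: oexp_mono.
case: (ole_eq_or_lt ab) => [eab|ltab].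
  by exists (g b) => //; exact: (@child_lt (mkOrd B g)).
have [x xb ax] := IH b ltab; exists x => //.
by apply: olt_trans xb _; exact: (@child_lt (mkOrd B g)).
Qed.

(** * Multiplication *)

(** Serves to space the layers of [chain_linearizable] far enough apart. *)
Fixpoint omul (x y : Ord) {struct y} : Ord :=
  match y with mkOrd B g => osup (fun b : B => oadd (omul x (g b)) x) end.

Lemma omul_mono x y z : ord_le y z -> ord_le (omul x y) (omul x z).
Proof.
elim: y z => B g IH [C h] H; apply: osup_le => b.
have [c bc] := H b; apply: ord_le_trans (oadd_mono_l _ (IH _ _ bc)) _.
exact: (le_osup (fun c => oadd (omul x (h c)) x)).
Qed.

Lemma omul_lt x y z : olt y z -> ord_le (oadd (omul x y) x) (omul x z).
Proof.
case: z => C h [c yc]; apply: ord_le_trans (oadd_mono_l _ (omul_mono x yc)) _.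
exact: (le_osup (fun c => oadd (omul x (h c)) x)).
Qed.

Lemma choice_fun (A B : Type) (R : A -> B -> Prop) :
  (forall x, exists y, R x y) -> exists f : A -> B, forall x, R x (f x).
Proof.
move=> H; exists (fun x => proj1_sig (constructive_indefinite_description _ (H x))) => x.
exact: proj2_sig (constructive_indefinite_description _ (H x)).
Qed.

(** * Ranks of residuals *)

Definition res (X : Type) (le : X -> X -> Prop) (P : X -> Prop) (x y : X) : Prop :=
  P y /\ ~ le x y.

(* [rle le P d] says that the tree of bad sequences in [P] has rank at most [d],
   and [rge le P d] that it has rank at least [d]. *)
Fixpoint rle (X : Type) (le : X -> X -> Prop) (P : X -> Prop) (d : Ord) {struct d} : Prop :=
  match d with
  | mkOrd A f => forall x, P x -> exists a : A, rle le (res le P x) (f a)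
  end.

Fixpoint rge (X : Type) (le : X -> X -> Prop) (P : X -> Prop) (d : Ord) {struct d} : Prop :=
  match d with
  | mkOrd A f => forall a : A, exists2 x, P x & rge le (res le P x) (f a)
  end.

(** A map that reflects the order sends bad sequences to bad sequences, so the tree over [X] embeds
    into the tree over [Y]. *)
Lemma rle_map (X Y : Type) (leX : X -> X -> Prop) (leY : Y -> Y -> Prop) (F : X -> Y)
    (P : X -> Prop) (P' : Y -> Prop) d d' :
  (forall x, P x -> P' (F x)) -> (forall x y, P x -> P y -> leY (F x) (F y) -> leX x y) ->
  ord_le d d' -> rle leY P' d -> rle leX P d'.
Proof.
elim: d d' P P' => A f IH [B g] P P' PP refl dd /= H x Px.
have [a Ha] := H _ (PP _ Px); have [b ab] := dd a; exists b.
apply: (IH a (g b) _ (res leY P' (F x)) _ _ ab Ha).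
  by move=> y [Py xy]; split; [exact: PP | move=> /(refl _ _ Px Py)].
by move=> y z [Py _] [Pz _]; exact: refl.
Qed.

Lemma rge_map (X Y : Type) (leX : X -> X -> Prop) (leY : Y -> Y -> Prop) (F : X -> Y)
    (P : X -> Prop) (P' : Y -> Prop) d d' :
  (forall x, P x -> P' (F x)) -> (forall x y, P x -> P y -> leY (F x) (F y) -> leX x y) ->
  ord_le d d' -> rge leX P d' -> rge leY P' d.
Proof.
elim: d d' P P' => A f IH [B g] P P' PP refl dd /= H a.
have [b ab] := dd a; have [x Px Hx] := H b; exists (F x); first exact: PP.
apply: (IH a (g b) (res leX P x) _ _ _ ab Hx).
  by move=> y [Py xy]; split; [exact: PP | move=> /(refl _ _ Px Py)].
by move=> y z [Py _] [Pz _]; exact: refl.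
Qed.

Section Rank.
Variables (X : Type) (le : X -> X -> Prop).
Implicit Types P U Y : X -> Prop.

Lemma rle_mono P U d d' : (forall x, P x -> U x) -> ord_le d d' -> rle le U d -> rle le P d'.
Proof. by move=> PU; apply: (@rle_map _ _ _ _ id). Qed.

Lemma rge_le_rle P d e : rge le P d -> rle le P e -> ord_le d e.
Proof.
elim: e d P => B g IH [A f] P /= Hd He a.
have [x Px Ha] := Hd a; have [b Hb] := He x Px; exists b; exact: IH Hb.
Qed.

Lemma rle_union P U d e : rle le P d -> rle le U e ->
  rle le (fun x => P x \/ U x) (nadd d e).
Proof.
elim: d e P U => A f IHd e; elim: e => B g IHe P U HP HU x [Px|Ux].
  have [a Ha] := HP x Px; exists (inl a).
  apply: (rle_mono _ (ord_le_refl _) (IHd a (mkOrd B g) _ U Ha HU)).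
  by move=> y [[Py|Uy] xy]; [left | right].
have [b Hb] := HU x Ux; exists (inr b).
apply: (rle_mono _ (ord_le_refl _) (IHe b P _ HP Hb)).
by move=> y [[Py|Uy] xy]; [left | right].
Qed.

(** A rank bound alone excludes infinite bad sequences. The order on trees is shown to be a wqo in
    this way, with no minimal bad sequence argument. *)
Lemma rle_no_bad_seq P d (s : nat -> X) : rle le P d -> (forall i, P (s i)) ->
  exists i j, (i < j)%N /\ le (s i) (s j).
Proof.
elim: d P s => A f IH P s /= H Ps.
case: (classic (exists j, le (s 0) (s j.+1))) => [[j sj]|nj]; first by exists 0, j.+1.
have [a Ha] := H _ (Ps 0).
have [|i [j [ij sij]]] := IH a _ (fun i => s i.+1) Ha; last by exists i.+1, j.+1.
by move=> i; split=> // si; apply: nj; exists i.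
Qed.

Hypothesis le_wqo : wqo le.

Lemma wqo_trans x y z : le x y -> le y z -> le x z.
Proof. exact: (proj2 (proj1 le_wqo)). Qed.

(** Were the conclusion false at [P0], dependent choice would give points each lying in the
    residuals of all earlier ones, hence an infinite bad sequence. *)
Lemma wqo_res_ind (G : (X -> Prop) -> Prop) :
  (forall P, (forall x, P x -> G (res le P x)) -> G P) -> forall P, G P.
Proof.
move=> H P0; apply: NNPP => nP0.
have step (b : {P | ~ G P}) : exists x, proj1_sig b x /\ ~ G (res le (proj1_sig b) x).
  case: b => P nP /=; apply: NNPP => nx; apply: nP; apply: H => x Px.
  by apply: NNPP => nG; apply: nx; exists x.
have [nx Hnx] := choice_fun step.
pose nxt b : {P | ~ G P} := exist (fun P => ~ G P) _ (proj2 (Hnx b)).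
pose b0 : {P | ~ G P} := exist (fun P => ~ G P) P0 nP0.
pose s n := nx (iter n nxt b0).
have mem i j : proj1_sig (iter (j + i) nxt b0) (s (j + i)) ->
    forall y, proj1_sig (iter (j + i) nxt b0) y -> proj1_sig (iter i nxt b0) y.
  move=> _; elim: j => [|j IH] y //=; rewrite -/(addn j i).
  by move=> [/IH].
have [i [j [ij sij]]] := proj2 le_wqo s.
have : proj1_sig (iter i.+1 nxt b0) (s j).
  rewrite -(subnK ij); apply: (mem i.+1 (j - i.+1)); exact: (proj1 (Hnx _)).
by move=> [_]; apply.
Qed.

Lemma rank_exists P : exists d, rle le P d /\ rge le P d.
Proof.
elim/wqo_res_ind: P => P H.
have [g Hg] := @choice_fun {x | P x} Ord
  (fun x d => rle le (res le P (proj1_sig x)) d /\ rge le (res le P (proj1_sig x)) d)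
  (fun x => H _ (proj2_sig x)).
exists (mkOrd {x | P x} g); split=> [x Px|[x Px]] /=.
  by exists (exist _ x Px); case: (Hg (exist _ x Px)).
by exists x => //; case: (Hg (exist _ x Px)).
Qed.

Definition rk P : Ord := proj1_sig (constructive_indefinite_description _ (rank_exists P)).

Lemma rk_rle P : rle le P (rk P).
Proof. by rewrite /rk; case: constructive_indefinite_description => d []. Qed.

Lemma rk_rge P : rge le P (rk P).
Proof. by rewrite /rk; case: constructive_indefinite_description => d []. Qed.

Lemma rk_le P d : rle le P d -> ord_le (rk P) d.
Proof. exact: rge_le_rle (rk_rge P). Qed.

Lemma rk_ge P d : rge le P d -> ord_le d (rk P).
Proof. by move=> H; exact: rge_le_rle H (rk_rle P). Qed.

Lemma rk_mono P U : (forall x, P x -> U x) -> ord_le (rk P) (rk U).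
Proof. by move=> PU; apply: rk_le; apply: rle_mono PU (ord_le_refl _) (rk_rle U). Qed.

Lemma rk_union P U : ord_le (rk (fun x => P x \/ U x)) (nadd (rk P) (rk U)).
Proof. by apply: rk_le; apply: rle_union; exact: rk_rle. Qed.

Lemma rk_res_lt P x : P x -> olt (rk (res le P x)) (rk P).
Proof.
move=> Px; have := rk_rle P; move: (rk P) => [A f] /(_ x Px)[a Ha].
by exists a; exact: rk_le.
Qed.

Lemma rk_lt_res P d : olt d (rk P) -> exists2 x, P x & ord_le d (rk (res le P x)).
Proof.
have := rk_rge P; move: (rk P) => [A f] H [a da].
have [x Px Hx] := H a; exists x => //; apply: ord_le_trans da _; exact: rk_ge.
Qed.

Lemma rk_le_res P d : (forall x, P x -> olt (rk (res le P x)) d) -> ord_le (rk P) d.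
Proof.
move=> H; apply: nlt_le => /rk_lt_res[x Px dx]; exact: ole_nlt dx (H x Px).
Qed.

(** Descend into a residual as long as one has rank at least [e]. Residuals are downward closed, and
    where the descent stops the rank is exactly [e]. *)
Lemma exact_rank P e : ord_le e (rk P) -> exists D, [/\ ord_eq (rk D) e,
  forall x, D x -> P x & forall x y, D y -> P x -> le x y -> D x].
Proof.
elim/wqo_res_ind: P => P IH eP.
case: (classic (exists2 x, P x & ord_le e (rk (res le P x)))) => [[x Px ex]|nx].
  have [D [De DP Ddown]] := IH x Px ex; exists D; split=> //.
    by move=> y /DP[].
  move=> y z Dz Py yz; apply: (Ddown _ _ Dz _ yz); split=> // xy.
  by have [_] := DP _ Dz; apply; exact: wqo_trans xy yz.
exists P; split=> //; split=> //; apply: rk_le_res => x Px.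
by apply: nle_lt => ex; apply: nx; exists x.
Qed.

(** * Maximal linearizations *)

(* [hge h P d x]: the rank of [x] in [P] quasi-ordered by [h] is at least [d];
   [tge h P d]: the order type of [P] quasi-ordered by [h] is at least [d]. *)
Fixpoint hge (h : X -> Ord) P (d : Ord) (x : X) {struct d} : Prop :=
  match d with
  | mkOrd A f => forall a : A, exists y, [/\ P y, olt (h y) (h x) & hge h P (f a) y]
  end.

Definition tge (h : X -> Ord) P (d : Ord) : Prop :=
  forall e, olt e d -> exists2 x, P x & hge h P e x.

Lemma hge_mono (h h' : X -> Ord) P U d d' x : (forall x, P x -> U x) ->
  (forall x y, P x -> P y -> olt (h y) (h x) -> olt (h' y) (h' x)) ->
  P x -> hge h P d x -> ord_le d' d -> hge h' U d' x.
Proof.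
move=> PU hh; elim: d' d x => B g IH [A f] x Px Hx dd b.
have [a ba] := dd b; have [y [Py yx Hy]] := Hx a; exists y; split; [exact: PU|exact: hh|].
exact: IH Hy ba.
Qed.

Lemma hge_lt h P d x : (forall e, olt e d -> exists y, [/\ P y, olt (h y) (h x) & hge h P e y]) ->
  hge h P d x.
Proof.
by case: d => A f H a; apply: H; exact: (@child_lt (mkOrd A f)).
Qed.

(** A linearization is given by a height function into the ordinals, so well-foundedness is
    automatic. Only a lower bound on the type is asked for; the upper bound holds for every
    linearization. *)
Definition max_linearizable P : Prop := exists h : X -> Ord,
  (forall x y, P x -> P y -> le x y -> ord_le (h x) (h y)) /\ tge h P (rk P).

(** [D] goes to the bottom, [U] above it from height [K] on, and the rest of [P] to the single
    height [K + K']. The two closure hypotheses make this monotone. *)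
Lemma max_linearizable_stack P D U k v :
  ord_eq (rk P) (oadd k v) -> ord_eq (rk D) k -> ord_le v (rk U) ->
  (forall x, D x -> P x) -> (forall x y, D y -> P x -> le x y -> D x) ->
  (forall x, U x -> P x /\ ~ D x) ->
  (forall x y, U y -> P x -> ~ D x -> le x y -> U x) ->
  max_linearizable D -> max_linearizable U -> max_linearizable P.
Proof.
move=> rP rD rU DP Ddown UP Udown [hD [mD tD]] [hU [mU tU]].
pose K := mkOrd {x | D x} (fun x => hD (proj1_sig x)).
pose K' := mkOrd {x | U x} (fun x => hU (proj1_sig x)).
have DK x : D x -> olt (hD x) K by move=> Dx; exists (exist _ x Dx); exact: ord_le_refl.
have UK x : U x -> olt (hU x) K' by move=> Ux; exists (exist _ x Ux); exact: ord_le_refl.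
pose h x := if excluded_middle_informative (D x) then hD x
  else if excluded_middle_informative (U x) then oadd K (hU x) else oadd K K'.
have hDE x : D x -> h x = hD x by rewrite /h; case: (excluded_middle_informative (D x)).
have hUE x : U x -> h x = oadd K (hU x).
  move=> Ux; rewrite /h; case: (excluded_middle_informative (D x)) => [Dx|nDx].
    by case: (UP _ Ux).
  by case: (excluded_middle_informative (U x)).
have KhU x : ~ D x -> ord_le K (h x).
  rewrite /h => nD; case: (excluded_middle_informative (D x)) => // nD'.
  by case: (excluded_middle_informative (U x)) => Ux; exact: oadd_le_l.
exists h; split=> [x y Px Py xy|].
  case: (classic (D y)) => Dy.
    by have Dx := Ddown _ _ Dy Px xy; rewrite !hDE //; exact: mD.
  case: (classic (D x)) => Dx.
    by rewrite hDE //; apply: olt_le; apply: olt_le_trans (DK x Dx) (KhU y Dy).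
  case: (classic (U y)) => Uy.
    have Ux := Udown _ _ Uy Px Dx xy.
    by rewrite !hUE //; apply: oadd_mono_r; exact: mU.
  have -> : h y = oadd K K'.
    rewrite /h; case: (excluded_middle_informative (D y)) => // nDy.
    by case: (excluded_middle_informative (U y)).
  case: (classic (U x)) => Ux.
    by rewrite hUE //; apply: oadd_mono_r; apply: olt_le; exact: UK.
  rewrite /h; case: (excluded_middle_informative (D x)) => // nDx.
  by case: (excluded_middle_informative (U x)) => // nUx; exact: ord_le_refl.
have lowD e x : D x -> hge hD D e x -> hge h P e x.
  move=> Dx Hx; apply: (hge_mono _ _ Dx Hx (ord_le_refl _)) => // y z Dy Dz.
  by rewrite !hDE.
have low e : olt e k -> exists2 x, D x & hge h P e x.
  move=> ek; have [x Dx Hx] := tD e (olt_le_trans ek (proj2 rD)).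
  by exists x => //; exact: lowD.
have high e x : U x -> hge hU U e x -> hge h P (oadd k e) x.
  elim/(well_founded_induction olt_wf): e x => e IH x Ux Hx; apply: hge_lt => z.
  move=> /olt_add[/low[y Dy Hy]|[e' ee ze]].
    exists y; split=> //; first exact: DP.
    rewrite hDE //; apply: olt_le_trans (DK y Dy) (KhU x _).
    by case: (UP _ Ux).
  case: e {IH} Hx ee (IH e' ee) => A f Hx [a ea] IH.
  have [y [Uy yx Hy]] := Hx a; exists y; split=> //.
  - by case: (UP _ Uy).
  - by rewrite !hUE //; exact: oadd_lt_r.
  - have Hy' : hge hU U e' y by apply: (hge_mono _ _ Uy Hy ea).
    case: (UP _ Uy) => Py _.
    by apply: (@hge_mono h h P P (oadd k e')) => //; exact: IH.
move=> e er; have /olt_add[/low[x Dx Hx]|[e' ev ee]] := olt_le_trans er (proj1 rP).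
  by exists x => //; exact: DP.
have [x Ux Hx] := tU e' (olt_le_trans ev rU); case: (UP _ Ux) => Px _; exists x => //.
by apply: (@hge_mono h h P P (oadd k e')) => //; exact: high.
Qed.

(* When [rk P] is additively indecomposable, [P] is cut into the layers between consecutive
   residuals of a chain; the chain is taken in a set [Y] such that all elements of [Y] of
   sufficiently large rank lie above a given one, so it stops only when its ranks are cofinal
   in [rk P]. *)
Section Indecomposable.
Variable P : X -> Prop.
Hypothesis P_nadd : forall a b, olt a (rk P) -> olt b (rk P) -> olt (nadd a b) (rk P).
Hypothesis P_succ : forall a, olt a (rk P) -> olt (osucc a) (rk P).
Variable x0 : X.
Local Notation R := (fun y => rk (res le P y)).

Let large Y := (forall y, Y y -> P y) /\ forall e, olt e (rk P) -> exists2 y, Y y & ord_le e (R y).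

(** Minimality means that, for [y] in [Y], the elements of [Y] not above [y] have residual ranks
    bounded strictly below [rk P]. The bound [b y] of the chain construction comes from here. *)
Lemma minimal_large : exists Y, large Y /\ forall y, Y y -> ~ large (res le Y y).
Proof.
apply: NNPP => nY.
suff : ~ large P by apply; split=> // e /rk_lt_res.
elim/wqo_res_ind: P => Y IH lY; apply: nY; exists Y; split=> // y Yy; exact: IH.
Qed.

Section Chain.
Variables (Y : X -> Prop) (b : X -> Ord).
Hypothesis Y_large : large Y.
Hypothesis b_lt : forall y, Y y -> olt (b y) (rk P).
Hypothesis b_gt : forall y, Y y -> olt (R y) (b y).
Hypothesis b_bound : forall y z, Y y -> Y z -> ~ le y z -> olt (R z) (b y).

(** One representative is kept for each value of [R] on [Y], so that distinct chain elements have
    distinct ranks and [before] well-orders the chain. *)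
Let same (z w : X) := Y w /\ ord_eq (R w) (R z).
Let canon z := z = epsilon (inhabits x0) (same z).

Lemma same_eq z z' : ord_eq (R z) (R z') -> same z = same z'.
Proof.
move=> zz; apply: functional_extensionality => w; apply: propositional_extensionality.
split=> -[Yw wz]; split=> //; first exact: ord_eq_trans wz zz.
exact: ord_eq_trans wz (ord_eq_sym zz).
Qed.

Lemma canon_uniq z z' : canon z -> canon z' -> ord_eq (R z) (R z') -> z = z'.
Proof. by move=> cz cz' zz; rewrite cz cz' (same_eq zz). Qed.

Lemma canon_exists y : Y y -> exists z, [/\ Y z, canon z & ord_eq (R z) (R y)].
Proof.
move=> Yy; have [Yz zy] : same y (epsilon (inhabits x0) (same y)).
  by apply: epsilon_spec; exists y; split=> //; exact: ord_eq_refl.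
by exists (epsilon (inhabits x0) (same y)); split=> //; rewrite /canon (same_eq zy).
Qed.

Let before y z := olt (R y) (R z).

Lemma before_wf : well_founded before.
Proof. exact: (wf_inverse_image _ _ _ (fun y => R y) olt_wf). Qed.

(** An element joins the chain if it lies above all earlier members and its layer, the part of its
    residual above all of them, has rank at least [b y] for each earlier [y]. The second demand
    forces the layers to grow. *)
Let chainF z (rec : forall y, before y z -> Prop) : Prop :=
  [/\ Y z, canon z & forall y (p : before y z), rec y p -> le y z /\
    ord_le (b y) (rk (fun w => res le P z w /\ forall y (p : before y z), rec y p -> le y w))].

Let chain : X -> Prop := Fix before_wf (fun _ => Prop) chainF.
Let layer z w := res le P z w /\ forall y, before y z -> chain y -> le y w.

Lemma chainE z : chain z = [/\ Y z, canon z & forall y, before y z -> chain y ->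
  le y z /\ ord_le (b y) (rk (layer z))].
Proof.
rewrite {1}/chain Fix_eq // => {z} z f g fg; congr chainF.
apply: functional_extensionality_dep => y; apply: functional_extensionality_dep => p; exact: fg.
Qed.

Lemma chainY z : chain z -> Y z.
Proof. by rewrite chainE => -[]. Qed.

Lemma chain_uniq y z : chain y -> chain z -> ord_eq (R y) (R z) -> y = z.
Proof. by rewrite !chainE => -[_ cy _] [_ cz _]; exact: canon_uniq. Qed.

(** Suppose [b] stays below [e] on the chain. Some [u] in [Y] lies above the whole chain, so the set
    [DC] of points missing a chain element is inside its residual and has rank below [rk P]. Take
    [z] of residual rank at least [nadd (rk DC) e]: its residual is covered by [DC] and its layer,
    so the layer has rank at least [e] and [z] joins the chain, although [b z > R z >= e]. *)
Lemma chain_cofinal e : olt e (rk P) -> exists2 y, chain y & ord_le e (b y).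
Proof.
move=> eP; apply: NNPP => nC.
have bC y : chain y -> olt (b y) e by move=> Cy; apply: nle_lt => h; apply: nC; exists y.
pose DC w := exists2 y, chain y & res le P y w.
have above u y : Y u -> ord_le e (R u) -> chain y -> le y u.
  move=> Yu eu Cy; apply: NNPP => nyu.
  have := b_bound (chainY Cy) Yu nyu.
  by move=> /(ole_lt_trans eu) h; exact: olt_irrefl (olt_trans h (bC _ Cy)).
have [YP Ylarge] := Y_large.
have DC_lt : olt (rk DC) (rk P).
  have [u Yu eu] := Ylarge e eP.
  apply: ole_lt_trans (rk_res_lt (YP _ Yu)); apply: rk_mono => w [y Cy [Pw nyw]].
  split=> // uw; apply: nyw; apply: wqo_trans uw; exact: above.
have [z0 Yz0 z0r] := Ylarge _ (P_nadd DC_lt eP).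
have [z [Yz cz zz0]] := canon_exists Yz0.
have nz : ord_le (nadd (rk DC) e) (R z) by apply: ord_le_trans z0r _; case: zz0.
have ez : ord_le e (R z) by apply: ord_le_trans (nadd_le_r _ _) nz.
have before_z y : chain y -> before y z.
  move=> Cy; apply: olt_le_trans ez; apply: olt_trans (bC _ Cy); exact: b_gt (chainY Cy).
have elay : ord_le e (rk (layer z)).
  apply: nlt_le => laye; have := nadd_lt_r (rk DC) laye; apply: ole_nlt.
  apply: ord_le_trans nz _; apply: ord_le_trans (rk_union _ _).
  apply: rk_mono => w zw; case: (classic (DC w)) => [|nDC]; first by left.
  right; split=> // y _ Cy; apply: NNPP => nyw; apply: nDC; exists y => //.
  by case: zw.
have Cz : chain z.
  rewrite chainE; split=> // y yz Cy; split; first exact: above.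
  by apply: ord_le_trans elay; apply: olt_le; exact: bC.
exact: (ole_nlt ez (olt_trans (b_gt Yz) (bC z Cz))).
Qed.

(** Of two chain elements with large [b], the later one has a layer of rank at least [b] of the
    earlier one. *)
Lemma layer_cofinal e : olt e (rk P) -> exists2 z, chain z & ord_le e (rk (layer z)).
Proof.
move=> eP; have [y Cy ey] := chain_cofinal eP.
have [z Cz yz] := chain_cofinal (P_succ (b_lt (chainY Cy))).
have byz : olt (b y) (b z) by apply: olt_le_trans yz; exact: olt_succ.
case: (ole_or_lt (R z) (R y)) => [zy|yz'].
  case: (ole_eq_or_lt zy) => [E|zy'].
    by move: byz; rewrite (chain_uniq Cz Cy E) => /olt_irrefl.
  exists y => //; have := Cy; rewrite chainE => -[_ _ /(_ _ zy' Cz)[_ h]].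
  by apply: ord_le_trans h; apply: ord_le_trans ey _; exact: olt_le.
exists z => //; have := Cz; rewrite chainE => -[_ _ /(_ _ yz' Cy)[_ h]].
exact: ord_le_trans h.
Qed.

Lemma layer_rk_lt z : chain z -> olt (rk (layer z)) (rk P).
Proof.
move=> Cz; apply: ole_lt_trans (rk_res_lt (proj1 Y_large _ (chainY Cz))).
by apply: rk_mono => w [].
Qed.

(** A chain element whose layer outranks the residual of [w] cannot lie below [w]. The first chain
    element not below [w] then determines the layer of [w]. *)
Lemma layer_exists w : P w -> exists z, [/\ chain z, ~ le z w &
  forall z', chain z' -> ~ le z' w -> ord_le (R z) (R z')].
Proof.
move=> Pw; have [z Cz hz] := layer_cofinal (P_succ (rk_res_lt Pw)).
have nzw : ~ le z w.
  move=> zw; have : ord_le (R z) (R w).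
    apply: rk_mono => y [Py zy]; split=> // wy; apply: zy; exact: wqo_trans wy.
  move/ole_nlt; apply; apply: olt_le_trans (olt_succ _) _.
  by apply: ord_le_trans hz _; apply: rk_mono => y [].
have [e [z' [Cz' nz' ee]] emin] := @ord_min
  (fun e => exists z, [/\ chain z, ~ le z w & e = R z]) (R z) (ex_intro _ z (And3 Cz nzw erefl)).
by exists z'; split=> // z'' Cz'' nz''; rewrite -ee; apply: emin; exists z''.
Qed.

Hypothesis layer_lin : forall z, chain z -> max_linearizable (layer z).

Lemma chain_linearizable : max_linearizable P.
Proof.
have [zof Hzof] := @choice_fun X X (fun w z => P w -> [/\ chain z, ~ le z w &
  forall z', chain z' -> ~ le z' w -> ord_le (R z) (R z')]) (fun w =>
    match classic (P w) with
    | or_introl Pw => let: ex_intro z hz := layer_exists Pw in ex_intro _ z (fun _ => hz)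
    | or_intror nPw => ex_intro _ w (fun Pw => False_ind _ (nPw Pw))
    end).
have [H HH] := @choice_fun X (X -> Ord) (fun z h => chain z ->
    (forall x y, layer z x -> layer z y -> le x y -> ord_le (h x) (h y)) /\
    tge h (layer z) (rk (layer z))) (fun z =>
    match classic (chain z) with
    | or_introl Cz => let: ex_intro h hz := layer_lin Cz in ex_intro _ h (fun _ => hz)
    | or_intror nCz => ex_intro _ (fun _ => ozero) (fun Cz => False_ind _ (nCz Cz))
    end).
(* [B] strictly bounds all heights used inside layers, so the offsets [B * R] keep different layers
   apart and in order. *)
pose B := mkOrd (X * X) (fun p => H p.1 p.2).
have HB z w : olt (H z w) B by exists (z, w); exact: ord_le_refl.
pose h w := oadd (omul B (R (zof w))) (H (zof w) w).
have in_layer w : P w -> layer (zof w) w.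
  move=> Pw; have [Cz nz zmin] := Hzof w Pw; split=> // y yz Cy.
  by apply: NNPP => nyw; exact: (ole_nlt (zmin y Cy nyw) yz).
have zofE z w : chain z -> layer z w -> zof w = z.
  move=> Cz [[Pw nzw] lw]; have [Cz' nz' zmin] := Hzof w Pw.
  apply: chain_uniq => //; split; first exact: zmin.
  by apply: nlt_le => lt; apply: nz'; exact: lw.
exists h; split=> [x y Px Py xy|e eP].
  have [Cx nx xmin] := Hzof x Px; have [Cy ny ymin] := Hzof y Py.
  have nyx : ~ le (zof y) x by move=> yx; apply: ny; exact: wqo_trans yx xy.
  case: (ole_eq_or_lt (xmin _ Cy nyx)) => [E|lt].
    have E' := chain_uniq Cx Cy E.
    rewrite /h -E'; apply: oadd_mono_r; apply: (proj1 (HH _ Cx)) => //; first exact: in_layer.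
    by rewrite E'; exact: in_layer.
  apply: olt_le; apply: olt_le_trans (oadd_le_l _ _).
  by apply: olt_le_trans (omul_lt _ lt); apply: oadd_lt_r.
have [z Cz ez] := layer_cofinal (P_succ eP).
have [_ tz] := HH z Cz.
have [x lx Hx] := tz e (olt_le_trans (olt_succ e) ez).
exists x; first by case: lx => -[].
apply: (hge_mono _ _ lx Hx (ord_le_refl _)); first by move=> y [[]].
by move=> y w ly lw; rewrite /h (zofE z) // (zofE z) //; exact: oadd_lt_r.
Qed.
End Chain.
End Indecomposable.

(** With [rk P = k + omega^c]: for [k = 0] the rank is 1 (one height suffices) or is closed under
    natural sums, and the chain applies. For [k > 0] both [k] and [omega^c <= k] are below [rk P],
    and two pieces of these ranks are stacked. *)
Theorem max_linearization P : max_linearizable P.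
Proof.
move E : (rk P) => r; have {E} E : ord_eq (rk P) r by rewrite E; exact: ord_eq_refl.
elim/(well_founded_induction olt_wf): r P E => r IH P rP.
have {}IH U : olt (rk U) (rk P) -> max_linearizable U.
  move=> UP; apply: (IH (rk U)); last exact: ord_eq_refl.
  by apply: olt_le_trans UP _; case: rP.
case: (ole_or_lt (rk P) ozero) => [P0|P0].
  exists (fun _ => ozero); split=> [*|e eP]; first exact: ord_le_refl.
  by have [[]] := olt_le_trans eP P0.
have [k [c [Pk kmul]]] := last_power P0.
case: (ole_or_lt k ozero) => [k0|k0].
  have Pc : ord_eq (rk P) (oexp_omega c).
    apply: ord_eq_trans Pk _; split; last exact: oadd_le_r.
    by apply: ord_le_trans (oadd_mono_l _ k0) _; case: (add0o (oexp_omega c)).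
  have [x0 Px0 _] := rk_lt_res P0.
  case: (ole_or_lt c ozero) => [c0|c0].
    exists (fun _ => ozero); split=> [*|e eP]; first exact: ord_le_refl.
    exists x0 => //; apply: hge_lt => d de.
    have := olt_le_trans eP (ord_le_trans (proj1 Pc) (oexp_mono c0)).
    move=> /olt_exp_elim[e0|[? [[]]]].
    by have [[]] := olt_le_trans de e0.
  have Pnadd a b : olt a (rk P) -> olt b (rk P) -> olt (nadd a b) (rk P).
    move=> ha hb; apply: olt_le_trans (proj2 Pc).
    by apply: oexp_nadd_lt; [apply: olt_le_trans ha _|apply: olt_le_trans hb _]; case: Pc.
  have Psucc a : olt a (rk P) -> olt (osucc a) (rk P).
    move=> ha; apply: olt_le_trans (proj2 Pc).
    apply: (@ole_lt_trans _ (oadd a (onat 1))).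
      by apply: olt_le_succ; apply: olt_add_pos; exact: olt_succ.
    apply: oexp_add_lt; first by apply: olt_le_trans ha _; case: Pc.
    exact: onat_lt_exp.
  have [Y [lY minY]] := minimal_large P.
  have [b Hb] : exists b : X -> Ord, forall y, Y y -> [/\ olt (b y) (rk P),
      olt (rk (res le P y)) (b y) &
      forall z, Y z -> ~ le y z -> olt (rk (res le P z)) (b y)].
    apply: (@choice_fun _ _ (fun y d => Y y -> [/\ olt d (rk P), olt (rk (res le P y)) d &
      forall z, Y z -> ~ le y z -> olt (rk (res le P z)) d])) => y.
    case: (classic (Y y)) => [Yy|nY]; last by exists ozero.
    have [e eP He] : exists2 e, olt e (rk P) &
        forall z, Y z -> ~ le y z -> olt (rk (res le P z)) e.
      apply: NNPP => ne; apply: (minY y Yy); split=> [z [/(proj1 lY)]//|e eP].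
      apply: NNPP => nz; apply: ne; exists e => // z Yz yz.
      by apply: nle_lt => ez; apply: nz; exists z.
    have [d dP [ed yd]] := olt_max eP (Psucc _ (rk_res_lt (proj1 lY _ Yy))).
    exists d => _; split=> //; first by apply: olt_le_trans yd; exact: olt_succ.
    by move=> z Yz yz; apply: olt_le_trans ed; exact: He.
  apply: (@chain_linearizable P Pnadd Psucc x0 Y b lY).
  - by move=> y /Hb[].
  - by move=> y /Hb[].
  - by move=> y z /Hb[_ _ h] Yz yz; exact: h.
  - by move=> z Cz; apply: IH; exact: layer_rk_lt Cz.
have kP : olt k (rk P).
  by apply: olt_le_trans (proj2 Pk); apply: olt_add_pos; exact: oexp_pos.
have ck : ord_le (oexp_omega c) k.
  by apply: ord_le_trans (kmul _ k0); exact: oadd_le_r.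
have [D [Dk DP Ddown]] := exact_rank (olt_le kP).
pose U x := P x /\ ~ D x.
(* Otherwise [P], the union of [D] and [U], would have rank below [k + omega^c] by [nadd_exp_lt]. *)
have cU : ord_le (oexp_omega c) (rk U).
  apply: nlt_le => Uc; have := nadd_exp_lt kmul Uc; apply: ole_nlt.
  apply: ord_le_trans (proj2 Pk) _.
  apply: (@ord_le_trans _ (nadd (rk D) (rk U))).
    apply: ord_le_trans (rk_union D U); apply: rk_mono => x Px.
    by case: (classic (D x)) => Dx; [left|right].
  by apply: nadd_mono; [case: Dk|exact: ord_le_refl].
have [U' [U'c U'U U'down]] := exact_rank cU.
apply: (@max_linearizable_stack P D U' k (oexp_omega c)) => //.
- by case: U'c.
- by move=> x y U'y Px nDx; apply: U'down.
- by apply: IH; apply: ole_lt_trans kP; case: Dk.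
- by apply: IH; apply: ole_lt_trans kP; apply: ord_le_trans ck; case: U'c.
Qed.
End Rank.

(** * Order types of linearizations compared with ranks *)

Lemma acc_rank_mono (A : Type) (R : A -> A -> Prop) x y (Hx : Acc R x) (Hy : Acc R y) :
  (forall z, R z x -> R z y) -> ord_le (acc_rank Hx) (acc_rank Hy).
Proof.
elim/Acc_inv_dep: Hx y Hy => {}x hx IH y [hy] xy /= [z zx].
by exists (exist _ z (xy _ zx)); exact: IH.
Qed.

Lemma acc_rank_surj (A : Type) (R : A -> A -> Prop) (w : well_founded R) x a :
  ord_le a (acc_rank (w x)) -> exists y, ord_eq (acc_rank (w y)) a.
Proof.
elim/(well_founded_induction w): x => x IH ax.
case: (ole_eq_or_lt ax) => [E|]; first by exists x; exact: ord_eq_sym.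
case: (w x) => h [[z zx] /= az]; apply: (IH z zx).
by apply: ord_le_trans az _; exact: acc_rank_mono.
Qed.

Section MaxOtype.
Variables (X : Type) (le : X -> X -> Prop).

(** A strictly [L]-descending sequence is bad for [le], so descending below [x] traces a branch of
    the tree of bad sequences. *)
Lemma acc_rank_rle (L : X -> X -> Prop) P d x (H : Acc (strict L) x) :
  (forall x y, le x y -> L x y) -> rle le P d -> (forall y, strict L y x -> P y) ->
  (forall x y z, L x y -> L y z -> L x z) -> ord_le (acc_rank H) d.
Proof.
move=> ext + + tr; elim: d P x H => A f IH P x [h] /= Hd Px [y yx] /=.
have [a Ha] := Hd y (Px y yx); exists a; apply: (IH a _ _ _ Ha) => z [zy nyz].
split; last by move=> /ext.
apply: Px; split; first exact: tr zy (proj1 yx).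
by move=> xz; apply: nyz; exact: tr (proj1 yx) xz.
Qed.

Lemma max_otype_le d : rle le (fun _ => True) d -> ord_le (max_otype le) d.
Proof.
move=> H; apply: osup_le => -[L [[[Lr Lt] [tot ext]] w]].
apply/ord_leP => x /=; case: d H => A f H.
have [a Ha] := H x I; exists a => /=.
apply: (acc_rank_rle _ _ Ha _ Lt) => // y [yx nxy].
by split=> // /ext.
Qed.

Hypothesis le_wqo : wqo le.
Let T := fun _ : X => True.

(** Unlike heights, accessibility ranks have no gaps: every ordinal below the maximal type is the
    rank of an element, which can therefore serve as its name in the lower bound. *)
Lemma max_rank_function : exists rho : X -> Ord,
  [/\ forall x y, le x y -> ord_le (rho x) (rho y),
      forall a, olt a (rk le_wqo T) -> exists x, ord_eq (rho x) a &
      ord_le (rk le_wqo T) (max_otype le)].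
Proof.
have [h [hmono ht]] := max_linearization le_wqo T.
pose L x y := ord_le (h x) (h y).
have strictE x y : strict L x y <-> olt (h x) (h y).
  split; first by move=> [_ /nle_lt].
  by move=> xy; split; [exact: olt_le | move=> /ole_nlt; apply].
have w : well_founded (strict L).
  apply: (wf_incl _ _ (fun x y => olt (h x) (h y))); first by move=> x y /strictE.
  exact: (wf_inverse_image _ _ _ h olt_wf).
have linL : linearization le L.
  split; first by split=> [x|x y z]; [exact: ord_le_refl | exact: ord_le_trans].
  split=> [x y|x y xy]; last exact: hmono.
  by case: (ole_or_lt (h x) (h y)) => [|/olt_le]; [left|right].
have hgeP e x (H : Acc (strict L) x) : hge h T e x -> ord_le e (acc_rank H).
  elim: e x H => A f IH x [hx] Hx a.
  have [y [_ /strictE yx Hy]] := Hx a; exists (exist _ y yx); exact: IH.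
exists (fun x => acc_rank (w x)); split.
- move=> x y xy; apply: acc_rank_mono => z /strictE zx; apply/strictE.
  by apply: olt_le_trans zx _; exact: hmono.
- by move=> a /ht[x _ Hx]; apply: (@acc_rank_surj _ _ w x); exact: hgeP.
- apply: ord_le_trans (le_osup (fun p : {L : X -> X -> Prop | linearization le L /\
    well_founded (strict L)} => wf_type (proj2 (proj2_sig p))) (exist _ L (conj linL w))).
  apply/ord_leP => c; have [x _ Hx] := ht _ (child_lt c).
  by exists x; exact: hgeP.
Qed.

Lemma max_otype_rk : ord_eq (max_otype le) (rk le_wqo T).
Proof.
split; first by apply: max_otype_le; exact: rk_rle.
by have [rho []] := max_rank_function.
Qed.

Lemma max_otype_ge d : rge le T d -> ord_le d (max_otype le).
Proof.
by move=> H; apply: ord_le_trans (proj2 max_otype_rk); exact: rk_ge.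
Qed.

Lemma max_otype_rle : rle le T (max_otype le).
Proof. by apply: rle_mono (proj2 max_otype_rk) (rk_rle le_wqo T). Qed.
End MaxOtype.

Lemma max_otype_reflect (X Y : Type) (leX : X -> X -> Prop) (leY : Y -> Y -> Prop) (F : X -> Y) :
  wqo leY -> (forall x y, leY (F x) (F y) -> leX x y) -> ord_le (max_otype leX) (max_otype leY).
Proof.
move=> wY refl; apply: max_otype_le.
by apply: (rle_map _ _ (ord_le_refl _) (max_otype_rle wY)) => // x y _ _; exact: refl.
Qed.

(** * Trees: the upper bound *)

Lemma rle_intro (X : Type) (le : X -> X -> Prop) P d :
  (forall x, P x -> exists2 e, olt e d & rle le (res le P x) e) -> rle le P d.
Proof.
case: d => A f H x /H[e [a ea] He]; exists a.
by apply: rle_mono He.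
Qed.

Lemma rle_empty (X : Type) (le : X -> X -> Prop) P d : (forall x, ~ P x) -> rle le P d.
Proof. by case: d => A f H x /H. Qed.

Section TreeInd.
Variables (Q : Type) (G : tree Q -> Prop).
Hypothesis G_leaf : forall q, G (Leaf q).
Hypothesis G_node : forall ts, (forall t, List.In t ts -> G t) -> G (Node ts).

Fixpoint tree_In_ind (t : tree Q) : G t :=
  match t with
  | Leaf q => G_leaf q
  | Node ts => G_node (fun t0 => (fix aux (l : list (tree Q)) : List.In t0 l -> G t0 :=
      match l return List.In t0 l -> G t0 with
      | nil => fun H => match H with end
      | cons u l' => fun H => match H with
                              | or_introl E => match E with erefl => tree_In_ind u end
                              | or_intror H' => aux l' H'
                              end
      end) ts)
  end.
End TreeInd.

Section Trees.
Variables (Q : Type) (le : Q -> Q -> Prop).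
Hypothesis le_qo : quasi_order le.
Local Notation tle := (tree_le le).
Implicit Types (s t u : tree Q) (W : Q -> Prop).

Lemma tle_leafE x y : tle (Leaf x) (Leaf y) -> le x y.
Proof. by move=> H; inversion H. Qed.

Lemma tle_leaf_nodeE x ts : tle (Leaf x) (Node ts) -> exists2 t, List.In t ts & tle (Leaf x) t.
Proof. by move=> H; inversion H as [|? ? t Ht Hx|]; exists t. Qed.

Lemma tle_nodeE ss ts : tle (Node ss) (Node ts) ->
  forall s, List.In s ss -> exists2 t, List.In t ts & tle s t.
Proof.
move=> H s sss; inversion H as [| |? ? Hn].
by have [t [tts st]] := Hn s sss; exists t.
Qed.

Lemma tle_node_leaf ss x : ~ tle (Node ss) (Leaf x).
Proof. by move=> H; inversion H. Qed.

Lemma tle_refl t : tle t t.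
Proof.
elim/tree_In_ind: t => [q|ts IH]; first by constructor; case: le_qo.
by constructor=> s sts; exists s; split=> //; exact: IH.
Qed.

Lemma tle_trans s t u : tle s t -> tle t u -> tle s u.
Proof.
elim/tree_In_ind: t s u => [q|ts IH] s u st tu.
  case: s st => [p /tle_leafE pq|ss /tle_node_leaf//].
  elim/tree_In_ind: u tu => [r /tle_leafE qr|us IHu /tle_leaf_nodeE[u' u'us /IHu h]].
    by constructor; case: le_qo => _; apply; eassumption.
  by apply: tle_leaf_node (h u'us).
case: u tu => [r /tle_node_leaf//|us tu].
case: s st => [p /tle_leaf_nodeE[t' t'ts pt]|ss st].
  have [u' u'us tu'] := tle_nodeE tu t'ts.
  by apply: (tle_leaf_node u'us); exact: IH tu'.
constructor=> s' s'ss; have [t' t'ts st'] := tle_nodeE st s'ss.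
by have [u' u'us tu'] := tle_nodeE tu t'ts; exists u'; split=> //; exact: IH tu'.
Qed.

Lemma Tf_quasi_order : quasi_order (Tf_le le).
Proof. by split=> [x|x y z]; [exact: tle_refl | exact: tle_trans]. Qed.

Inductive tin W : tree Q -> Prop :=
| tin_leaf q : W q -> tin W (Leaf q)
| tin_node ts : ts <> nil -> (forall t, List.In t ts -> tin W t) -> tin W (Node ts).

Lemma tin_wf t : tree_wf t -> tin (fun _ => True) t.
Proof. by elim=> *; constructor. Qed.

Lemma wf_tin W t : tin W t -> tree_wf t.
Proof. by elim=> *; constructor. Qed.

Definition leaves W t := exists2 q, t = Leaf q & W q.
Definition nodes (P : tree Q -> Prop) t := exists2 ts, t = Node ts & forall s, List.In s ts -> P s.

Lemma rle_leaves W d : rle le W d -> rle tle (leaves W) d.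
Proof.
elim: d W => A f IH W /= H t [q -> Wq]; have [a Ha] := H q Wq; exists a.
apply: rle_mono (ord_le_refl _) (IH a _ Ha) => s [[p -> Wp] nqp]; exists p => //.
by split=> // qp; apply: nqp; constructor.
Qed.

Lemma rle_list_union (G : tree Q -> tree Q -> Prop) d ss :
  (forall a b, olt a d -> olt b d -> olt (nadd a b) d) -> olt ozero d ->
  (forall s, List.In s ss -> exists2 e, olt e d & rle tle (G s) e) ->
  exists2 e, olt e d & rle tle (fun t => exists2 s, List.In s ss & G s t) e.
Proof.
move=> dn d0; elim: ss => [|s ss IH] H.
  by exists ozero => //; apply: rle_empty => t [s []].
have [e ed He] := H s (or_introl erefl).
have [e' ed' He'] : exists2 e, olt e d & rle tle (fun t => exists2 s, List.In s ss & G s t) e.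
  by apply: IH => u uss; apply: H; right.
exists (nadd e e'); first exact: dn.
apply: rle_mono (ord_le_refl _) (rle_union He He') => t [u [->|uss] Gu]; first by left.
by right; exists u.
Qed.

Lemma not_tle_node ss ts : ~ tle (Node ss) (Node ts) ->
  exists2 s, List.In s ss & forall t, List.In t ts -> ~ tle s t.
Proof.
move=> H; apply: NNPP => nH; apply: H; constructor=> s sss.
apply: NNPP => ns; apply: nH; exists s => // t tts st; apply: ns; by exists t.
Qed.

(** A finite set not above [Node ss] lies entirely in the residual of a single [s] of [ss]. The
    residual is thus a finite union of sets of ranks at most [omega^e] with [e < d], and [omega^d]
    is closed under natural sums. *)
Lemma rle_nodes P d : rle tle P d -> rle tle (nodes P) (oexp_omega d).
Proof.
elim: d P => A f IH P H; apply: rle_intro => _ [ss -> Pss].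
have [|||e ed He] := @rle_list_union (fun s => nodes (res tle P s)) (oexp_omega (mkOrd A f)) ss.
- exact: oexp_nadd_lt.
- exact: oexp_pos.
- move=> s sss; have [a Ha] := H s (Pss s sss).
  exists (oexp_omega (f a)); last exact: IH.
  by apply: oexp_lt; exact: (@child_lt (mkOrd A f)).
exists e => //; apply: rle_mono (ord_le_refl _) He => _ [[ts -> Pts] /not_tle_node[s sss ns]].
exists s => //; exists ts => // t tts; split; [exact: Pts|exact: ns].
Qed.

Lemma rle_trees W a y : rle le W a -> olt a (oeps y) ->
  (forall q, W q -> exists2 e, olt e (oeps y) & rle tle (tin (res le W q)) e) ->
  rle tle (tin W) (oeps y).
Proof.
move=> Wa ay Wres; apply: rle_intro; elim/tree_In_ind=> [q|ts IH] tW.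
  have Wq : W q by inversion tW.
  have [e ey He] := Wres q Wq; exists e => //.
  apply: rle_mono (ord_le_refl _) He => s [] {tW}.
  elim=> [p Wp np|ss ssn _ IHs np]; constructor=> //.
    by split=> // qp; apply: np; constructor.
  by move=> u uss; apply: IHs => // qu; apply: np; apply: tle_leaf_node qu.
have tsW t : List.In t ts -> tin W t by inversion tW as [|? ? H]; exact: H.
have [|||e ey He] := @rle_list_union (fun t => nodes (res tle (tin W) t)) (oeps y) ts.
- exact: oeps_nadd_lt.
- exact: oeps_pos.
- move=> t tts; have [e ey He] := IH t tts (tsW t tts).
  by exists (oexp_omega e); [exact: oeps_exp_lt | exact: rle_nodes].
(* The summand [a] pays for the leaves, none of which is above a node. *)
exists (nadd a e); first exact: oeps_nadd_lt.
apply: rle_mono (ord_le_refl _) (rle_union (rle_leaves Wa) He) => s [].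
case=> [q Wq _|ss _ ssW /not_tle_node[t tts nt]]; first by left; exists q.
right; exists t => //; exists ss => // u uss; split; [exact: ssW|exact: nt].
Qed.

Fixpoint depth t : nat :=
  match t with
  | Leaf _ => 0
  | Node ts => (foldr maxn 0 (map depth ts)).+1
  end.

Lemma depth_child t ts : List.In t ts -> depth t < depth (Node ts).
Proof.
rewrite /= ltnS; elim: ts => //= u ts IH [->|/IH h]; first exact: leq_maxl.
exact: leq_trans h (leq_maxr _ _).
Qed.

Lemma depth_attained ts : ts <> nil -> exists2 t, List.In t ts & depth (Node ts) = (depth t).+1.
Proof.
elim: ts => //= u [|v ts] IH _; first by exists u; [left|rewrite /= maxn0].
have [//|t tts [E]] := IH; move: E => /= E.
case: (leqP (depth u) (depth t)) => h; last by exists u; [left|rewrite E (maxn_idPl (ltnW h))].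
by exists t; [right|rewrite E (maxn_idPr h)].
Qed.

Lemma tle_depth s t : tle s t -> depth s <= depth t.
Proof.
elim/tree_In_ind: s t => [q|ss IH] [p|ts] // st; first by case: (tle_node_leaf st).
rewrite [depth (Node ss)]/= ltnS.
elim: ss IH st => //= s ss IHss IH st; rewrite geq_max; apply/andP; split.
  have [t tts s_t] := tle_nodeE st (or_introl erefl).
  by have := depth_child tts; rewrite /= ltnS; apply: leq_trans; exact: IH (or_introl erefl) _ s_t.
apply: IHss; first by move=> u uss; apply: IH; right.
constructor=> u uss; have [t tts u_t] := tle_nodeE st (or_intror uss); by exists t.
Qed.

(** Over pairwise equivalent labels a tree is determined up to equivalence by its depth; this is the
    source of [g(1) = omega]. The induction matches every child with a deepest child of the other
    tree. *)
Lemma depth_tle W s t : (forall p q, W p -> W q -> le p q) -> tin W s -> tin W t ->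
  depth s <= depth t -> tle s t.
Proof.
move=> Wle; have leafle p u : W p -> tin W u -> tle (Leaf p) u.
  move=> Wp; elim=> [q Wq|us usn _ IH]; first by constructor; exact: Wle.
  by case: us usn IH => // v vs _ IH; apply: (@tle_leaf_node _ _ _ _ v); [left|apply: IH; left].
elim/tree_In_ind: s t => [p|ss IH] t sW tW st; first by apply: leafle => //; inversion sW.
case: t tW st => [//|ts] tW st; constructor=> s sss.
have tsn : ts <> nil by inversion tW.
have [t tts tE] := depth_attained tsn; exists t; split=> //.
apply: IH => //; [by inversion sW as [|? ? H]; exact: H | by inversion tW as [|? ? H]; exact: H|].
by rewrite -ltnS -tE; apply: leq_trans st; exact: depth_child.
Qed.

Lemma rle_nat_below n : rle (fun i j : nat => i <= j) (fun i => i < n) (onat n).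
Proof.
elim: n => [|n IH] /=; first by move=> i.
move=> i i_n; exists tt; apply: rle_mono (ord_le_refl _) IH => j [_ /negP].
by rewrite -ltnNge => ji; exact: leq_trans ji i_n.
Qed.

Lemma rle_trees_one W : rle le W (onat 1) -> rle tle (tin W) oomega.
Proof.
move=> H; have Wle p q : W p -> W q -> le p q.
  move=> Wp Wq; apply: NNPP => pq; have [_ H'] := H p Wp.
  by have [] := H' q (conj Wq pq).
apply: (@rle_map _ _ _ (fun i j : nat => i <= j) depth _ (fun _ => True) oomega) => //.
- by move=> s t sW tW; exact: depth_tle sW tW.
- exact: ord_le_refl.
move=> n _; exists n; apply: rle_mono (ord_le_refl _) (rle_nat_below n) => j [_ nj].
by rewrite ltnNge; apply/negP.
Qed.
End Trees.

Definition eps_overshoot (b : Ord) : Prop := exists (g : Ord) (n : nat),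
  ord_eq b (oadd g (onat n)) /\ ord_eq (oeps g) g.

Definition ebar (b : Ord) : Ord :=
  if excluded_middle_informative (eps_overshoot b) then oeps (osucc b) else oeps b.

Lemma ebarE b : exists2 c, ebar b = oeps c & ord_le b c.
Proof.
rewrite /ebar; case: (excluded_middle_informative _) => h; last by exists b => //; exact: ord_le_refl.
by exists (osucc b) => //; apply: olt_le; exact: olt_succ.
Qed.

(** This strictness is what the shift at fixed points secures: the leaves alone have rank 2 + [b],
    which must stay below the bound. *)
Lemma ebar_gt b : olt b (ebar b).
Proof.
rewrite /ebar; case: (excluded_middle_informative _) => h.
  by apply: olt_le_trans (olt_succ b) (oeps_ge _).
case: (ole_eq_or_lt (oeps_ge b)) => // E; case: h; exists b, 0; split; last exact: ord_eq_sym.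
by apply: ord_eq_sym; exact: oadd0.
Qed.

Lemma eps_overshoot_succ a b : eps_overshoot a -> ord_eq (osucc a) b -> eps_overshoot b.
Proof.
move=> [g [n [an eg]]] [ab ba]; exists g, n.+1; split=> //.
have [h1 h2] := oadd_succ g (onat n); have [a1 a2] := an.
split; first by apply: ord_le_trans ba _; apply: ord_le_trans h2; exact: osucc_mono.
by apply: ord_le_trans ab; apply: ord_le_trans h1 _; exact: osucc_mono.
Qed.

Lemma ebar_lt a b : olt a b -> olt (ebar a) (ebar b).
Proof.
move=> ab; rewrite /ebar; case: (excluded_middle_informative (eps_overshoot a)) => ha;
  case: (excluded_middle_informative (eps_overshoot b)) => hb; apply: oeps_lt => //.
- by apply: ole_lt_trans (olt_succ b); exact: olt_le_succ.
(* Here the index of [a] is raised and that of [b] is not; [b] cannot be the successor of [a], since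
   the shift persists at successors. *)
- case: (ole_eq_or_lt (olt_le_succ ab)) => // E; case: hb; exact: eps_overshoot_succ E.
- exact: olt_trans ab (olt_succ b).
Qed.

Lemma rle_trees_ebar (Q : Type) (le : Q -> Q -> Prop) (W : Q -> Prop) b : quasi_order le ->
  rle le W (oadd (onat 2) b) -> rle (tree_le le) (tin W) (ebar b).
Proof.
move=> qo; elim/(well_founded_induction olt_wf): b W => b IH W Wb.
have [c E bc] := ebarE b; have bE := ebar_gt b; rewrite E in bE *.
apply: (rle_trees Wb) => [|q Wq].
  apply: olt_le_trans (oeps_fix c); apply: oexp_add_lt.
    by apply: onat_lt_exp; exact: oeps_pos.
  exact: olt_le_trans bE (oexp_ge _).
(* A residual has rank at most 1, the only child of [onat 2], or at most 2 + [g i]. The former gives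
   trees of rank at most [omega], the latter falls under the induction. *)
case: b IH Wb E {bc bE} => B g IH Wb E; have [[[]|i] Hi] := Wb q Wq.
  exists oomega; [exact: oomega_lt_eps | exact: rle_trees_one].
have gb : olt (g i) (mkOrd B g) by exact: (@child_lt (mkOrd B g)).
exists (ebar (g i)); [by rewrite -E; exact: ebar_lt | exact: IH].
Qed.

(** * Trees: the lower bound *)

(** [V x a] reads: [x] is a name of [a]. Names of descending ordinals form a bad sequence when no
    larger name lies below a smaller one. *)
Lemma rge_family (X : Type) (le : X -> X -> Prop) (P : X -> Prop) (V : X -> Ord -> Prop) d :
  (forall a, olt a d -> exists2 x, P x & V x a) ->
  (forall x y a b, V x a -> V y b -> olt a b -> ~ le y x) -> rge le P d.
Proof.
move=> + Vle; elim: d P => A f IH P HP a.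
have [x Px Vx] := HP (f a) (@child_lt (mkOrd A f) a).
exists x => //; apply: IH => b bfa.
have [y Py Vy] := HP b (olt_trans bfa (@child_lt (mkOrd A f) a)).
by exists y => //; split=> //; exact: Vle Vy Vx bfa.
Qed.

Lemma onat_le_elim n a : ord_le a (onat n) -> exists2 m, m <= n & ord_eq a (onat m).
Proof.
elim: n a => [|n IH] a; first by exists 0 => //; split=> //; exact: ole0.
move=> an; case: (ole_eq_or_lt an) => [E|/olt_succ_le/IH[m mn E]]; first by exists n.+1.
by exists m => //; exact: leqW.
Qed.

Lemma onat_mono m n : m <= n -> ord_le (onat m) (onat n).
Proof.
elim: n m => [|n IH] [|m] // mn; try exact: ole0.
by apply: osucc_mono; exact: IH.
Qed.

Fixpoint clt (l m : seq Ord) : Prop :=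
  match l, m with
  | _, [::] => False
  | [::], _ :: _ => True
  | a :: l', b :: m' => olt a b \/ (ord_eq a b /\ clt l' m')
  end.

Fixpoint ceq (l m : seq Ord) : Prop :=
  match l, m with
  | [::], [::] => True
  | a :: l', b :: m' => ord_eq a b /\ ceq l' m'
  | _, _ => False
  end.

Lemma ceq_csum l m : ceq l m -> ord_eq (csum l) (csum m).
Proof.
elim: l m => [|a l IH] [|b m] //=; first by move=> _; exact: ord_eq_refl.
by move=> [[ab ba] /IH[h1 h2]]; split; apply: oadd_mono => //; exact: oexp_mono.
Qed.

Lemma ceq_cdesc l m : ceq l m -> cdesc l -> cdesc m.
Proof.
elim: l m => [|a l IH] [|b m] //= [ab lm] [la dl]; split; last exact: IH dl.
move=> c cm; apply: ord_le_trans (proj1 ab).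
elim: l m lm cm la {IH dl} => [|d l IH] [|e m] //= [de lm] [<-|cm] la.
  by apply: ord_le_trans (proj2 de) _; apply: la; left.
by apply: (IH m) => // x xl; apply: la; right.
Qed.

Lemma ctotal l m : ceq l m \/ clt l m \/ clt m l.
Proof.
elim: l m => [|a l IH] [|b m] /=; auto.
case: (ole_or_lt a b) => [ab|]; last by auto.
case: (ole_eq_or_lt ab) => [E|]; last by auto.
have E' := ord_eq_sym E; case: (IH m) => [h|[h|h]]; tauto.
Qed.

Lemma clt_csum l m : cdesc l -> clt l m -> olt (csum l) (csum m).
Proof.
elim: l m => [|a l IH] [|b m] //=.
  by move=> _ _; apply: olt_le_trans (oexp_pos b) (oadd_le_l _ _).
move=> [la dl] [ab|[E lm]].
  apply: olt_le_trans (oadd_le_l _ _); apply: (@csum_lt b (a :: l)) => c [<-//|cl].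
  exact: ole_lt_trans (la c cl) ab.
apply: ole_lt_trans (oadd_mono_l _ (oexp_mono (proj1 E))) _.
by apply: oadd_lt_r; exact: IH.
Qed.

Lemma csum_clt l m : cdesc l -> cdesc m -> olt (csum l) (csum m) -> clt l m.
Proof.
move=> dl dm lm; case: (ctotal l m) => [/ceq_csum[_ h]|[//|h]].
  by case: (ole_nlt h lm).
by case: (olt_irrefl (olt_trans lm (clt_csum dm h))).
Qed.

Lemma csum_ceq l m : cdesc l -> cdesc m -> ord_eq (csum l) (csum m) -> ceq l m.
Proof.
move=> dl dm [lm ml]; case: (ctotal l m) => [//|[h|h]].
  by case: (ole_nlt ml (clt_csum dl h)).
by case: (ole_nlt lm (clt_csum dm h)).
Qed.

Lemma In_map_elim (A B : Type) (f : A -> B) b l :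
  List.In b (map f l) -> exists2 a, List.In a l & b = f a.
Proof.
elim: l => //= a l IH [<-|/IH[c cl ->]]; first by exists a; [left|].
by exists c; [right|].
Qed.

Lemma In_map_intro (A B : Type) (f : A -> B) a l : List.In a l -> List.In (f a) (map f l).
Proof. by elim: l => //= b l IH [->|/IH]; [left|right]. Qed.

Section Lower.
Variables (Q : Type) (le : Q -> Q -> Prop).
Hypothesis le_qo : quasi_order le.
Local Notation tle := (tree_le le).
Let leafE x y : tle (Leaf x) (Leaf y) -> le x y := @tle_leafE Q le x y.
Let leaf_nodeE x ts : tle (Leaf x) (Node ts) -> exists2 t, List.In t ts & tle (Leaf x) t :=
  @tle_leaf_nodeE Q le x ts.
Variable q0 : Q.

Definition spine n : tree Q := iter n (fun t => Node [:: t]) (Leaf q0).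

Arguments spine : simpl never.

Lemma spineS n : spine n.+1 = Node [:: spine n].
Proof. by []. Qed.

Lemma depth_spine n : depth (spine n) = n.
Proof. by elim: n => // n IH; rewrite spineS /= IH maxn0. Qed.

Lemma spine_wf n : tree_wf (spine n).
Proof. by elim: n => [|n IH]; constructor=> // t [<-|]. Qed.

Lemma rge_spines : rge tle (@tin Q (fun _ => True)) oomega.
Proof.
apply: (@rge_family _ _ _ (fun t a => exists2 n, t = spine n & ord_eq a (onat n))).
  move=> a [n /onat_le_elim[m _ am]]; exists (spine m); last by exists m.
  by apply: tin_wf; exact: spine_wf.
move=> _ _ a b [m -> am] [n -> bn] ab /tle_depth; rewrite !depth_spine => nm.
apply: (ole_nlt _ ab); apply: ord_le_trans (proj1 bn) _.
by apply: ord_le_trans (proj2 am); exact: onat_mono.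
Qed.

Lemma leaf_spine p n : tle (Leaf p) (spine n) -> le p q0.
Proof.
elim: n => [|n IH] H; first exact: tle_leafE H.
rewrite spineS in H.
by have [t [<-|//]] := tle_leaf_nodeE H.
Qed.

(** [q0] builds the spines and [q1] the code of [g]; labels have [rho]-rank at least 2. With [g]
    zero, all labels denote epsilon numbers; with [g] a fixed point of the epsilon function, they
    also denote all ordinals below [g]. *)
Section Terms.
Variables (q1 : Q) (rho lab : Q -> Ord) (isl : Q -> Prop) (g : Ord).
Hypothesis rho_mono : forall p q, le p q -> ord_le (rho p) (rho q).
Hypothesis rho0 : ord_eq (rho q0) ozero.
Hypothesis rho1 : ord_eq (rho q1) (onat 1).
Hypothesis isl_gt : forall q, isl q -> olt (onat 1) (rho q).
Hypothesis lab_mono : forall p q, isl p -> isl q -> le p q -> ord_le (lab p) (lab q).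
Hypothesis lab_range : forall q, isl q ->
  olt (lab q) g \/ (olt g (lab q) /\ ord_le (oexp_omega (lab q)) (lab q)).

(* Trees over [Q] also serve as ordinal terms: [val] is the ordinal denoted by a term and
   [code] the tree that represents it. The exponents of a Cantor normal form are paired with
   spines of increasing height, so that a repeated or smaller exponent still matters. *)
Fixpoint val (t : tree Q) : Ord :=
  match t with
  | Leaf q => lab q
  | Node [::] => g
  | Node l => csum (map val l)
  end.

Fixpoint build (h : nat) (l : seq (tree Q)) : seq (tree Q) :=
  match l with
  | [::] => [::]
  | t :: l' => let h' := (maxn h (depth t)).+1 in Node [:: t; spine h'] :: build h' l'
  end.

Fixpoint code (t : tree Q) : tree Q :=
  match t with
  | Leaf q => Leaf q
  | Node [::] => Node [:: Leaf q1]
  | Node l => Node (build 0 (map code l))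
  end.

(** The last two conditions of [nf_node] keep the kinds of terms apart: a sum exceeding all its
    exponents is not an epsilon number, and it exceeds [g], so no label and no [Node [::]] has the
    same value. *)
Inductive nf : tree Q -> Prop :=
| nf_leaf q : isl q -> nf (Leaf q)
| nf_nil : nf (Node [::])
| nf_node l : l <> nil -> (forall t, List.In t l -> nf t) -> cdesc (map val l) ->
    (forall t, List.In t l -> olt (val t) (csum (map val l))) ->
    olt g (csum (map val l)) -> nf (Node l).

Lemma In_build h l u : List.In u (build h l) ->
  exists t k, List.In t l /\ u = Node [:: t; spine k].
Proof.
elim: l h => //= t l IH h [<-|/IH[s [k [sl ->]]]].
  by exists t, (maxn h (depth t)).+1; split=> //; left.
by exists s, k; split=> //; right.
Qed.

Lemma In_vals a l : List.In a (map val l) -> exists2 t, List.In t l & a = val t.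
Proof. exact: In_map_elim. Qed.

Lemma In_codes u l : List.In u (map code l) -> exists2 t, List.In t l & u = code t.
Proof. exact: In_map_elim. Qed.

Lemma valE l : l <> nil -> val (Node l) = csum (map val l).
Proof. by case: l. Qed.

Lemma codeE l : l <> nil -> code (Node l) = Node (build 0 (map code l)).
Proof. by case: l. Qed.

Lemma nf_nodeE l : l <> nil -> nf (Node l) -> [/\ forall t, List.In t l -> nf t,
  cdesc (map val l), forall t, List.In t l -> olt (val t) (csum (map val l)) &
  olt g (csum (map val l))].
Proof. by move=> ln H; inversion H; subst. Qed.

Lemma node_cases l : l = nil \/ l <> nil :> seq (tree Q).
Proof. by case: l; [left|right]. Qed.

(** A label has rank at least 2, so it fits neither into a spine nor under [q1]. It must lie under
    the code of an exponent, whose value is smaller than the sum. *)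
Lemma leaf_code q t : nf t -> isl q -> tle (Leaf q) (code t) -> ord_le (lab q) (val t).
Proof.
elim/tree_In_ind: t => [p|l IH] nt iq.
  by move=> /leafE; apply: lab_mono => //; inversion nt.
case: (node_cases l) => [E|ln].
  subst l => /= H; have [t [<-|//] /leafE/rho_mono h] := tle_leaf_nodeE H.
  by case: (ole_nlt (ord_le_trans h (proj1 rho1)) (isl_gt iq)).
have [lnf _ lt _] := nf_nodeE ln nt.
rewrite codeE // valE // => /leaf_nodeE[u /In_build[s [k [/In_codes[t tl ->] ->]]]].
move=> /leaf_nodeE[w [<-|[<-|//]]].
  by move=> /(IH _ tl (lnf _ tl) iq) h; apply: ord_le_trans h (olt_le (lt _ tl)).
move=> /leaf_spine/rho_mono h; case: (ole_nlt (ord_le_trans h (proj1 rho0))).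
by apply: olt_trans (isl_gt iq); exact: olt_succ.
Qed.

(** Spines have only leaves of rank 0; a leaf of positive rank prevents a code from lying below a
    spine. *)
Lemma code_leaf_pos t : nf t -> exists2 p, olt ozero (rho p) & tle (Leaf p) (code t).
Proof.
elim/tree_In_ind: t => [q|l IH] nt.
  exists q; last exact: tle_refl.
  by apply: olt_trans (isl_gt _); [exact: olt_succ | inversion nt].
case: (node_cases l) => [E|ln].
  subst l; exists q1; first by apply: olt_le_trans (proj2 rho1); exact: olt_succ.
  by apply: (@tle_leaf_node _ _ _ _ (Leaf q1)); [left | exact: tle_refl].
have [lnf _ _ _] := nf_nodeE ln nt; rewrite codeE //.
case: l ln lnf IH {nt} => // t l _ lnf IH.
have [p p0 pt] := IH t (or_introl erefl) (lnf t (or_introl erefl)).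
exists p => //=; apply: tle_leaf_node; first by left.
by apply: tle_leaf_node pt; left.
Qed.

Lemma code_spine t n : nf t -> ~ tle (code t) (spine n).
Proof.
move=> /code_leaf_pos[p p0 pt] ts.
have /rho_mono h := leaf_spine (tle_trans le_qo pt ts).
exact: ole_nlt (ord_le_trans h (proj1 rho0)) p0.
Qed.

Lemma build_depths h l l' : map (@depth Q) l = map (@depth Q) l' ->
  map (@depth Q) (build h l) = map (@depth Q) (build h l').
Proof. by elim: l l' h => [|t l IH] [|t' l'] // h [E /IH E']; rewrite /= E E'. Qed.

(** Equal values need not give equal codes, but equal depths are enough for [build] to assign the
    same spine heights after a common initial part of two normal forms. *)
Lemma val_code_depth s t : nf s -> nf t -> ord_eq (val s) (val t) -> depth (code s) = depth (code t).
Proof.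
have leaf_node q l : nf (Leaf q) -> nf (Node l) -> ~ ord_eq (lab q) (val (Node l)).
  move=> nq nl E; have iq : isl q by inversion nq.
  case: (node_cases l) => [El|ln].
    subst l; case: (lab_range iq) => [h|[h _]].
      exact: (ole_nlt (proj2 E) h).
    exact: (ole_nlt (proj1 E) h).
  have [lnf ld lt lg] := nf_nodeE ln nl; rewrite valE // in E.
  case: (lab_range iq) => [h|[_ h]].
    exact: (ole_nlt (proj2 E) (olt_trans h lg)).
  apply: (ole_nlt (ord_le_trans h (proj1 E))).
  apply: csum_lt => a /In_vals[u ul ->].
  exact: olt_le_trans (lt u ul) (proj2 E).
elim/tree_In_ind: s t => [q|l IH] [p|m] ns nt E //.
- by case: (leaf_node q m).
- by case: (leaf_node p l) => //; exact: ord_eq_sym.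
case: (node_cases l) => [El|ln]; case: (node_cases m) => [Em|mn]; subst=> //.
- have [_ _ _ h] := nf_nodeE mn nt; rewrite [val (Node m)]valE // in E.
  by case: (ole_nlt (proj2 E) h).
- have [_ _ _ h] := nf_nodeE ln ns; rewrite [val (Node l)]valE // in E.
  by case: (ole_nlt (proj1 E) h).
have [lnf ld _ _] := nf_nodeE ln ns; have [mnf md _ _] := nf_nodeE mn nt.
rewrite !valE // in E; have {ld md}C := csum_ceq ld md E.
rewrite !codeE //= (@build_depths 0 (map code l) (map code m)) //.
elim: l m C IH lnf mnf {ln mn E ns nt} => [|t l IHl] [|t' m] //= [E C] IH lnf mnf.
congr (_ :: _); first by apply: IH => //; [left|apply: lnf; left|apply: mnf; left].
apply: IHl => //.
- by move=> s sl; apply: IH; right.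
- by move=> s sl; apply: lnf; right.
- by move=> s sl; apply: mnf; right.
Qed.

Lemma tle_pair t t' k k' : tle (Node [:: t; spine k]) (Node [:: t'; spine k']) ->
  (tle t t' \/ tle t (spine k')) /\ (k <= depth t' \/ k <= k').
Proof.
move=> H; split.
  by have [u [<-|[<-|//]]] := tle_nodeE H (or_introl erefl); auto.
have [u [<-|[<-|//]] /tle_depth] := tle_nodeE H (or_intror (or_introl erefl)).
  by rewrite depth_spine; left.
by rewrite !depth_spine; right.
Qed.

Lemma code_reflect s t : nf s -> nf t -> olt (val s) (val t) -> ~ tle (code t) (code s).
Proof.
elim/tree_In_ind: t s => [q|m IH] s ns nt st.
  have iq : isl q by inversion nt.
  by move=> /(leaf_code ns iq) h; exact: (ole_nlt h st).
case: s ns st => [p|l] ns st.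
  by case: (m) => [|u m'] H; inversion H.
case: (node_cases m) => [Em|mn].
  subst m; case: (node_cases l) => [El|ln]; first by subst l; case: (olt_irrefl st).
  by have [_ _ _ h] := nf_nodeE ln ns; rewrite valE // in st; case: (olt_irrefl (olt_trans h st)).
have [mnf md _ _] := nf_nodeE mn nt; rewrite [code (Node m)]codeE //.
case: (node_cases l) => [El|ln].
  subst l; case: m mn {IH nt mnf md st} => // t m _ /= H.
  have [u [<-|//] h] := tle_nodeE H (or_introl erefl); exact: tle_node_leaf h.
have [lnf ld _ _] := nf_nodeE ln ns; rewrite codeE //.
rewrite !valE // in st; have {}st := csum_clt ld md st.
suff [u um uw] : exists2 u, List.In u (build 0 (map code m)) &
    forall w, List.In w (build 0 (map code l)) -> ~ tle u w.
  by move=> H; have [w wl uw'] := tle_nodeE H um; exact: uw wl uw'.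
suff [t [k [_ um uw]]] : exists t k, [/\ 0 < k,
    List.In (Node [:: code t; spine k]) (build 0 (map code m)) &
    forall w, List.In w (build 0 (map code l)) -> ~ tle (Node [:: code t; spine k]) w].
  by exists (Node [:: code t; spine k]).
(* The starting height is generalized and [h < k] is carried along, so that the pair found later in
   [m] is still too tall for the pairs already passed. *)
move: 0 => h; elim: l m h st IH lnf mnf ld {ns nt ln mn md} => [|a l IHl] [|b m] h //= st IH lnf mnf ld.
  by exists b, (maxn h (depth (code b))).+1; split=> //; [rewrite ltnS leq_maxl|left].
have na := lnf a (or_introl erefl); have nb := mnf b (or_introl erefl).
case: st => [ab|[E st]].
  exists b, (maxn h (depth (code b))).+1; split=> //; [by rewrite ltnS leq_maxl|by left|].
  have low t : List.In t (a :: l) -> nf t /\ olt (val t) (val b).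
    move=> tl; split; first exact: lnf.
    apply: ole_lt_trans ab; case: tl => [->|tl]; first exact: ord_le_refl.
    by apply: (proj1 ld); exact: In_map_intro.
  (* A larger exponent settles the matter by itself: its code is below no code of a smaller
     exponent, by induction, and below no spine. *)
  have bad t k k' : nf t -> olt (val t) (val b) ->
      ~ tle (Node [:: code b; spine k]) (Node [:: code t; spine k']).
    move=> nt tb /tle_pair[[bt|bs] _]; last exact: code_spine bs.
    exact: (IH b (or_introl erefl) t nt nb tb).
  move=> w [<-|/In_build[u [k [/In_codes[t tl ->] ->]]]].
    by case: (low a (or_introl erefl)) => *; exact: bad.
  by case: (low t (or_intror tl)) => *; exact: bad.
have dE := val_code_depth na nb E.
have [||||t [k [hk tm tw]]] := IHl m (maxn h (depth (code b))).+1 st.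
- by move=> u um; apply: IH; right.
- by move=> u ul; apply: lnf; right.
- by move=> u um; apply: mnf; right.
- exact: (proj2 ld).
exists t, k; split; [|by right|].
  by apply: leq_trans hk; rewrite ltnS; apply: leq_trans (leq_maxl _ _) (leqnSn _).
rewrite dE => w [<-|]; last exact: tw.
(* The pair passed last has a code and a spine of depth at most its height, and [k] exceeds that
   height. *)
move=> /tle_pair[_]; rewrite dE => -[] kd; move: (leq_trans hk kd); rewrite ltnNge ?leqnn //.
by rewrite (leq_trans (leq_maxr h _) (leqnSn _)).
Qed.

Lemma code_wf t : nf t -> tree_wf (code t).
Proof.
elim/tree_In_ind: t => [q|l IH] nt; first by constructor.
case: (node_cases l) => [E|ln]; first by subst l; constructor=> // t [<-|//]; constructor.
have [lnf _ _ _] := nf_nodeE ln nt; rewrite codeE //; constructor; first by case: l ln {IH nt lnf}.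
move=> u /In_build[s [k [/In_codes[t tl ->] ->]]]; constructor=> // w [<-|[<-|//]].
  by apply: IH => //; exact: lnf.
exact: spine_wf.
Qed.

Variable d : Ord.
Hypothesis labels_low : forall a, olt a d -> olt a g -> exists2 q, isl q & ord_eq (lab q) a.
Hypothesis labels_eps : forall a, olt a d -> olt g a -> ord_le (oexp_omega a) a ->
  exists2 q, isl q & ord_eq (lab q) a.

Lemma nf_exists a : olt a d -> exists2 t, nf t & ord_eq (val t) a.
Proof.
elim/(well_founded_induction olt_wf): a => a IH ad.
case: (ole_or_lt g a) => [ga|ag]; last first.
  have [q iq E] := labels_low ad ag; exists (Leaf q) => //; exact: nf_leaf.
case: (ole_eq_or_lt ga) => [E|{}ga]; first by exists (Node [::]) => //; exact: nf_nil.
case: (ole_or_lt (oexp_omega a) a) => [fa|nfa].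
  have [q iq E] := labels_eps ad ga fa; exists (Leaf q) => //; exact: nf_leaf.
have [l [dl la al]] := cnf_exists a.
have {}la b : List.In b l -> olt b a.
  move=> bl; apply: nle_lt => ab; apply: (ole_nlt (oexp_mono ab)).
  apply: ole_lt_trans nfa; apply: ord_le_trans (proj2 al); exact: csum_ge_In.
have [ts [tsnf tsl]] : exists ts, (forall t, List.In t ts -> nf t) /\ ceq l (map val ts).
  elim: l la {dl al} => [|b l IHl] la; first by exists [::].
  have [ts [tsnf tsl]] : exists ts, (forall t, List.In t ts -> nf t) /\ ceq l (map val ts).
    by apply: IHl => c cl; apply: la; right.
  have [t nt tb] : exists2 t, nf t & ord_eq (val t) b.
    by apply: IH; [|apply: olt_trans ad]; apply: la; left.
  exists (t :: ts); split=> [u [<-|/tsnf]//|]; split=> //; exact: ord_eq_sym.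
have E : ord_eq (csum (map val ts)) a.
  by apply: ord_eq_sym; apply: ord_eq_trans al (ceq_csum tsl).
have tsn : ts <> nil.
  by move=> tsE; subst ts; have [[]] := ole_lt_trans (ole0 g) (olt_le_trans ga (proj2 E)).
exists (Node ts); last by rewrite valE.
apply: nf_node => //; [exact: ceq_cdesc tsl dl| |exact: olt_le_trans ga (proj2 E)].
move=> t tts; apply: olt_le_trans (proj2 E).
have [b bl tb] : exists2 b, List.In b l & ord_eq (val t) b.
  elim: l ts tsl tts {dl la al tsnf E tsn} => [|b l IHl] [|u ts] //= [E C] [<-|tts].
    by exists b; [left|exact: ord_eq_sym].
  by have [c cl tc] := IHl ts C tts; exists c; [right|].
exact: ole_lt_trans (proj1 tb) (la b bl).
Qed.

Lemma rge_codes : rge tle (@tin Q (fun _ => True)) d.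
Proof.
apply: (@rge_family _ _ _ (fun u a => exists t, [/\ nf t, u = code t & ord_eq (val t) a])).
  move=> a /nf_exists[t nt ta]; exists (code t); last by exists t.
  by apply: tin_wf; exact: code_wf.
move=> _ _ a b [s [ns -> sa]] [t [nt -> tb]] ab; apply: code_reflect => //.
exact: ole_lt_trans (proj1 sa) (olt_le_trans ab (proj2 tb)).
Qed.
End Terms.
End Lower.

(** Above the fixed point the labels denote epsilon numbers of successor index only; within finite
    distance of [g] there are no others. *)
Lemma between_add_nat g n e : olt g e -> ord_le e (oadd g (onat n)) ->
  exists2 x, ord_eq e (osucc x) & ord_le g x.
Proof.
move=> ge; elim: n => [|n IH] en.
  by case: (ole_nlt (ord_le_trans en (proj1 (oadd0 g))) ge).
have [h1 h2] := oadd_succ g (onat n).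
case: (ole_eq_or_lt en) => [E|lt].
  exists (oadd g (onat n)); last exact: oadd_le_l.
  by apply: ord_eq_trans E _; split.
by apply: IH; apply: olt_succ_le; exact: olt_le_trans lt h1.
Qed.

Lemma rge_trees_ebar (Q : Type) (le : Q -> Q -> Prop) (rho : Q -> Ord) b : quasi_order le ->
  (forall p q, le p q -> ord_le (rho p) (rho q)) ->
  (forall a, olt a (oadd (onat 2) b) -> exists q, ord_eq (rho q) a) ->
  rge (tree_le le) (@tin Q (fun _ => True)) (ebar b).
Proof.
move=> qo rho_mono rho_surj.
have two n : n < 2 -> olt (onat n) (oadd (onat 2) b).
  move=> n2; apply: olt_le_trans (oadd_le_l _ _).
  by apply: (@olt_le_trans _ (onat n.+1)); [exact: olt_succ | exact: onat_mono].
have [q0 rho0] := rho_surj _ (two 0 erefl); have [q1 rho1] := rho_surj _ (two 1 erefl).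
pose isl q := olt (onat 1) (rho q).
have [xi Hxi] : exists xi : Q -> Ord, forall q, isl q -> ord_eq (rho q) (oadd (onat 2) (xi q)).
  apply: (@choice_fun _ _ (fun q x => isl q -> ord_eq (rho q) (oadd (onat 2) x))) => q.
  case: (classic (isl q)) => [iq|niq]; last by exists ozero.
  by have [x hx] := osub (olt_le_succ iq); exists x.
have xi_mono p q : isl p -> isl q -> ord_le (rho p) (rho q) -> ord_le (xi p) (xi q).
  move=> ip iq pq; apply: (@ole_add_cancel (onat 2)).
  apply: ord_le_trans (proj2 (Hxi _ ip)) _; apply: ord_le_trans pq _.
  by case: (Hxi _ iq).
have xi_surj a : olt a b -> exists2 q, isl q & ord_eq (xi q) a.
  move=> ab; have [q qa] := rho_surj _ (oadd_lt_r (onat 2) ab).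
  have iq : isl q.
    apply: olt_le_trans (proj2 qa); apply: olt_le_trans (oadd_le_l _ _); exact: olt_succ.
  exists q => //; have [h1 h2] := Hxi q iq; have [h3 h4] := qa.
  by split; apply: (@ole_add_cancel (onat 2)); eapply ord_le_trans; eassumption.
rewrite /ebar; case: (excluded_middle_informative (eps_overshoot b)) => [[g [n [bE gfix]]]|nb]; last first.
  apply: (@rge_codes Q le qo q0 q1 rho (fun q => oeps (xi q)) isl ozero) => //.
  - by move=> p q ip iq pq; apply: oeps_mono; apply: xi_mono => //; exact: rho_mono.
  - by move=> q iq; right; split; [exact: oeps_pos | exact: oeps_fix].
  - by move=> a _ [[]].
  - move=> a ab _ fa; have [x xb ax] := eps_enum fa ab.
    have [q iq [h1 h2]] := xi_surj x xb; exists q => //.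
    by apply: ord_eq_trans (ord_eq_sym ax); split; exact: oeps_mono.
(* Below the fixed point [g] every ordinal is a label; [g] itself has no label and is
   denoted by [Node [::]]; above it the labels are the epsilon numbers. *)
pose Lam x := if excluded_middle_informative (olt x g) then x else oeps (osucc x).
have Lam_low x : olt x g -> Lam x = x.
  by rewrite /Lam; case: (excluded_middle_informative (olt x g)).
have Lam_high x : ord_le g x -> Lam x = oeps (osucc x).
  by rewrite /Lam => gx; case: (excluded_middle_informative (olt x g)) => // xg; case: (ole_nlt gx xg).
have high x : ord_le g x -> olt g (oeps (osucc x)).
  move=> gx; apply: ole_lt_trans (proj2 gfix) _; apply: oeps_lt.
  exact: ole_lt_trans gx (olt_succ x).
have Lam_mono x y : ord_le x y -> ord_le (Lam x) (Lam y).
  move=> xy; case: (ole_or_lt g x) => gx; case: (ole_or_lt g y) => gy.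
  - by rewrite !Lam_high //; apply: oeps_mono; exact: osucc_mono.
  - by case: (ole_nlt gx (ole_lt_trans xy gy)).
  - by rewrite Lam_low // Lam_high //; apply: olt_le; apply: olt_trans gx (high _ gy).
  - by rewrite !Lam_low.
have gb : ord_le g b by apply: ord_le_trans (proj2 bE); exact: oadd_le_l.
apply: (@rge_codes Q le qo q0 q1 rho (fun q => Lam (xi q)) isl g) => //.
- by move=> p q ip iq pq; apply: Lam_mono; apply: xi_mono => //; exact: rho_mono.
- move=> q iq; case: (ole_or_lt g (xi q)) => gx; last by left; rewrite Lam_low.
  by right; rewrite Lam_high //; split; [exact: high | exact: oeps_fix].
- move=> a _ ag; have [q iq [h1 h2]] := xi_surj a (olt_le_trans ag gb); exists q => //.
  have E := Lam_low a ag; have m1 := Lam_mono _ _ h1; have m2 := Lam_mono _ _ h2.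
  by rewrite E in m1 m2.
- move=> a ab ga fa; have [x /olt_succ_le xb ax] := eps_enum fa ab.
  have gx : olt g x.
    apply: nle_lt => xg; apply: (ole_nlt _ ga).
    apply: ord_le_trans (proj1 ax) _; apply: ord_le_trans (oeps_mono xg) _; by case: gfix.
  have [y xy gy] := between_add_nat gx (ord_le_trans xb (proj1 bE)).
  have yb : olt y b by apply: olt_le_trans xb; apply: olt_le_trans (proj2 xy); exact: olt_succ.
  have [q iq [h1 h2]] := xi_surj y yb; exists q => //.
  have E := Lam_high y gy; have m1 := Lam_mono _ _ h1; have m2 := Lam_mono _ _ h2.
  rewrite E in m1 m2; have [x1 x2] := xy; have [a1 a2] := ax.
  split; first by apply: ord_le_trans m1 _; apply: ord_le_trans a2; exact: oeps_mono.
  by apply: ord_le_trans m2; apply: ord_le_trans a1 _; exact: oeps_mono.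
Qed.

(** * Positions *)

Lemma cnf_lt_irr i : cnf_lt i i = false.
Proof. by elim: i => //= a i ->; rewrite ltnn andbF. Qed.

Lemma cnf_lt_trans j i k : cnf_lt i j -> cnf_lt j k -> cnf_lt i k.
Proof.
elim: i j k => [|a i IH] [|b j] [|c k] //=.
case/orP => [ab|/andP[/eqP -> ij]]; case/orP => [bc|/andP[/eqP <- jk]].
- by rewrite (ltn_trans ab bc).
- by rewrite ab.
- by rewrite bc.
- by rewrite eqxx (IH j k ij jk) orbT.
Qed.

Lemma cnf_lt0 i : cnf_lt i [::] = false.
Proof. by case: i. Qed.

Lemma cnf_lt_cat d i j : cnf_lt (d ++ i) (d ++ j) = cnf_lt i j.
Proof. by elim: d => //= a d ->; rewrite ltnn eqxx. Qed.

Lemma geq_trans : transitive geq.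
Proof. by move=> a b c ab ca; exact: leq_trans ca ab. Qed.

Arguments cnf_ok : simpl never.

Lemma cnf_okE s : cnf_ok s = pairwise geq s.
Proof. exact: sorted_pairwise geq_trans _. Qed.

Lemma cnf_ok_cons a s : cnf_ok (a :: s) = all (geq a) s && cnf_ok s.
Proof. by rewrite !cnf_okE. Qed.

Lemma cnf_ok_cat s t : cnf_ok (s ++ t) = [&& allrel geq s t, cnf_ok s & cnf_ok t].
Proof. by rewrite !cnf_okE pairwise_cat. Qed.

Lemma posE e i : pos [:: e] i = cnf_ok i && all (fun a => a < e) i.
Proof.
rewrite /pos; case ok: (cnf_ok i) => //=; case: i ok => [|a i] //.
rewrite cnf_ok_cons => /andP[/allP ai _] /=; rewrite cnf_lt0 andbF orbF.
case: (ltnP a e) => //= ae; symmetry; apply/allP => b /ai ba; exact: leq_ltn_trans ba ae.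
Qed.

Lemma pos_nil e : pos [:: e] [::].
Proof. by []. Qed.

Lemma pos0 i : pos [:: 0] i -> i = [::].
Proof. by rewrite posE; case: i => // a i /andP[_]. Qed.

Lemma pos_widen d e i : d <= e -> pos [:: d] i -> pos [:: e] i.
Proof.
move=> de; rewrite !posE => /andP[-> /allP h] /=; apply/allP => a /h ad.
exact: leq_trans ad de.
Qed.

(** For a position [omega^e * n + r] with [r < omega^e], the numbers [n] and [r]. *)
Definition copies (e : nat) (i : seq nat) : nat := find (fun a => a != e) i.
Definition remainder (e : nat) (i : seq nat) : seq nat := drop (copies e i) i.

Lemma copies_cat e n r : pos [:: e] r -> copies e (nseq n e ++ r) = n.
Proof.
rewrite posE => /andP[_ h]; elim: n => [|n IH]; last by rewrite /copies /= eqxx -/(copies _ _) IH.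
by case: r h => //= a r /andP[ae _]; rewrite /copies /= (ltn_eqF ae).
Qed.

Lemma remainder_cat e n r : pos [:: e] r -> remainder e (nseq n e ++ r) = r.
Proof. by move=> pr; rewrite /remainder copies_cat // drop_size_cat ?size_nseq. Qed.

Lemma pos_join e n r : pos [:: e] r -> pos [:: e.+1] (nseq n e ++ r).
Proof.
rewrite !posE => /andP[ok /allP h]; rewrite all_cat; apply/and3P; split.
- elim: n => //= n IH; rewrite cnf_ok_cons IH andbT all_cat; apply/andP; split.
    by apply/allP => a /nseqP[-> _] /=.
  by apply/allP => a /h /ltnW.
- by apply/allP => a /nseqP[-> _].
- by apply/allP => a /h /ltnW; rewrite ltnS.
Qed.

Lemma pos_split e i : pos [:: e.+1] i -> exists n r, i = nseq n e ++ r /\ pos [:: e] r.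
Proof.
elim: i => [|a i IH]; first by exists 0, [::].
rewrite posE cnf_ok_cons => /andP[/andP[ai ok] /= /andP[ae h]].
rewrite ltnS leq_eqVlt in ae; case/orP: ae => [/eqP E|ae].
  have [|n [r [-> pr]]] := IH; first by rewrite posE ok.
  by exists n.+1, r; rewrite E.
exists 0, (a :: i); split=> //; rewrite posE cnf_ok_cons ai ok /= ae /=.
by apply/allP => b /(allP ai) ba; exact: leq_ltn_trans ba ae.
Qed.

Lemma cnf_lt_join e n m r r' : pos [:: e] r -> pos [:: e] r' ->
  cnf_lt (nseq n e ++ r) (nseq m e ++ r') = (n < m) || (n == m) && cnf_lt r r'.
Proof.
rewrite !posE => /andP[_ hr] /andP[_ hr']; elim: n m => [|n IH] [|m] //=.
- by case: r hr => //= a r /andP[-> _].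
- clear IH; case: r' hr' => //= b r' /andP[be _].
  by rewrite ltnNge (ltnW be) /= (gtn_eqF be).
- by rewrite ltnn eqxx IH.
Qed.

(** * Labelled sequences *)

(** Positions form an arbitrary set of lists under [cnf_lt], which makes paths in trees usable as
    positions without normalization. On all lists [cnf_lt] is not well-founded, but only embeddings
    matter. *)
Record lseq (Q : Type) := LSeq { ldom : seq nat -> Prop; lval : seq nat -> Q }.

Definition emb (Q : Type) (le : Q -> Q -> Prop) (A B : lseq Q) : Prop :=
  exists f : seq nat -> seq nat,
    (forall i, ldom A i -> ldom B (f i) /\ le (lval A i) (lval B (f i))) /\
    (forall i j, ldom A i -> ldom A j -> cnf_lt i j -> cnf_lt (f i) (f j)).

Definition above (Q : Type) (A : lseq Q) (p : seq nat) : lseq Q :=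
  LSeq (fun i => ldom A i /\ (p = i \/ cnf_lt p i)) (lval A).

Lemma nat_max (P : nat -> Prop) N n : P n -> (forall m, P m -> m <= N) ->
  exists2 m, P m & forall k, P k -> k <= m.
Proof.
elim: N n => [|N IH] n Pn bound.
  by exists n => // k /bound; rewrite leqn0 => /eqP ->.
case: (classic (P N.+1)) => [PN|nP]; first by exists N.+1.
apply: (IH n) => // m Pm; have := bound m Pm; rewrite leq_eqVlt => /orP[/eqP E|//].
by rewrite E in Pm.
Qed.

Section Sequences.
Variables (Q : Type) (le : Q -> Q -> Prop).
Hypothesis le_qo : quasi_order le.
Variable q0 : Q.
Local Notation emb := (emb le).
Local Notation tle := (tree_le le).
Local Notation nthT := (nth (Leaf q0)).
Implicit Types (s t : tree Q) (ts ss : seq (tree Q)).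

Let le_refl x : le x x.
Proof. by case: le_qo. Qed.

Let le_trans x y z : le x y -> le y z -> le x z.
Proof. by case: le_qo => _; apply. Qed.

Lemma emb_trans A B C : emb A B -> emb B C -> emb A C.
Proof.
move=> [f [f1 f2]] [g [g1 g2]]; exists (g \o f); split=> [i Ai|i j Ai Aj ij] /=.
  have [Bf lf] := f1 i Ai; have [Cg lg] := g1 _ Bf.
  by split=> //; exact: le_trans lf lg.
by apply: g2; [case: (f1 i Ai)|case: (f1 j Aj)|exact: f2].
Qed.

Lemma emb_sub A B : (forall i, ldom A i -> ldom B i /\ lval A i = lval B i) -> emb A B.
Proof. by move=> H; exists id; split=> // i /H[Bi ->]. Qed.

Lemma emb_above A p : emb (above A p) A.
Proof. by apply: emb_sub => i []. Qed.

Definition lsum (I : nat -> Prop) (A : nat -> lseq Q) : lseq Q :=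
  LSeq (fun i => match i with [::] => False | n :: p => I n /\ ldom (A n) p end)
       (fun i => match i with [::] => q0 | n :: p => lval (A n) p end).

Lemma lsum_emb (I I' : nat -> Prop) A A' f : (forall n, I n -> I' (f n)) ->
  (forall n m, I n -> I m -> n < m -> f n < f m) ->
  (forall n, I n -> emb (A n) (A' (f n))) -> emb (lsum I A) (lsum I' A').
Proof.
move=> fI fmono H.
have [g Hg] := @choice_fun nat (seq nat -> seq nat) (fun n g => I n ->
  (forall i, ldom (A n) i -> ldom (A' (f n)) (g i) /\ le (lval (A n) i) (lval (A' (f n)) (g i))) /\
  (forall i j, ldom (A n) i -> ldom (A n) j -> cnf_lt i j -> cnf_lt (g i) (g j)))
  (fun n => match classic (I n) with
    | or_introl In => let: ex_intro g hg := H n In in ex_intro _ g (fun _ => hg)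
    | or_intror nIn => ex_intro _ id (fun In => False_ind _ (nIn In)) end).
exists (fun i => match i with [::] => [::] | n :: p => f n :: g n p end).
split=> [[//|n p] [In Ap]|[//|n p] [//|m p'] [In Ap] [Im Ap']] /=.
  by have [h _] := Hg n In; have [h1 h2] := h p Ap; split=> //; split=> //; exact: fI.
case/orP => [nm|/andP[/eqP E pp]]; first by rewrite fmono.
by subst m; rewrite eqxx; have [_ h] := Hg n In; rewrite h ?orbT.
Qed.

(** * The sequence of a tree *)

(** The children of [Node ts] are concatenated and repeated [omega] times: [n :: p'] is position
    [p'] of the [n]-th block, a copy of child [n] modulo their number. *)
Fixpoint sdom (t : tree Q) : seq nat -> Prop :=
  match t with
  | Leaf _ => fun p => p = [::]
  | Node ts => fun p => match p with
      | [::] => False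
      | n :: p' => nth (fun _ => False) (map sdom ts) (n %% size ts) p'
      end
  end.

Fixpoint slab (t : tree Q) : seq nat -> Q :=
  match t with
  | Leaf q => fun _ => q
  | Node ts => fun p => match p with
      | [::] => q0
      | n :: p' => nth (fun _ => q0) (map slab ts) (n %% size ts) p'
      end
  end.

Definition seqT (t : tree Q) : lseq Q := LSeq (sdom t) (slab t).
Definition nthchild (ts : seq (tree Q)) (n : nat) : tree Q := nthT ts (n %% size ts).

Lemma size_gt0 (ts : seq (tree Q)) : ts <> nil -> 0 < size ts.
Proof. by case: ts. Qed.

Lemma In_nth (ts : seq (tree Q)) n : n < size ts -> List.In (nthT ts n) ts.
Proof.
elim: ts n => //= t ts IH [|n] h; first by left.
by right; exact: IH.
Qed.

Lemma In_index (ts : seq (tree Q)) t : List.In t ts -> exists2 n, n < size ts & nthT ts n = t.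
Proof.
elim: ts => //= s ts IH [<-|/IH[n h <-]]; first by exists 0.
by exists n.+1.
Qed.

Lemma nthchild_In ts n : ts <> nil -> List.In (nthchild ts n) ts.
Proof. by move=> /size_gt0 h; apply: In_nth; rewrite ltn_mod. Qed.

Lemma nthchild_addmul ts m n : n < size ts -> nthchild ts (m * size ts + n) = nthT ts n.
Proof. by move=> h; rewrite /nthchild modnMDl modn_small. Qed.

Lemma sdom_node ts n p : ts <> nil -> sdom (Node ts) (n :: p) = sdom (nthchild ts n) p.
Proof. by move=> /size_gt0 h; rewrite /= (nth_map (Leaf q0)) // ltn_mod. Qed.

Lemma slab_node ts n p : ts <> nil -> slab (Node ts) (n :: p) = slab (nthchild ts n) p.
Proof. by move=> /size_gt0 h; rewrite /= (nth_map (Leaf q0)) // ltn_mod. Qed.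

Lemma wf_nodeE ts : tree_wf (Node ts) -> ts <> nil /\ forall t, List.In t ts -> tree_wf t.
Proof. by move=> H; inversion H. Qed.

Lemma wf_nthchild ts n : tree_wf (Node ts) -> tree_wf (nthchild ts n).
Proof. by move=> /wf_nodeE[tsn h]; apply: h; exact: nthchild_In. Qed.

Lemma seqT_node ts : ts <> nil ->
  emb (seqT (Node ts)) (lsum (fun _ => True) (fun n => seqT (nthchild ts n))) /\
  emb (lsum (fun _ => True) (fun n => seqT (nthchild ts n))) (seqT (Node ts)).
Proof.
move=> tsn; split; apply: emb_sub => -[|n p] //.
  by rewrite [ldom _ _]sdom_node // => h; rewrite [lval _ _]slab_node.
by move=> [_ h]; rewrite [ldom (seqT _) _]sdom_node // [lval (seqT _) _]slab_node.
Qed.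

Lemma sdom_inhabited t : tree_wf t -> exists p, sdom t p.
Proof.
elim/tree_In_ind: t => [q|ts IH] wt; first by exists [::].
have [tsn tswf] := wf_nodeE wt; have c0 := nthchild_In 0 tsn.
have [p hp] := IH _ c0 (tswf _ c0); exists (0 :: p); by rewrite sdom_node.
Qed.

(** Indecomposability of tree sequences: moving forward by whole periods, beyond the block of [p0],
    preserves the labels. *)
Lemma seqT_above t p0 : tree_wf t -> sdom t p0 -> emb (seqT t) (above (seqT t) p0).
Proof.
case: t => [q|ts] wt hp0.
  by apply: emb_sub => i /= Ei; split=> //; split=> //; left; rewrite Ei hp0.
have [tsn tswf] := wf_nodeE wt; case: p0 hp0 => // n p' _.
exists (fun i => match i with [::] => [::] | m :: p => m + n.+1 * size ts :: p end).
have shift m : nthchild ts (m + n.+1 * size ts) = nthchild ts m.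
  by rewrite /nthchild addnC modnMDl.
split=> [[//|m p]|[//|m p] [//|m' p'']] h.
  rewrite [ldom _ _]sdom_node // in h; split; last first.
    by rewrite [lval _ _]slab_node // [lval (above _ _) _]slab_node // shift.
  split; first by rewrite [ldom _ _]sdom_node // shift.
  right=> /=; apply/orP; left; apply: leq_trans (leq_addl _ _).
  by rewrite -{1}[n.+1]muln1 leq_mul // size_gt0.
by move=> _ /=; rewrite ltn_add2r eqn_add2r.
Qed.

Lemma tle_emb s t : tree_wf s -> tree_wf t -> tle s t -> emb (seqT s) (seqT t).
Proof.
elim/tree_In_ind: s t => [x|ss IHs]; elim/tree_In_ind=> [y|ts IHt] ws wt st.
- by exists id; split=> // i /= ->; split=> //; exact: tle_leafE st.
- have [tsn tswf] := wf_nodeE wt; have [t' t'ts xt] := tle_leaf_nodeE st.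
  have [f [f1 f2]] := IHt t' t'ts ws (tswf _ t'ts) xt.
  have [n nts nE] := In_index t'ts.
  exists (fun i => n :: f i); split=> [i Ei|i j -> -> //].
  have [h1 h2] := f1 i Ei; have cE : nthchild ts n = t' by rewrite /nthchild modn_small.
  by rewrite [ldom _ _]sdom_node // [lval (seqT (Node ts)) _]slab_node // cE.
- by case: (tle_node_leaf st).
have [ssn sswf] := wf_nodeE ws; have [tsn tswf] := wf_nodeE wt.
have ks := size_gt0 tsn.
apply: emb_trans (proj1 (seqT_node ssn)) _; apply: emb_trans (proj2 (seqT_node tsn)).
have [j Hj] : exists j : nat -> nat, forall n, j n < size ts /\
    tle (nthchild ss n) (nthT ts (j n)).
  apply: (@choice_fun _ _ (fun n j => j < size ts /\ tle (nthchild ss n) (nthT ts j))) => n.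
  have [t' t'ts h] := tle_nodeE st (nthchild_In n ssn).
  by have [m mts mE] := In_index t'ts; exists m; rewrite mE.
(* Block [n] goes into the [n]-th period of [ts], at a child above it. *)
apply: (@lsum_emb _ _ _ _ (fun n => n * size ts + j n)) => // [n m _ _ nm|n _].
  apply: (@leq_trans (n.+1 * size ts)).
    by rewrite mulSn addnC ltn_add2r; case: (Hj n).
  by apply: leq_trans (leq_addr _ _); rewrite leq_mul2r nm orbT.
have [jn h] := Hj n; rewrite nthchild_addmul //; apply: IHs => //; first exact: nthchild_In.
  exact: wf_nthchild.
by apply: tswf; exact: In_nth.
Qed.

Lemma emb_tle s t : tree_wf s -> tree_wf t -> emb (seqT s) (seqT t) -> tle s t.
Proof.
elim/tree_In_ind: s t => [x|ss IHs] t ws wt [f [f1 f2]].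
  have [] := f1 [::] erefl; move: (f [::]) => p {f f1 f2}.
  elim/tree_In_ind: t wt p => [y|ts IH] wt p; first by move=> _ h; constructor.
  have [tsn tswf] := wf_nodeE wt; case: p => // n p.
  rewrite [ldom _ _]sdom_node // [lval (seqT (Node ts)) _]slab_node // => h1 h2.
  have nts := nthchild_In n tsn.
  by apply: (tle_leaf_node nts); apply: IH h2 => //; exact: tswf.
have [ssn sswf] := wf_nodeE ws.
case: t wt f1 f2 => [y|ts] wt f1 f2.
  have [p hp] := sdom_inhabited (wf_nthchild 0 ws).
  have [p' hp'] := sdom_inhabited (wf_nthchild 1 ws).
  have d0 : ldom (seqT (Node ss)) (0 :: p) by rewrite [ldom _ _]sdom_node.
  have d1 : ldom (seqT (Node ss)) (1 :: p') by rewrite [ldom _ _]sdom_node.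
  have := f2 _ _ d0 d1 erefl.
  by case: (f1 _ d0) => -> _; case: (f1 _ d1) => -> _.
have [tsn tswf] := wf_nodeE wt.
constructor=> s sss; have [j jss jE] := In_index sss.
have ws' := sswf s sss.
have cj : nthchild ss j = s by rewrite /nthchild modn_small.
have dj p : sdom s p -> ldom (seqT (Node ss)) (j :: p) by rewrite [ldom _ _]sdom_node // cj.
have [p1 hp1] := sdom_inhabited (wf_nthchild j.+1 ws).
have d1 : ldom (seqT (Node ss)) (j.+1 :: p1) by rewrite [ldom _ _]sdom_node.
pose block p := head 0 (f (j :: p)).
have [p2 hp2] := sdom_inhabited ws'.
(* The images of block [j] all precede that of a point in block [j + 1], so they meet finitely many
   blocks. From [p0] on they stay in the last one, [b], and [s] embeds into its own tail from
   [p0]. *)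
have [b [p0 [hp0 bE]] bmax] : exists2 b, (exists p, sdom s p /\ b = block p) &
    forall b', (exists p, sdom s p /\ b' = block p) -> b' <= b.
  apply: (@nat_max (fun b => exists p, sdom s p /\ b = block p) (head 0 (f (j.+1 :: p1))) (block p2)).
    by exists p2.
  move=> m [p [hp ->]]; rewrite /block.
  have := f2 _ _ (dj p hp) d1; rewrite /= ltnSn => /(_ erefl).
  case: (f1 _ (dj p hp)) => + _; case: (f1 _ d1) => + _.
  case: (f (j :: p)) => // n r _; case: (f _) => // n' r' _ /= /orP[/ltnW//|/andP[/eqP ->//]].
have tB := nthchild_In b tsn; exists (nthchild ts b); split=> //.
apply: (IHs s sss) => //; first exact: tswf.
apply: emb_trans (seqT_above ws' hp0) _.
have key p : sdom s p -> p0 = p \/ cnf_lt p0 p -> f (j :: p) = b :: behead (f (j :: p)).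
  move=> hp pp; have : block p = b.
    apply/eqP; rewrite eqn_leq bmax /=; last by exists p.
    rewrite bE; case: pp => [->//|lt].
    have := f2 _ _ (dj _ hp0) (dj _ hp); rewrite /= ltnn eqxx => /(_ lt); rewrite /block.
    case: (f1 _ (dj _ hp0)) => + _; case: (f1 _ (dj _ hp)) => + _.
    by case: (f (j :: p)) => // n r _; case: (f _) => // n' r' _ /= /orP[/ltnW//|/andP[/eqP ->//]].
  by rewrite /block; case: (f1 _ (dj _ hp)) => + _; case: (f _) => //= n r _ ->.
exists (fun p => behead (f (j :: p))); split=> [p [hp pp]|p p' [hp pp] [hp' pp'] lt].
  have := f1 _ (dj _ hp); rewrite {1 2}(key p hp pp) [ldom _ _]sdom_node //.
  by rewrite [lval (seqT (Node ss)) _]slab_node // cj [lval (seqT (Node ts)) _]slab_node.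
have := f2 _ _ (dj _ hp) (dj _ hp'); rewrite /= ltnn eqxx => /(_ lt).
by rewrite {1}(key p hp pp) {1}(key p' hp' pp') /= ltnn eqxx.
Qed.

(** * Trees realized by sequences of length a power of omega *)

Definition maxdepth ts : nat := foldr maxn 0 (map (@depth Q) ts).

Lemma depth_node ts : depth (Node ts) = (maxdepth ts).+1.
Proof. by []. Qed.

Lemma depth_le_max ts t : List.In t ts -> depth t <= maxdepth ts.
Proof. by move=> /depth_child; rewrite depth_node. Qed.

Definition deepest ts : nat := find (fun t => depth t == maxdepth ts) ts.

Lemma deepestP ts : ts <> nil -> deepest ts < size ts /\ depth (nthT ts (deepest ts)) = maxdepth ts.
Proof.
move=> tsn; have [t tts tE] := depth_attained tsn.
have [n nts nE] := In_index tts.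
have h : has (fun t => depth t == maxdepth ts) ts.
  by apply/(has_nthP (Leaf q0)); exists n => //; rewrite nE -eqSS -tE depth_node.
by split; [rewrite -has_find | apply/eqP; exact: (nth_find (Leaf q0) h)].
Qed.

(* The sequence [tv (Node ts)] is cut into blocks of length [omega ^ maxdepth ts]. The
   [n]-th block starts with a copy of the [n]-th child (cyclically), and is padded with a
   tail of a child of maximal depth. *)
Fixpoint tv (t : tree Q) : seq nat -> Q :=
  match t with
  | Leaf q => fun _ => q
  | Node ts => fun i =>
      let e := foldr maxn 0 (map (@depth Q) ts) in
      let c := copies e i %% size ts in
      let r := remainder e i in
      if cnf_lt r [:: nth 0 (map (@depth Q) ts) c] then nth (fun _ => q0) (map tv ts) c r
      else nth (fun _ => q0) (map tv ts) (find (fun t => depth t == e) ts) r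
  end.

Lemma tv_node ts n r : ts <> nil -> pos [:: maxdepth ts] r ->
  tv (Node ts) (nseq n (maxdepth ts) ++ r) =
  if cnf_lt r [:: depth (nthchild ts n)] then tv (nthchild ts n) r
  else tv (nthT ts (deepest ts)) r.
Proof.
move=> tsn pr; have ks := size_gt0 tsn; have [dk _] := deepestP tsn.
rewrite /= -/(maxdepth ts) -/(deepest ts) copies_cat // remainder_cat //.
by rewrite !(nth_map (Leaf q0)) // ?ltn_mod.
Qed.

Definition seqR t : lseq Q := LSeq (pos [:: depth t]) (tv t).

Lemma seqR_seqT t : tree_wf t -> emb (seqR t) (seqT t).
Proof.
elim/tree_In_ind: t => [q|ts IH] wt.
  by exists id; split=> // i /pos0.
have [tsn tswf] := wf_nodeE wt; have ks := size_gt0 tsn; have [dk dE] := deepestP tsn.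
have [G HG] : exists G : tree Q -> seq nat -> seq nat, forall t, List.In t ts ->
    (forall i, pos [:: depth t] i -> sdom t (G t i) /\ le (tv t i) (slab t (G t i))) /\
    (forall i j, pos [:: depth t] i -> pos [:: depth t] j -> cnf_lt i j -> cnf_lt (G t i) (G t j)).
  apply: (@choice_fun _ _ (fun t g => List.In t ts ->
    (forall i, pos [:: depth t] i -> sdom t (g i) /\ le (tv t i) (slab t (g i))) /\
    (forall i j, pos [:: depth t] i -> pos [:: depth t] j -> cnf_lt i j -> cnf_lt (g i) (g j)))).
  move=> t; case: (classic (List.In t ts)) => [tts|nt]; last by exists id.
  by have [g hg] := IH t tts (tswf t tts); exists g.
pose e := maxdepth ts; pose k := size ts.
(* Each block of length [omega^e] gets two periods of [ts]: the child is sent into the first, the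
   padding into the deepest child of the second. *)
pose F i := let n := copies e i in let r := remainder e i in
  if cnf_lt r [:: depth (nthchild ts n)] then (2 * n * k + n %% k) :: G (nthchild ts n) r
  else ((2 * n).+1 * k + deepest ts) :: G (nthT ts (deepest ts)) r.
have FE n r : pos [:: e] r -> F (nseq n e ++ r) =
    if cnf_lt r [:: depth (nthchild ts n)] then (2 * n * k + n %% k) :: G (nthchild ts n) r
    else ((2 * n).+1 * k + deepest ts) :: G (nthT ts (deepest ts)) r.
  by move=> pr; rewrite /F copies_cat // remainder_cat.
have dIn : List.In (nthT ts (deepest ts)) ts by exact: In_nth.
have ltpos n r : pos [:: e] r -> cnf_lt r [:: depth (nthchild ts n)] ->
    pos [:: depth (nthchild ts n)] r.
  by rewrite /pos => /andP[-> _].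
exists F; split=> [i /pos_split[n [r [-> pr]]]|i j].
  rewrite FE // [lval (seqR _) _]tv_node //; case: ifP => lt.
    have [[h1 h2] _] : _ /\ True := conj (proj1 (HG _ (nthchild_In n tsn)) r (ltpos n r pr lt)) I.
    have cE : nthchild ts (2 * n * k + n %% k) = nthchild ts n.
      by rewrite nthchild_addmul // ltn_mod.
    by split; rewrite ?[ldom _ _]sdom_node ?[lval (seqT _) _]slab_node // cE.
  have pr' : pos [:: depth (nthT ts (deepest ts))] r by rewrite dE.
  have [h1 h2] := proj1 (HG _ dIn) r pr'.
  by split; rewrite ?[ldom _ _]sdom_node ?[lval (seqT _) _]slab_node // nthchild_addmul.
move=> /pos_split[n [r [-> pr]]] /pos_split[m [r' [-> pr']]].
rewrite -/e in pr pr' *; rewrite cnf_lt_join // !FE //.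
have small a b : a < k -> 2 * b * k + a < (2 * b).+1 * k by move=> ak; rewrite mulSn addnC ltn_add2r.
have small' a b : a < k -> (2 * b).+1 * k + a < 2 * b.+1 * k.
  by move=> ak; rewrite mulnS add2n [X in _ < X]mulSn addnC ltn_add2r.
have nk : n %% k < k by rewrite ltn_mod.
have mk : m %% k < k by rewrite ltn_mod.
case/orP => [nm|/andP[/eqP E rr]].
  have big a : a < k -> (2 * n).+1 * k + a < 2 * m * k.
    by move=> ak; apply: leq_trans (small' a n ak) _; rewrite leq_mul2r leq_mul2l nm !orbT.
  have small2 a : a < k -> 2 * n * k + a < 2 * m * k.
    move=> ak; apply: ltn_trans (small a n ak) _; apply: leq_ltn_trans (big 0 ks).
    by rewrite leq_addr.
  have up a : 2 * m * k <= 2 * m * k + a by exact: leq_addr.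
  have up' a : 2 * m * k <= (2 * m).+1 * k + a.
    by apply: leq_trans (leq_addr _ _); rewrite leq_mul2r leqnSn orbT.
  case: ifP => _; case: ifP => _ /=; apply/orP; left.
  - exact: leq_trans (small2 _ nk) (up _).
  - exact: leq_trans (small2 _ nk) (up' _).
  - exact: leq_trans (big _ dk) (up _).
  - exact: leq_trans (big _ dk) (up' _).
subst m; case: ifP => lr; case: ifP => lr' /=.
- rewrite ltnn eqxx /=; apply: (proj2 (HG _ (nthchild_In n tsn))) => //; exact: ltpos.
- by rewrite (leq_trans (small _ n nk) (leq_addr _ _)).
- by rewrite (cnf_lt_trans rr lr') in lr.
- by rewrite ltnn eqxx /=; apply: (proj2 (HG _ dIn)); rewrite ?dE.
Qed.

Lemma seqT_seqR t : tree_wf t -> emb (seqT t) (seqR t).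
Proof.
elim/tree_In_ind: t => [q|ts IH] wt.
  by exists id; split=> [i ->|i j -> ->].
have [tsn tswf] := wf_nodeE wt; apply: emb_trans (proj1 (seqT_node tsn)) _.
apply: (@emb_trans _ (lsum (fun _ => True) (fun n => seqR (nthchild ts n)))).
  apply: (@lsum_emb _ _ _ _ id) => // n _; apply: IH; first exact: nthchild_In.
  exact: wf_nthchild.
have wide n r : pos [:: depth (nthchild ts n)] r -> pos [:: maxdepth ts] r.
  by apply: pos_widen; apply: depth_le_max; exact: nthchild_In.
exists (fun i => match i with [::] => [::] | n :: r => nseq n (maxdepth ts) ++ r end).
split=> [[//|n r] [_ pr]|[//|n r] [//|m r'] [_ pr] [_ pr']]; last first.
  by rewrite cnf_lt_join; [| exact: wide pr | exact: wide pr'].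
split; first by apply: pos_join; exact: wide pr.
rewrite [lval (seqR _) _]tv_node //; last exact: wide pr.
by case/andP: (pr) => _ ->.
Qed.

Lemma tv_finite_range t : tree_wf t -> exists r : seq Q, forall i, pos [:: depth t] i -> List.In (tv t i) r.
Proof.
elim/tree_In_ind: t => [q|ts IH] wt; first by exists [:: q] => i _; left.
have [tsn tswf] := wf_nodeE wt.
have [r hr] : exists r : seq Q, forall t, List.In t ts -> forall i, pos [:: depth t] i -> List.In (tv t i) r.
  elim: ts IH tswf {wt tsn} => [|t ts IHts] IH tswf; first by exists [::].
  have [r hr] := IH t (or_introl erefl) (tswf t (or_introl erefl)).
  have [r' hr'] : exists r : seq Q, forall t, List.In t ts -> forall i, pos [:: depth t] i -> List.In (tv t i) r.
    by apply: IHts => u uts; [apply: IH|apply: tswf]; right.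
  exists (r ++ r') => u [<-|uts] i pi; apply: List.in_or_app; first by left; exact: hr.
  by right; exact: hr' uts _ pi.
have [dk dE] := deepestP tsn.
exists r => i /pos_split[n [x [-> px]]]; rewrite tv_node //; case: ifP => lt.
  by apply: hr; [exact: nthchild_In | case/andP: px => ok _; rewrite /pos ok].
by apply: hr; [exact: In_nth | rewrite dE].
Qed.

Lemma tv_indecomposable t : tree_wf t -> indecomposable le (TSeq [:: depth t] (tv t)).
Proof.
move=> wt d b okd okb dn dlt dadd.
have bE : b = [:: depth t].
  case: b dadd {okb} => [|x b] /= dadd; first by rewrite dadd cnf_lt_irr in dlt.
  by case: (filter _ _) dadd => [//|y [|z f]] [].
have pd : pos [:: depth t] d by rewrite /pos okd dlt.
rewrite {}bE; case: t wt pd {dlt dadd} => [q|ts] wt pd; first by move/pos0: pd.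
have [tsn tswf] := wf_nodeE wt; have [n [r [dE pr]]] := pos_split pd.
suff H : emb (seqT (Node ts)) (LSeq (pos [:: depth (Node ts)]) (fun i => tv (Node ts) (cnf_add d i))).
  exact: emb_trans (seqR_seqT wt) H.
apply: emb_trans (proj1 (seqT_node tsn)) _.
apply: (@emb_trans _ (lsum (fun _ => True) (fun n => seqR (nthchild ts n)))).
  apply: (@lsum_emb _ _ _ _ id) => // m _; exact: seqT_seqR (wf_nthchild m wt).
pose e := maxdepth ts; pose k := size ts; have ks : 0 < k by exact: size_gt0.
have wide m x : pos [:: depth (nthchild ts m)] x -> pos [:: e] x.
  by apply: pos_widen; apply: depth_le_max; exact: nthchild_In.
(* Adding [d], that is [omega^e * n + r], on the left absorbs [r] and leads to block
   [m + (n + 1) * k], which copies the same child as block [m]. *)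
exists (fun i => match i with [::] => [::] | m :: x => nseq (m + n.+1 * k - n) e ++ x end).
have nk : n < n.+1 * k by rewrite -{1}[n.+1]muln1 leq_mul2l ks orbT.
split=> [[//|m x] [_ px]|[//|m x] [//|m' x'] [_ px] [_ px']]; last first.
  rewrite cnf_lt_join; [| exact: wide px | exact: wide px'] => /=.
  have h a : n <= a + n.+1 * k by apply: leq_trans (ltnW nk) (leq_addl _ _).
  rewrite ltn_subLR // subnKC // ltn_add2r.
  case/orP => [->//|/andP[/eqP -> ->]]; by rewrite eqxx orbT.
split; first by apply: pos_join; exact: wide px.
have -> : lval (LSeq (pos [:: depth (Node ts)]) (fun i => tv (Node ts) (cnf_add d i)))
    (nseq (m + n.+1 * k - n) e ++ x) = tv (Node ts) (nseq (m + n.+1 * k) e ++ x).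
  rewrite /lval; congr tv.
  have : 0 < m + n.+1 * k - n by rewrite subn_gt0; apply: leq_trans nk (leq_addl _ _).
  have E : nseq (m + n.+1 * k) e = nseq n e ++ nseq (m + n.+1 * k - n) e.
    by rewrite -nseqD subnKC //; apply: leq_trans (ltnW nk) (leq_addl _ _).
  case: (m + n.+1 * k - n) E => // u E _; rewrite E -catA /= dE filter_cat.
  have -> : [seq a <- nseq n e | e <= a] = nseq n e.
    by apply/all_filterP; apply/allP => a /nseqP[-> _] /=.
  have -> : [seq a <- r | e <= a] = [::].
    apply/eqP; rewrite -[_ == _]negbK -has_filter; apply/hasPn => a ar.
    by move: pr; rewrite posE => /andP[_ /allP/(_ a ar)]; rewrite -ltnNge.
  by rewrite cats0.
rewrite tv_node //; last exact: wide px.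
have -> : nthchild ts (m + n.+1 * k) = nthchild ts m by rewrite /nthchild addnC modnMDl.
by case/andP: (px) => _ ->.
Qed.

(** * Sequences decomposed into trees *)

Definition listT ts : lseq Q := lsum (fun n => n < size ts) (fun n => seqT (nthT ts n)).
Definition equiv (A B : lseq Q) : Prop := emb A B /\ emb B A.

Lemma equiv_trans A B C : equiv A B -> equiv B C -> equiv A C.
Proof. by move=> [h1 h2] [h3 h4]; split; [exact: emb_trans h1 h3 | exact: emb_trans h4 h2]. Qed.

Lemma equiv_lsum A B : (forall n, equiv (A n) (B n)) ->
  equiv (lsum (fun _ => True) A) (lsum (fun _ => True) B).
Proof. by move=> H; split; apply: (@lsum_emb _ _ _ _ id) => // n _; case: (H n). Qed.

Lemma equiv_blocks e v : equiv (LSeq (pos [:: e.+1]) v)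
  (lsum (fun _ => True) (fun n => LSeq (pos [:: e]) (fun r => v (nseq n e ++ r)))).
Proof.
split.
  exists (fun i => copies e i :: remainder e i).
  split=> [i /pos_split[n [r [-> pr]]]|i j /pos_split[n [r [-> pr]]] /pos_split[m [r' [-> pr']]]].
    by rewrite copies_cat // remainder_cat.
  by rewrite cnf_lt_join // !copies_cat // !remainder_cat.
exists (fun i => match i with [::] => [::] | n :: r => nseq n e ++ r end).
split=> [[//|n r] [_ pr]|[//|n r] [//|m r'] [_ pr] [_ pr']]; first by split=> //; exact: pos_join.
by rewrite cnf_lt_join.
Qed.

Section Flatten.
Variable l : nat -> seq (tree Q).
Hypothesis l_nonempty : forall n, l n <> nil.

Fixpoint offset n : nat := if n is m.+1 then offset m + size (l m) else 0.

Lemma offset_lt n m : n < m -> offset n + size (l n) <= offset m.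
Proof.
elim: m => // m IH; rewrite ltnS leq_eqVlt => /orP[/eqP ->//|/IH h] /=.
exact: leq_trans h (leq_addr _ _).
Qed.

Lemma offset_lex n a m b : a < size (l n) -> n < m \/ n = m /\ a < b -> offset n + a < offset m + b.
Proof.
move=> an [nm|[-> ab]]; last by rewrite ltn_add2l.
apply: leq_trans (leq_addr _ _); apply: leq_trans (offset_lt nm); by rewrite ltn_add2l.
Qed.

Lemma offset_lex_inv n a m b : b < size (l m) -> offset n + a < offset m + b ->
  n < m \/ n = m /\ a < b.
Proof.
move=> bm lt; case: (ltngtP n m) => [|mn|E]; [by left| |by subst m; right; rewrite ltn_add2l in lt].
by have := ltn_trans lt (@offset_lex m b n a bm (or_introl mn)); rewrite ltnn.
Qed.

Lemma offset_inj n a m b : a < size (l n) -> b < size (l m) -> offset n + a = offset m + b ->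
  n = m /\ a = b.
Proof.
move=> an bm E; case: (ltngtP n m) => [nm|mn|E'].
- by have := offset_lex an (or_introl nm : n < m \/ n = m /\ a < b); rewrite E ltnn.
- by have := offset_lex bm (or_introl mn : m < n \/ m = n /\ b < a); rewrite E ltnn.
- by subst m; move/addnI: E.
Qed.

Lemma offset_cover x : exists na : nat * nat, na.2 < size (l na.1) /\ x = offset na.1 + na.2.
Proof.
elim: x => [|x [[n a] /= [an xE]]]; first by exists (0, 0) => /=; rewrite size_gt0.
case: (ltnP a.+1 (size (l n))) => h; first by exists (n, a.+1) => /=; rewrite addnS xE.
exists (n.+1, 0) => /=; rewrite addn0 size_gt0 //; split=> //.
by rewrite xE -addnS; congr (_ + _); apply/eqP; rewrite eqn_leq an h.
Qed.

Lemma equiv_flatten : exists u : nat -> tree Q,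
  (forall x, exists n, List.In (u x) (l n)) /\
  equiv (lsum (fun _ => True) (fun n => listT (l n))) (lsum (fun _ => True) (fun x => seqT (u x))).
Proof.
have [dec Hdec] := choice_fun offset_cover.
pose u x := nthT (l (dec x).1) (dec x).2.
have uE n a : a < size (l n) -> u (offset n + a) = nthT (l n) a.
  move=> an; have [h1 h2] := Hdec (offset n + a).
  by rewrite /u; have [<- <-] := offset_inj an h1 h2.
exists u; split=> [x|].
  by exists (dec x).1; apply: In_nth; case: (Hdec x).
split.
  exists (fun i => match i with n :: a :: p => offset n + a :: p | _ => [::] end).
  have domE i : ldom (lsum (fun _ => True) (fun n => listT (l n))) i ->
      exists n a p, [/\ i = n :: a :: p, a < size (l n) & sdom (nthT (l n) a) p].
    by case: i => [|n [|a p]] //; [move=> [_ []] | move=> [_ [an ap]]; exists n, a, p].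
  split=> [i /domE[n [a [p [-> an ap]]]]|i j /domE[n [a [p [-> an ap]]]] /domE[m [b [p' [-> bm bp]]]]].
    by rewrite /= uE.
  move=> /= /orP[nm|/andP[/eqP E /orP[ab|/andP[/eqP E' pp]]]].
  - by rewrite (offset_lex an) //; left.
  - by rewrite (offset_lex an) //; right.
  - by subst m b; rewrite ltnn eqxx.
exists (fun i => match i with x :: p => (dec x).1 :: (dec x).2 :: p | _ => [::] end).
split=> [[//|x p] [_ hp]|[//|x p] [//|y p'] [_ hp] [_ hp']] /=.
  by case: (Hdec x).
case/orP => [xy|/andP[/eqP <- ->]]; last by rewrite !eqxx !ltnn.
have [h1 h2] := Hdec x; have [h3 h4] := Hdec y; rewrite h2 h4 in xy.
by case: (offset_lex_inv h3 xy) => [->//|[-> ->]]; rewrite eqxx orbT.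
Qed.
End Flatten.

(** A finite stock containing, up to order and repetition, every set of trees from [F] that can
    recur. *)
Definition sublists (F : seq (tree Q)) : seq (seq (tree Q)) :=
  foldr (fun t acc => map (cons t) acc ++ acc) [:: [::]] F.

Lemma sublists_filter (P : tree Q -> Prop) F : exists2 J, List.In J (sublists F) &
  forall t, List.In t J <-> List.In t F /\ P t.
Proof.
elim: F => [|t F [J JF JP]]; first by exists [::]; [left|move=> t; split=> // -[]].
case: (classic (P t)) => Pt.
  exists (t :: J); first by apply: List.in_or_app; left; apply: In_map_intro.
  move=> u; split=> [[<-|/JP[]]|[[->|uF] Pu]]; [by split; [left|]|by split; [right|]|by left|].
  by right; apply/JP.
exists J; first by apply: List.in_or_app; right.
move=> u; split=> [/JP[uF Pu]|[[<-|uF] Pu]//]; [by split; [right|]|by apply/JP].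
Qed.

(** [J] collects the trees that occur infinitely often. Past some [N] only they occur, and that tail
    is equivalent to [Node J]. *)
Lemma equiv_periodic (u : nat -> tree Q) (F : seq (tree Q)) :
  (forall x, List.In (u x) F /\ tree_wf (u x)) ->
  exists N J, [/\ List.In J (sublists F), tree_wf (Node J) &
    equiv (lsum (fun _ => True) (fun x => seqT (u x))) (listT (rcons (mkseq u N) (Node J)))].
Proof.
move=> uF; pose P t := forall M, exists2 x, M <= x & u x = t.
have [J JF JP] := sublists_filter P F.
have [N HN] : exists N, forall t, List.In t F -> ~ P t -> forall x, N <= x -> u x <> t.
  elim: (F) => [|t F' [N HN]]; first by exists 0.
  have [M HM] : exists M, ~ P t -> forall x, M <= x -> u x <> t.
    case: (classic (P t)) => [|nP]; first by exists 0.
    have [M HM] := not_all_ex_not _ _ nP; exists M => _ x Mx E; apply: HM; by exists x.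
  exists (maxn M N) => s [<-|sF] nP x; rewrite geq_max => /andP[Mx Nx]; first exact: HM.
  exact: HN.
have uJ x : N <= x -> List.In (u x) J.
  move=> Nx; apply/JP; have [h _] := uF x; split=> //; apply: NNPP => nP.
  exact: HN h nP x Nx erefl.
have Jn : J <> nil by move=> E; have := uJ N (leqnn N); rewrite E.
have Jwf : tree_wf (Node J).
  constructor=> // t /JP[_ /(_ 0)[x _ <-]]; by case: (uF x).
have ks := size_gt0 Jn; exists N, J; split=> //.
have sz : size (rcons (mkseq u N) (Node J)) = N.+1 by rewrite size_rcons size_mkseq.
have nthlt x : x < N -> nthT (rcons (mkseq u N) (Node J)) x = u x.
  by move=> xN; rewrite nth_rcons size_mkseq xN nth_mkseq.
have nthN : nthT (rcons (mkseq u N) (Node J)) N = Node J.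
  by rewrite nth_rcons size_mkseq ltnn eqxx.
split.
  have [idx Hidx] : exists idx : nat -> nat, forall x, N <= x -> idx x < size J /\ nthT J (idx x) = u x.
    apply: (@choice_fun _ _ (fun x i => N <= x -> i < size J /\ nthT J i = u x)) => x.
    case: (leqP N x) => Nx; last by exists 0.
    by have [i h1 h2] := In_index (uJ x Nx); exists i.
  exists (fun i => match i with [::] => [::] | x :: p =>
    if x < N then x :: p else N :: (x * size J + idx x) :: p end).
  split=> [[//|x p] [_ hp]|[//|x p] [//|y p'] [_ hp] [_ hp']].
    case: ltnP => xN; first by rewrite /= sz nthlt // ltnS (ltnW xN).
    have [h1 h2] := Hidx x xN.
    have cE : nthchild J (x * size J + idx x) = u x by rewrite nthchild_addmul.
    split; first by split; [rewrite sz | rewrite nthN [ldom _ _]sdom_node // cE].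
    rewrite [X in le _ X](_ : _ = slab (u x) p) //.
    by rewrite [lval _ _]/= nthN slab_node // cE.
  move=> /= lt; case: (ltnP x N) => xN; case: (ltnP y N) => yN //=.
  - by rewrite xN.
  - case/orP: lt => [xy|/andP[/eqP E _]]; last by rewrite E leqNgt yN in xN.
    by have := leq_trans (ltn_trans xy yN) xN; rewrite ltnn.
  - rewrite ltnn eqxx /=; case/orP: lt => [xy|/andP[/eqP <- ->]]; last by rewrite eqxx orbT.
    apply/orP; left; apply: (@leq_trans (x.+1 * size J)).
      by rewrite mulSn addnC ltn_add2r; case: (Hidx x xN).
    by apply: leq_trans (leq_addr _ _); rewrite leq_mul2r xy orbT.
have [nx Hnx] : exists nx : nat * nat -> nat, forall c, c.2 <= nx c /\ u (nx c) = nthchild J c.1.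
  apply: (@choice_fun _ _ (fun c x => c.2 <= x /\ u x = nthchild J c.1)) => c.
  have /JP[_ /(_ c.2)[x h1 h2]] := nthchild_In c.1 Jn; by exists x.
(* A greedy choice: [y j] is an index beyond all earlier ones at which the [j]-th child of the
   periodic sequence occurs. *)
pose fix y (j : nat) : nat := if j is i.+1 then nx (j, (y i).+1) else nx (0, N).
have yu j : u (y j) = nthchild J j by case: j => [|j]; [case: (Hnx (0, N)) | case: (Hnx (j.+1, (y j).+1))].
have yS j : y j < y j.+1 by case: (Hnx (j.+1, (y j).+1)).
have ymono i j : i < j -> y i < y j.
  elim: j => // j IH; rewrite ltnS leq_eqVlt => /orP[/eqP ->|/IH h]; first exact: yS.
  exact: ltn_trans h (yS j).
have yN j : N <= y j.
  case: j => [|j]; first by case: (Hnx (0, N)).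
  apply: leq_trans (ltnW (ymono 0 j.+1 erefl)); by case: (Hnx (0, N)).
exists (fun i => match i with
  | [::] => [::]
  | x :: p => if x < N then x :: p else if p is j :: p' then y j :: p' else [::] end).
have split_dom i : ldom (listT (rcons (mkseq u N) (Node J))) i ->
    (exists x p, [/\ i = x :: p, x < N, sdom (u x) p & lval (listT (rcons (mkseq u N) (Node J))) i = slab (u x) p]) \/
    (exists j p, [/\ i = N :: j :: p, sdom (u (y j)) p &
       lval (listT (rcons (mkseq u N) (Node J))) i = slab (u (y j)) p]).
  case: i => // x p [xN hp]; rewrite sz ltnS leq_eqVlt in xN.
  case/orP: xN => [/eqP E|xN]; last first.
    by left; exists x, p; rewrite -(nthlt x xN).
  subst x; move: hp; rewrite nthN; case: p => // j p; rewrite [ldom _ _]sdom_node // => hp.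
  right; exists j, p; rewrite yu; split=> //.
  by rewrite [lval _ _]/= nthN slab_node.
split=> [i /split_dom[[x [p [-> xN hp ->]]]|[j [p [-> hp ->]]]]|i i'].
- by rewrite xN.
- by rewrite ltnn.
move=> /split_dom[[x [p [-> xN hp _]]]|[j [p [-> hp _]]]].
all: move=> /split_dom[[x' [p' [-> xN' hp' _]]]|[j' [p' [-> hp' _]]]].
- by rewrite xN xN'.
- by move=> _; rewrite xN ltnn /= (leq_trans xN (yN j')).
- rewrite /= => /orP[|/andP[/eqP E _]]; first by rewrite ltnNge (ltnW xN').
  by rewrite -E ltnn in xN'.
rewrite ltnn /= ltnn eqxx /= => /orP[jj|/andP[/eqP <- ->]]; first by rewrite ymono.
by rewrite eqxx orbT.
Qed.

(** [F] is chosen before [v]: the infinitely many blocks of a longer sequence must draw their trees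
    from one finite set for [equiv_periodic] to apply. *)
Lemma decompose e (r : seq Q) : exists F : seq (tree Q), forall v,
  (forall i, pos [:: e] i -> List.In (v i) r) -> exists ts, [/\ ts <> nil,
    forall t, List.In t ts -> List.In t F /\ tree_wf t & equiv (LSeq (pos [:: e]) v) (listT ts)].
Proof.
elim: e => [|e [F HF]].
  exists (map Leaf r) => v hv; exists [:: Leaf (v [::])]; split=> //.
    by move=> t [<-|//]; split; [apply: In_map_intro; exact: hv | constructor].
  split; first by exists (fun _ => [:: 0]); split=> [i /pos0 ->|i j /pos0 -> /pos0 ->].
  have domE i : ldom (listT [:: Leaf (v [::])]) i -> i = [:: 0].
    by case: i => [//|[|n] p] [//= _ ->].
  by exists (fun _ => [::]); split=> [i /domE ->|i j /domE -> /domE ->].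
exists (F ++ map Node (sublists F)) => v hv.
have [l Hl] : exists l : nat -> seq (tree Q), forall n, [/\ l n <> nil,
    forall t, List.In t (l n) -> List.In t F /\ tree_wf t &
    equiv (LSeq (pos [:: e]) (fun x => v (nseq n e ++ x))) (listT (l n))].
  apply: (@choice_fun _ _ (fun n l => [/\ l <> nil,
    forall t, List.In t l -> List.In t F /\ tree_wf t &
    equiv (LSeq (pos [:: e]) (fun x => v (nseq n e ++ x))) (listT l)])) => n.
  by apply: HF => i pi; apply: hv; exact: pos_join.
have ln n : l n <> nil by case: (Hl n).
have [u [ul ueq]] := equiv_flatten ln.
have uF x : List.In (u x) F /\ tree_wf (u x).
  by have [n un] := ul x; have [_ h _] := Hl n; exact: h.
have [N [J [JF Jwf Jeq]]] := equiv_periodic uF.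
exists (rcons (mkseq u N) (Node J)); split.
- by case: (mkseq _ _).
- move=> t; rewrite -cats1 => /(@List.in_app_or (tree Q))[|[<-|//]].
    by move=> /(@In_map_elim nat (tree Q))[x _ ->]; have [h1 h2] := uF x; split=> //; apply: List.in_or_app; left.
  by split=> //; apply: List.in_or_app; right; exact: In_map_intro.
apply: equiv_trans (equiv_blocks e v) _; apply: equiv_trans Jeq; apply: equiv_trans ueq.
by apply: equiv_lsum => n; case: (Hl n).
Qed.

Lemma listT_last ts A : (exists i, ldom A i) -> (forall i, ldom A i -> emb A (above A i)) ->
  (forall t, List.In t ts -> tree_wf t) -> equiv A (listT ts) ->
  exists2 t, tree_wf t & equiv A (seqT t).
Proof.
move=> [i0 Ai0] Aind; elim/last_ind: ts => [|ts t IH] tswf [[g [g1 g2]] back].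
  by have [] := g1 i0 Ai0; case: (g i0) => // n p [].
have wt : tree_wf t by apply: tswf; rewrite -cats1; apply: List.in_or_app; right; left.
have nthlast : nthT (rcons ts t) (size ts) = t by rewrite nth_rcons ltnn eqxx.
have nthlt n : n < size ts -> nthT (rcons ts t) n = nthT ts n by move=> h; rewrite nth_rcons h.
case: (classic (exists i p, ldom A i /\ g i = size ts :: p)) => [[i [p [Ai gi]]]|none].
  exists t => //; split.
    apply: emb_trans (Aind i Ai) _.
    have key j : ldom A j -> i = j \/ cnf_lt i j -> g j = size ts :: behead (g j).
      move=> Aj [<-|ij]; first by rewrite gi.
      have := g2 i j Ai Aj ij; have [] := g1 j Aj; rewrite gi.
      case: (g j) => // n p' [nts _] _ /=; rewrite size_rcons ltnS in nts.
      case/orP => [h|/andP[/eqP -> //]].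
      by have := leq_trans h nts; rewrite ltnn.
    exists (fun j => behead (g j)); split=> [j [Aj ij]|j j' [Aj ij] [Aj' ij'] lt].
      by have := g1 j Aj; rewrite (key j Aj ij) /= nthlast => -[[]].
    by have := g2 j j' Aj Aj' lt; rewrite (key j Aj ij) (key j' Aj' ij') /= ltnn eqxx.
  apply: emb_trans back; exists (fun p' => size ts :: p'); split=> [p' hp'|p' p'' _ _ lt] /=.
    by rewrite nthlast size_rcons.
  by rewrite eqxx lt orbT.
apply: IH; first by move=> s sts; apply: tswf; rewrite -cats1; apply: List.in_or_app; left.
split.
  exists g; split=> // i Ai; have [] := g1 i Ai.
  case E : (g i) => [//|n p] [nts hp]; rewrite size_rcons ltnS leq_eqVlt in nts.
  case/orP: nts => [/eqP nE|nts]; first by case: none; exists i, p; rewrite E nE.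
  by move: hp; rewrite /= nthlt.
apply: emb_trans back; apply: emb_sub => -[//|n p] [nts hp].
by rewrite /= nthlt // size_rcons ltnS (ltnW nts).
Qed.

Lemma filter_prefix a i : cnf_ok i -> exists2 r, i = [seq x <- i | a <= x] ++ r & all (fun x => x < a) r.
Proof.
elim: i => [|x i IH]; first by exists [::].
rewrite cnf_ok_cons => /andP[/allP xi ok] /=; case: leqP => ax.
  by have [r {1}-> ra] := IH ok; exists r.
exists (x :: i); last by rewrite /= ax; apply/allP => y /xi yx; exact: leq_ltn_trans yx ax.
have -> // : [seq y <- i | a <= y] = [::].
apply/eqP; rewrite -[_ == _]negbK -has_filter; apply/hasPn => y /xi yx.
by rewrite -ltnNge; exact: leq_ltn_trans yx ax.
Qed.

Lemma small_lt a r x : all (fun x => x < a) r -> cnf_lt r (a :: x).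
Proof. by case: r => //= y r /andP[->]. Qed.

Lemma cnf_add_pos e i j : pos [:: e] i -> pos [:: e] j -> pos [:: e] (cnf_add i j).
Proof.
rewrite !posE => /andP[oki /allP hi] /andP[okj /allP hj].
case: j okj hj => [|a j] okj hj /=; first by rewrite oki; apply/allP.
rewrite cnf_ok_cat okj all_cat; apply/andP; split.
  rewrite andbT; apply/andP; split.
    apply/allrelP => x y; rewrite mem_filter => /andP[ax _]; rewrite inE => /orP[/eqP -> //|yj] /=.
    move: okj; rewrite cnf_ok_cons => /andP[/allP/(_ y yj) ya _]; exact: leq_trans ya ax.
  by rewrite cnf_okE; apply: pairwise_filter; rewrite -cnf_okE.
apply/andP; split; last by apply/allP.
by apply/allP => x; rewrite mem_filter => /andP[_ /hi].
Qed.

Lemma cnf_add_ge i j : cnf_ok i -> i = cnf_add i j \/ cnf_lt i (cnf_add i j).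
Proof.
case: j => [|a j] ok; first by left.
have [r E ra] := filter_prefix a ok; right; rewrite /= {1}E cnf_lt_cat; exact: small_lt.
Qed.

Lemma cnf_add_lt i j k : cnf_ok i -> cnf_lt j k -> cnf_lt (cnf_add i j) (cnf_add i k).
Proof.
move=> ok; case: k => [|b k]; first by rewrite cnf_lt0.
have [r E rb] := filter_prefix b ok; case: j => [|a j] /=.
  by move=> _; rewrite {1}E cnf_lt_cat; exact: small_lt.
case/orP => [ab|/andP[/eqP <- jk]]; last by rewrite cnf_lt_cat /= jk eqxx orbT.
rewrite {1}E filter_cat -filter_predI.
have -> : [seq x <- i | predI (fun x => a <= x) (fun x => b <= x) x] = [seq x <- i | b <= x].
  apply: eq_filter => x /=; case: (leqP b x) => bx; last by rewrite andbF.
  by rewrite (leq_trans (ltnW ab) bx).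
rewrite -catA cnf_lt_cat.
have : all (fun x => x < b) [seq x <- r | a <= x].
  by apply/allP => x; rewrite mem_filter => /andP[_ /(allP rb)].
by case: (filter _ r) => [_ /=|x r' /= /andP[-> _] //]; rewrite ab.
Qed.

Definition lseq_of (s : tseq Q) : lseq Q := LSeq (pos (tlen s)) (Defs.tval s).

Lemma iF_tree (s : tseq Q) : tseq_valid s -> finite_range s -> indecomposable le s ->
  exists2 t, tree_wf t & equiv (lseq_of s) (seqT t).
Proof.
case: s => len v [/= oklen lenn] [r hr] ind.
(* With [e] the last exponent of the length, the final stretch of length [omega^e] is a tail, so it
   is equivalent to the whole sequence and only it needs decomposing. *)
case/lastP: len oklen lenn hr ind => [//|d e] okd _ hr ind; rewrite /= in hr.
pose A := LSeq (pos [:: e]) (fun x => v (d ++ x)).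
pose S := LSeq (pos (rcons d e)) v.
have [de okd'] : all (fun a => e <= a) d /\ cnf_ok d.
  move: okd; rewrite -cats1 cnf_ok_cat => /and3P[/allrelP h -> _]; split=> //.
  by apply/allP => a ad; apply: h ad _; rewrite inE.
have joinok x : pos [:: e] x -> cnf_ok (d ++ x).
  rewrite posE => /andP[okx /allP hx]; rewrite cnf_ok_cat okd' okx !andbT.
  apply/allrelP => a b ad bx; apply: leq_trans (ltnW (hx b bx)) _; exact: (allP de).
have join x : pos [:: e] x -> pos (rcons d e) (d ++ x).
  move=> px; rewrite /pos joinok //= -cats1 cnf_lt_cat.
  by case/andP: px.
have AS : emb A S.
  exists (cat d); split=> [x px|x y _ _]; first by split; [exact: join | exact: le_refl].
  by rewrite cnf_lt_cat.
have SA i : pos [:: e] i -> emb S (above A i).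
  move=> pi; have oki : cnf_ok i by case/andP: pi.
  (* Here the tail is the whole sequence, which [indecomposable] does not cover because it speaks of
     proper tails. *)
  case: (classic (d ++ i = [::])) => [E|ne].
    have [dE iE] : d = [::] /\ i = [::] by case: (d) (i) E => [|? ?] [|? ?].
    apply: emb_sub => x px; rewrite /S /A /= dE in px *; split=> //; split=> //.
    by rewrite iE; case: x {px} => [|? ?]; [left|right].
  have addE : cnf_add (d ++ i) [:: e] = rcons d e.
    rewrite /= filter_cat (all_filterP de) -cats1.
    have -> : [seq a <- i | e <= a] = [::]; last by rewrite cats0.
    apply/eqP; rewrite -[_ == _]negbK -has_filter; apply/hasPn => a ai.
    by move: pi; rewrite posE => /andP[_ /allP/(_ a ai)]; rewrite -ltnNge.
  have lt : cnf_lt (d ++ i) (rcons d e) by case/andP: (join i pi).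
  have H := ind _ [:: e] (joinok i pi) erefl ne lt addE.
  apply: (@emb_trans _ (LSeq (pos [:: e]) (fun j => v (cnf_add (d ++ i) j)))); first exact: H.
  exists (cnf_add i); split=> [j pj|j k pj pk]; last exact: cnf_add_lt.
  split; first by split; [exact: cnf_add_pos | exact: cnf_add_ge].
  have -> : lval (above A i) (cnf_add i j) = v (cnf_add (d ++ i) j); last exact: le_refl.
  rewrite /=; congr v; case: j pj => [//|a j] pj /=; rewrite catA filter_cat.
  have -> // : [seq x <- d | a <= x] = d.
  apply/all_filterP; apply/allP => x /(allP de) ex; apply: leq_trans ex.
  by move: (pj : pos [:: e] (a :: j)); rewrite posE => /andP[_ /= /andP[/ltnW]].
have [F HF] := decompose e r.
have [|ts [tsn tsF tseq]] := HF (fun x => v (d ++ x)).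
  by move=> i pi; apply: hr; exact: join.
have [|||t wt [At tA]] := @listT_last ts A _ _ _ tseq.
- by exists [::].
- by move=> i pi; apply: emb_trans AS (SA i pi).
- by move=> t /tsF[].
exists t => //; split; last exact: emb_trans tA AS.
by apply: emb_trans (SA [::] (pos_nil e)) _; apply: emb_trans (emb_above _ _) At.
Qed.

Lemma iF_Tf_reflect :
  (exists F : Tf Q -> iF le, forall x y, iF_le le (F x) (F y) -> Tf_le le x y) /\
  (exists F : iF le -> Tf Q, forall x y, Tf_le le (F x) (F y) -> iF_le le x y).
Proof.
split.
  have mk (x : Tf Q) : exists s : iF le, equiv (lseq_of (proj1_sig s))
      (seqT (proj1_sig x)).
    case: x => t wt.
    have P : tseq_valid (TSeq [:: depth t] (tv t)) /\ finite_range (TSeq [:: depth t] (tv t)) /\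
        indecomposable le (TSeq [:: depth t] (tv t)).
      by split=> //; split; [exact: tv_finite_range | exact: tv_indecomposable].
    by exists (exist (fun z : tseq Q => tseq_valid z /\ finite_range z /\ indecomposable le z) _ P); split; [exact: seqR_seqT | exact: seqT_seqR].
  have [F HF] := choice_fun mk; exists F => x y h.
  apply: emb_tle; [exact: proj2_sig x | exact: proj2_sig y|].
  apply: emb_trans (proj2 (HF x)) _; apply: emb_trans (proj1 (HF y)); exact: h.
have mk (s : iF le) : exists x : Tf Q, equiv (lseq_of (proj1_sig s))
    (seqT (proj1_sig x)).
  case: s => s [sv [sf si]]; have [t wt eqt] := iF_tree sv sf si.
  by exists (exist _ t wt).
have [F HF] := choice_fun mk; exists F => x y h.
change (emb (lseq_of (proj1_sig x)) (lseq_of (proj1_sig y))).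
apply: (@emb_trans _ (seqT (proj1_sig (F x)))); first exact: (proj1 (HF x)).
apply: emb_trans (proj2 (HF y)); apply: tle_emb h; [exact: proj2_sig (F x) | exact: proj2_sig (F y)].
Qed.
End Sequences.

(** * Maximal order types *)

Section Main.
Variables (Q : Type) (le : Q -> Q -> Prop).
Hypothesis le_wqo : wqo le.
Variable q0 : Q.
Let le_qo : quasi_order le := proj1 le_wqo.

Lemma Tf_rle d : rle (tree_le le) (@tin Q (fun _ => True)) d -> rle (Tf_le le) (fun _ => True) d.
Proof.
apply: (@rle_map _ _ _ _ (fun x : Tf Q => proj1_sig x)) => //; last exact: ord_le_refl.
by move=> [t wt] _; exact: tin_wf.
Qed.

Lemma Tf_rge d : rge (tree_le le) (@tin Q (fun _ => True)) d -> rge (Tf_le le) (fun _ => True) d.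
Proof.
(* A total map is required; the leaf [q0] is only a default for ill-formed trees. *)
pose F t : Tf Q := match excluded_middle_informative (tree_wf t) with
  | left w => exist _ t w
  | right _ => exist _ (Leaf q0) (twf_leaf q0)
  end.
have FE t : tin (fun _ => True) t -> proj1_sig (F t) = t.
  by move=> /wf_tin wt; rewrite /F; case: (excluded_middle_informative (tree_wf t)).
apply: (@rge_map _ _ _ _ F) => //; last exact: ord_le_refl.
by move=> s t /FE Es /FE Et; rewrite /Tf_le Es Et.
Qed.

Lemma Tf_wqo : wqo (Tf_le le).
Proof.
split=> [|s]; first exact: Tf_quasi_order.
(* Any bound of the form 2 + [b] makes [rle_trees_ebar] applicable; its rank bound then rules out
   bad sequences of trees. *)
have H : rle le (fun _ => True) (oadd (onat 2) (rk le_wqo (fun _ => True))).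
  by apply: rle_mono (oadd_le_r _ _) (rk_rle _ _).
by apply: (rle_no_bad_seq (Tf_rle (rle_trees_ebar le_qo H))).
Qed.

Lemma iF_wqo : wqo (iF_le le).
Proof.
split.
  split=> [x|x y z]; first by exists id; split=> // i pi; split=> //; case: le_qo.
  exact: (@emb_trans Q le le_qo (lseq_of (proj1_sig x)) (lseq_of (proj1_sig y)) (lseq_of (proj1_sig z))).
have [_ [F HF]] := iF_Tf_reflect le_qo q0 => s.
have [i [j [ij h]]] := proj2 Tf_wqo (F \o s).
by exists i, j; split=> //; exact: HF.
Qed.

Lemma iF_Tf_otype : ord_eq (max_otype (iF_le le)) (max_otype (Tf_le le)).
Proof.
have [[F HF] [G HG]] := iF_Tf_reflect le_qo q0.
split; [exact: max_otype_reflect Tf_wqo HG | exact: max_otype_reflect iF_wqo HF].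
Qed.

Lemma Tf_otype_one : ord_eq (max_otype le) (onat 1) -> ord_eq (max_otype (Tf_le le)) oomega.
Proof.
move=> [le1 _]; split.
  apply: max_otype_le; apply: Tf_rle; apply: rle_trees_one => //.
  exact: rle_mono le1 (max_otype_rle le_wqo).
apply: max_otype_ge; first exact: Tf_wqo.
by apply: Tf_rge; exact: (rge_spines le q0).
Qed.

Lemma Tf_otype_ebar b : ord_eq (oadd (onat 2) b) (max_otype le) ->
  ord_eq (max_otype (Tf_le le)) (ebar b).
Proof.
move=> [b1 b2]; split.
  apply: max_otype_le; apply: Tf_rle; apply: rle_trees_ebar => //.
  exact: rle_mono b2 (max_otype_rle le_wqo).
apply: max_otype_ge; first exact: Tf_wqo.
apply: Tf_rge; have [rho [mono surj _]] := max_rank_function le_wqo.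
apply: (rge_trees_ebar le_qo mono) => a ab; apply: surj; apply: olt_le_trans ab _.
exact: ord_le_trans b1 (proj1 (max_otype_rk le_wqo)).
Qed.
End Main.

Lemma g_spec_eq a d d' : ord_eq d d' -> g_spec a d -> g_spec a d'.
Proof.
move=> dd [h1 h2]; have step x : ord_eq d x -> ord_eq d' x.
  by apply: ord_eq_trans; exact: ord_eq_sym.
split=> [/h1/step//|b /h2[h3 h4]]; split=> [/h3/step|/h4/step] //.
Qed.

Theorem theorem4p27 (Q : Type) (le : Q -> Q -> Prop) :
  wqo le -> inhabited Q ->
  ord_eq (max_otype (iF_le le)) (max_otype (Tf_le le)) /\
  g_spec (max_otype le) (max_otype (iF_le le)) /\
  g_spec (max_otype le) (max_otype (Tf_le le)).
Proof.
move=> le_wqo [q0]; have E := iF_Tf_otype le_wqo q0.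
suff H : g_spec (max_otype le) (max_otype (Tf_le le)).
  by split=> //; split=> //; apply: g_spec_eq H; exact: ord_eq_sym.
split=> [|b /(Tf_otype_ebar le_wqo q0)]; first exact: Tf_otype_one.
by rewrite /ebar; case: (excluded_middle_informative (eps_overshoot b)).
Qed.
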